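(* For every $n\ge1$ there is an $n$-dimensional slit Sierpi\'nski space $X=M(\mathcal{S})$ (corresponding to a sequence of slits $\mathcal{S}$ in a bounded open box of $\mathbb{R}^{n+1}$) which is not porous, but is quasisymmetrically co-Hopfian.
   Context: QS co-Hopfian. A homeomorphism $f:(X,d_X)\to(Y,d_Y)$ is quasisymmetric (QS) if there is an increasing $\eta:[0,\infty)\to[0,\infty)$ with $\frac{d_Y(f(x),f(y))}{d_Y(f(y),f(z))}\le \eta\left(\frac{d_X(x,y)}{d_X(y,z)}\right)$ for all distinct $x,y,z\in X$. A QS embedding is a QS homeomorphism onto its image. A metric space $X$ is quasisymmetrically (QS) co-Hopfian if every QS embedding of $X$ into itself is onto. Slits. Let $N\ge2$ and let $I=(a_1,b_1)\times\cdots\times(a_N,b_N)\subset\mathbb{R}^N$ be a bounded open box. A slit in $I$ is a set $s=\{x\}\times[c_2,d_2]\times\cdots\times[c_N,d_N]\subset I$ with $d_2-c_2=\dots=d_N-c_N=:l(s)>0$. Consider a sequence $\mathcal{S}=\{s_i\}_{i\ge1}$ of pairwise disjoint slits in $I$ satisfying: ($\mathcal{S}_1$) the slits are uniformly relatively separated in $I$: there is $\sigma>0$ with $\Delta(s_i,s_j)\ge\sigma$ and $\Delta(s_i,\partial I)\ge\sigma$ for all $i\ne j$, where $\Delta(E,F)=\mathrm{dist}(E,F)/\min(\mathrm{diam}\,E,\mathrm{diam}\,F)$; ($\mathcal{S}_2$) $\mathrm{diam}(s_i)\to0$ as $i\to\infty$; ($\mathcal{S}_3$) $\bigcup_i s_i$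 is dense in $I$. (These are standing assumptions for slit Sierpi\'nski spaces.) Slit Sierpi\'nski space. Put $S_0=I$, $S_i=I\setminus\bigcup_{j\le i}s_j$, and let $(\overline{M}_i,d_{\overline{M}_i})$ be the completion of $S_i$ in its inner (path) metric ($d(x,y)$ = infimum of Euclidean lengths of curves in $S_i$ joining $x,y$), with $\overline{M}_0=\overline I$. For $i\le j$ let $\tau_{i,j}:\overline{M}_j\to\overline{M}_i$ be the $1$-Lipschitz extension of the inclusion $S_j\subset S_i$; it identifies the points of $\overline{M}_j$ that correspond to the same point of $\overline{M}_i$. Then $M(\mathcal{S})=\varprojlim(\overline{M}_i,\tau_{i,j})$, with metric $d_{\mathcal{S}}(p,q)=\lim_i d_{\overline{M}_i}(p_i,q_i)$ for $p=(p_i)$, $q=(q_i)$, is the slit Sierpi\'nski space corresponding to $\mathcal{S}$; it has topological dimension $N-1$, and is called $(N-1)$-dimensional. Let $\tau_0:M(\mathcal{S})\to\overline I$, $p\mapsto p_0$. The peripheral spheres of $M(\mathcal{S})$ are the sets $\tau_0^{-1}(s_i)$ and the outer boundary $\tau_0^{-1}(\partial I)$; they are topological $(N-1)$-spheres. Porosity. $X=M(\mathcal{S})$ is porous if there is $A<\infty$ such that every ball $B(x,r)\subset X$, $x\in X$, $0<r<\mathrm{diam}\,X$, contains a peripheral sphere $S$ with $\mathrm{diam}(S)\ge r/A$. *)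

(* Defs.v *)
From HB Require Import structures.
From mathcomp Require Import all_boot all_order all_algebra generic_quotient.
From mathcomp Require Import all_classical all_reals all_analysis.
From mathcomp Require Import ring lra.

Set Implicit Arguments.
Unset Strict Implicit.
Unset Printing Implicit Defensive.

Import Order.TTheory GRing.Theory Num.Theory numFieldNormedType.Exports.

Local Open Scope classical_set_scope.
Local Open Scope ring_scope.

(* The library norm on 'rV[R]_N is the sup norm. It induces the same topology
   as the Euclidean distance below, so [continuous], [closure], [interior] and
   [lim] in 'rV[R]_N have their usual meaning. *)
Definition edist {R : realType} {N : nat} (x y : 'rV[R]_N) : R :=
  Num.sqrt (\sum_i (x 0 i - y 0 i) ^+ 2).

Section euclidean_distance.
Context {R : realType} {N : nat}.
Implicit Types (x y z : 'rV[R]_N).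

Lemma edist_ge0 x y : 0 <= edist x y.
Proof. exact: sqrtr_ge0. Qed.

Lemma edistxx x : edist x x = 0.
Proof. by rewrite /edist big1 ?sqrtr0// => i _; rewrite subrr expr0n. Qed.

Lemma edistC x y : edist x y = edist y x.
Proof. by congr Num.sqrt; apply: eq_bigr => i _; rewrite -sqrrN opprB. Qed.

Lemma edist_eq0 x y : edist x y = 0 -> x = y.
Proof.
move=> /eqP; rewrite sqrtr_eq0 => s0; apply/rowP => i.
have : (x 0 i - y 0 i) ^+ 2 <= 0.
  apply: le_trans s0; rewrite (bigD1 i)//= lerDl.
  by apply: sumr_ge0 => j _; exact: sqr_ge0.
by rewrite le_eqVlt ltNge sqr_ge0 orbF sqrf_eq0 subr_eq0 => /eqP.
Qed.

Lemma cauchy_schwarz (u v : 'I_N -> R) :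
  (\sum_i u i * v i) ^+ 2 <= (\sum_i u i ^+ 2) * (\sum_i v i ^+ 2).
Proof.
set A := \sum_i u i ^+ 2; set B := \sum_i v i ^+ 2; set C := \sum_i u i * v i.
have B0 : 0 <= B by apply: sumr_ge0 => i _; exact: sqr_ge0.
have [Bpos|Bneg] := ltP 0 B; last first.
  have Beq : B = 0 by apply/eqP; rewrite eq_le Bneg B0.
  suff -> : C = 0 by rewrite expr0n Beq mulr0.
  rewrite /C big1// => i _.
  have : v i ^+ 2 <= 0.
    by rewrite -Beq /B (bigD1 i)//= lerDl; apply: sumr_ge0 => j _; exact: sqr_ge0.
  by rewrite le_eqVlt ltNge sqr_ge0 orbF sqrf_eq0 => /eqP ->; rewrite mulr0.
have : 0 <= \sum_i (B * u i - C * v i) ^+ 2.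
  by apply: sumr_ge0 => i _; exact: sqr_ge0.
rewrite (_ : \sum_i _ = B * (A * B - C ^+ 2)); last first.
  transitivity (\sum_i (B ^+ 2 * u i ^+ 2 - 2 * B * C * (u i * v i)
                        + C ^+ 2 * v i ^+ 2)).
    by apply: eq_bigr => i _; ring.
  rewrite big_split/= big_split/= -!mulr_sumr sumrN -!mulr_sumr -/A -/B -/C.
  ring.
by rewrite pmulr_rge0// subr_ge0.
Qed.

Lemma edist_triangle y x z : edist x z <= edist x y + edist y z.
Proof.
pose u i := x 0 i - y 0 i; pose v i := y 0 i - z 0 i.
have hA : 0 <= \sum_i u i ^+ 2 by apply: sumr_ge0 => i _; exact: sqr_ge0.
have hB : 0 <= \sum_i v i ^+ 2 by apply: sumr_ge0 => i _; exact: sqr_ge0.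
rewrite -(@ler_pXn2r _ 2)// ?nnegrE ?addr_ge0 ?edist_ge0//.
rewrite sqrrD !sqr_sqrtr//; last by apply: sumr_ge0 => i _; exact: sqr_ge0.
rewrite (_ : \sum_i _ = \sum_i u i ^+ 2 + (\sum_i u i * v i) *+ 2
                        + \sum_i v i ^+ 2); last first.
  rewrite -sumrMnl -!big_split/=; apply: eq_bigr => i _.
  by rewrite /u /v; ring.
rewrite lerD2r lerD2l lerMn2r /=.
rewrite -sqrtrM//; apply: le_trans (ler_norm _) _.
by rewrite -sqrtr_sqr ler_sqrt ?mulr_ge0//; exact: cauchy_schwarz.
Qed.

End euclidean_distance.

Definition set_dist {R : realType} {T : Type} (d : T -> T -> R)
  (E F : set T) : R := inf [set d x y | x in E & y in F].

Definition diam {R : realType} {T : Type} (d : T -> T -> R) (E : set T) : R :=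
  sup [set d x y | x in E & y in E].

Definition rel_dist {R : realType} {N : nat} (E F : set 'rV[R]_N) : R :=
  set_dist edist E F / Num.min (diam edist E) (diam edist F).

Definition open_box {R : realType} {N : nat} (a b : 'rV[R]_N) : set 'rV[R]_N :=
  [set x | forall i, a 0 i < x 0 i < b 0 i].

Definition boundary {T : topologicalType} (A : set T) : set T :=
  closure A `\` interior A.

(* {c_0} x [c_1, c_1 + l] x ... x [c_n, c_n + l] *)
Definition slit {R : realType} {n : nat} (c : 'rV[R]_n.+1) (l : R) :
    set 'rV[R]_n.+1 :=
  [set x | x 0 0 = c 0 0 /\
           forall i, i != 0 -> c 0 i <= x 0 i <= c 0 i + l].

(* Slits in a bounded open box of R^(n+1). They are indexed from 0, so that
   [slits S i] is s_(i+1). *)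
Record slit_system (R : realType) (n : nat) := SlitSystem {
  box_lo : 'rV[R]_n.+1 ;
  box_hi : 'rV[R]_n.+1 ;
  slits : nat -> set 'rV[R]_n.+1 ;
  slit_system_dim : (1 < n.+1)%N ;
  box_lt : forall i, box_lo 0 i < box_hi 0 i ;
  slitsP : forall i, exists c l, 0 < l /\ slits i = slit c l ;
  slits_sub : forall i, slits i `<=` open_box box_lo box_hi ;
  slits_disjoint : forall i j, i != j -> slits i `&` slits j = set0 ;
  slits_separated : exists sigma : R, [/\ 0 < sigma,
    forall i j, i != j -> sigma <= rel_dist (slits i) (slits j) &
    forall i, sigma <= rel_dist (slits i) (boundary (open_box box_lo box_hi))] ;
  slits_diam_cvg0 : diam edist (slits i) @[i --> \oo] --> (0 : R) ;
  slits_dense :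
    open_box box_lo box_hi `<=` closure (\bigcup_i slits i)
}.

Definition box {R : realType} {n : nat} (S : slit_system R n) :=
  open_box (box_lo S) (box_hi S).

Section inner_metric.
Context {R : realType} {N : nat}.
Implicit Types (g : R -> 'rV[R]_N) (A : set 'rV[R]_N).

Definition polygon_length g (a : R) (s : seq R) : R :=
  \sum_(p <- zip (a :: s) s) edist (g p.1) (g p.2).

Definition curve_length g (a b : R) : \bar R :=
  ereal_sup [set (polygon_length g a s)%:E | s in itv_partition a b].

Definition curve_in A g (a b : R) (x y : 'rV[R]_N) : Prop :=
  [/\ a <= b, {within `[a, b], continuous g}, g @` `[a, b] `<=` A,
      g a = x & g b = y].

Definition inner_dist A (x y : 'rV[R]_N) : \bar R :=
  ereal_inf [set l | exists g a b, curve_in A g a b x y /\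
                                   l = curve_length g a b].

Lemma polygon_length_cons g a x s :
  polygon_length g a (x :: s) = edist (g a) (g x) + polygon_length g x s.
Proof. by rewrite /polygon_length/= big_cons. Qed.

Lemma polygon_length_nil g a : polygon_length g a [::] = 0.
Proof. by rewrite /polygon_length big_nil. Qed.

Lemma polygon_length_rcons g a s x :
  polygon_length g a (rcons s x) =
  polygon_length g a s + edist (g (last a s)) (g x).
Proof.
elim: s a => [|y s ih] a /=.
  by rewrite polygon_length_cons !polygon_length_nil addrC.
by rewrite !polygon_length_cons ih addrA.
Qed.

Lemma polygon_length_rev g a s :
  polygon_length g (last a s) (rev (belast a s)) = polygon_length g a s.
Proof.
elim: s a => [|x s ih] a //=; rewrite rev_cons polygon_length_rcons ih.
rewrite polygon_length_cons addrC; congr (_ + _).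
rewrite edistC; congr (edist _ (g _)).
by case: s {ih} => //= y s; rewrite rev_cons last_rcons.
Qed.

Lemma polygon_lengthN g a s :
  polygon_length (g \o -%R) a s = polygon_length g (- a) (map -%R s).
Proof.
elim: s a => [|x s ih] a /=; first by rewrite !polygon_length_nil.
by rewrite !polygon_length_cons ih.
Qed.

Lemma eq_polygon_length g h (s0 : R -> R) a s :
  (forall t, t \in a :: s -> g t = h (s0 t)) ->
  polygon_length g a s = polygon_length h (s0 a) (map s0 s).
Proof.
elim: s a => [|x s ih] a H /=; first by rewrite !polygon_length_nil.
rewrite !polygon_length_cons ih; last by move=> t ts; apply: H; rewrite inE ts orbT.
by rewrite !H// !inE eqxx ?orbT.
Qed.

Lemma polygon_length_ge0 g a s : 0 <= polygon_length g a s.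
Proof. by apply: sumr_ge0 => p _; exact: edist_ge0. Qed.

Lemma curve_length_ub g a b s : itv_partition a b s ->
  ((polygon_length g a s)%:E <= curve_length g a b)%E.
Proof. by move=> abs; apply: ereal_sup_ubound; exists s. Qed.

Lemma edist_le_curve_length g a b : a <= b ->
  ((edist (g a) (g b))%:E <= curve_length g a b)%E.
Proof.
rewrite le_eqVlt => /predU1P[->|ab].
  rewrite edistxx -(polygon_length_nil g b).
  by apply: curve_length_ub; split.
have := @curve_length_ub g a b [:: b].
rewrite polygon_length_cons polygon_length_nil addr0; apply.
exact: itv_partition1.
Qed.

Lemma edist_le_inner_dist A x y : ((edist x y)%:E <= inner_dist A x y)%E.
Proof.
apply: le_ereal_inf_tmp => _ [g [a [b [[ab _ _ <- <-] ->]]]].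
exact: edist_le_curve_length.
Qed.

Lemma inner_dist_ge0 A x y : (0 <= inner_dist A x y)%E.
Proof. by apply: le_trans (edist_le_inner_dist _ _ _); rewrite lee_fin edist_ge0. Qed.

Lemma itv_partition_sub (a b : R) s t : itv_partition a b s ->
  t \in a :: s -> a <= t <= b.
Proof.
elim: s a t => [|x s ih] a t [] /=.
  by move=> _ /eqP <-; rewrite inE => /eqP ->; rewrite lexx.
move=> /andP[ax xs] lb; rewrite inE => /predU1P[->|ts].
  have /andP[_ xb] := ih x x (conj xs lb) (mem_head _ _).
  by rewrite lexx (le_trans (ltW ax)).
have /andP[xt ->] := ih x t (conj xs lb) ts.
by rewrite andbT (le_trans (ltW ax)).
Qed.

Lemma within_continuous_precomp g (D E : set R) (f : R -> R) :
  continuous f -> (forall t, D t -> E (f t)) ->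
  {within E, continuous g} -> {within D, continuous (g \o f)}.
Proof.
move=> cf DE /subspace_continuousP cg; apply/subspace_continuousP => t Dt.
apply: cvg_comp (cg _ (DE t Dt)) => W /= /cf; rewrite /within /= !near_simpl.
by apply: filterS => u /= EW /DE.
Qed.

Lemma inner_dist_sym_le A x y : (inner_dist A x y <= inner_dist A y x)%E.
Proof.
apply: le_ereal_inf_tmp => _ [g [a [b [[ab cg gA ga gb] ->]]]].
have Nab t : `[- b, - a]%classic t -> `[a, b]%classic (- t).
  by rewrite /= !in_itv/= lerNr andbC lerNl.
apply: (@le_trans _ _ (curve_length (g \o -%R) (- b) (- a))).
  apply: ereal_inf_lbound; exists (g \o -%R), (- b), (- a); split => //.
  split => /=; rewrite ?opprK//; first by rewrite lerN2.
  - by apply: within_continuous_precomp cg => //; exact: oppr_continuous.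
  - by move=> _ [t /Nab tab <-]; apply: gA; exists (- t).
apply: ge_ereal_sup => _ [s sp <-].
have [_ /eqP lb] := sp.
have := curve_length_ub g (itv_partition_rev sp).
rewrite !opprK => /(le_trans _); apply; rewrite lee_fin polygon_lengthN opprK.
rewrite -(polygon_length_rev g b (map -%R s)).
suff -> : last b (map -%R s) = a by [].
by rewrite -{1}(opprK b) last_map lb opprK.
Qed.

Lemma inner_dist_sym A x y : inner_dist A x y = inner_dist A y x.
Proof. by apply/eqP; rewrite eq_le !inner_dist_sym_le. Qed.

Lemma polygon_length_split g a b c s : itv_partition a c s -> a <= b <= c ->
  exists s1 s2, [/\ itv_partition a b s1, itv_partition b c s2 &
    polygon_length g a s <= polygon_length g a s1 + polygon_length g b s2].
Proof.
elim: s a => [|x s ih] a [] /=.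
  move=> _ /eqP <- /le_anti <-; exists [::], [::].
  by rewrite polygon_length_nil addr0.
move=> /andP[ax xs] lc /andP[]; rewrite le_eqVlt => /predU1P[<- ac|ab bc].
  exists [::], (x :: s); rewrite polygon_length_nil add0r; split => //.
  by split => //=; rewrite ax.
have [xb|bx] := leP x b.
  have [|s1 [s2 [[p1 l1] p2 h]]] := ih x (conj xs lc); first by rewrite xb.
  exists (x :: s1), s2; split => //; first by split => //=; rewrite ax.
  by rewrite !polygon_length_cons -addrA lerD2l.
exists [:: b], (x :: s); split; first exact: itv_partition1.
  by split => //=; rewrite bx.
rewrite !polygon_length_cons polygon_length_nil addr0 addrA lerD2r.
exact: edist_triangle.
Qed.

Lemma inner_dist_triangle A y x z :
  (inner_dist A x z <= inner_dist A x y + inner_dist A y z)%E.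
Proof.
have [->|xy] := eqVneq (inner_dist A x y) +oo%E.
  by rewrite addye ?leey// gt_eqF// (lt_le_trans _ (inner_dist_ge0 _ _ _)).
have [->|yz] := eqVneq (inner_dist A y z) +oo%E.
  by rewrite addey ?leey// gt_eqF// (lt_le_trans _ (inner_dist_ge0 _ _ _)).
have xyf : inner_dist A x y \is a fin_num.
  by rewrite ge0_fin_numE ?inner_dist_ge0// ltey.
have yzf : inner_dist A y z \is a fin_num.
  by rewrite ge0_fin_numE ?inner_dist_ge0// ltey.
apply/lee_addgt0Pr => e e0; rewrite (splitr e) EFinD addeACA.
have e20 : 0 < e / 2 by rewrite divr_gt0.
have [_ [g1 [a [b [[ab cg1 gA1 ga1 gb1] ->]]]] /ltW l1] :=
  lb_ereal_inf_adherent e20 xyf.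
have [_ [g2 [c [d [[cd cg2 gA2 gc2 gd2] ->]]]] /ltW l2] :=
  lb_ereal_inf_adherent e20 yzf.
apply: le_trans (leeD l1 l2).
pose sh (t : R) := t + (c - b).
pose g (t : R) := if t <= b then g1 t else g2 (sh t).
have sh_cont : continuous sh by move=> t; apply: cvgD => //; exact: cvg_cst.
pose e' := b + (d - c).
have be : b <= e' by rewrite /e' lerDl subr_ge0.
have shb : sh b = c by rewrite /sh; ring.
have she : sh e' = d by rewrite /sh /e'; ring.
have shbe t : `[b, e']%classic t -> `[c, d]%classic (sh t).
  by rewrite /= !in_itv/= /sh /e' => /andP[h1 h2]; apply/andP; split; lra.
have g1E t : t <= b -> g t = g1 t by rewrite /g => ->.
have g2E t : b <= t -> g t = g2 (sh t).
  rewrite le_eqVlt => /predU1P[<-|bt]; last by rewrite /g leNgt bt.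
  by rewrite g1E// shb gc2.
apply: (@le_trans _ _ (curve_length g a e')).
  apply: ereal_inf_lbound; exists g, a, e'; split => //; split.
  - exact: le_trans be.
  - rewrite (_ : `[a, e']%classic = `[a, b] `|` `[b, e']).
      apply: withinU_continuous; [exact: interval_closed|exact: interval_closed| |].
        apply: (@subspace_eq_continuous _ _ _ g1) => //.
        by move=> t; rewrite inE/= in_itv/= => /andP[_ tb]; exact/esym/g1E.
      apply: (@subspace_eq_continuous _ _ _ (g2 \o sh)).
        by move=> t; rewrite inE/= in_itv/= => /andP[bt _]; exact/esym/g2E.
      exact: within_continuous_precomp cg2.
    apply/seteqP; split => t /=; rewrite !in_itv/=.
      move=> /andP[aut te].
      by have [tb|/ltW bt] := leP t b; [left; rewrite aut|right; rewrite te bt].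
    move=> [/andP[aut tb]|/andP[bt te]]; last by rewrite te (le_trans ab bt).
    by rewrite aut (le_trans tb be).
  - move=> _ [t /= + <-]; rewrite in_itv/= => /andP[aut te].
    have [tb|/ltW bt] := leP t b.
      by rewrite g1E//; apply: gA1; exists t => //=; rewrite in_itv/= aut.
    rewrite g2E//; apply: gA2; exists (sh t) => //.
    by apply: shbe; rewrite /= in_itv/= bt.
  - by rewrite g1E.
  - by rewrite g2E// she.
apply: ge_ereal_sup => _ [s sp <-].
have [|s1 [s2 [p1 p2 h]]] := polygon_length_split g sp (b := b).
  by rewrite ab.
apply: (@le_trans _ _ (polygon_length g a s1 + polygon_length g b s2)%:E).
  by rewrite lee_fin.
rewrite EFinD; apply: leeD.
  rewrite (@eq_polygon_length g g1 id) ?map_id; first exact: curve_length_ub.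
  by move=> t /(itv_partition_sub p1)/andP[_ /g1E].
rewrite (@eq_polygon_length g g2 sh); last first.
  by move=> t /(itv_partition_sub p2)/andP[/g2E].
rewrite shb; apply: curve_length_ub.
move: p2 => [ps /eqP le]; split.
  rewrite -shb path_map; apply: sub_path ps => u v uv /=.
  by rewrite /sh ltrD2r.
by rewrite -shb last_map le she.
Qed.

Lemma edist_segment (x v : 'rV[R]_N) (s t : R) :
  edist (x + s *: v) (x + t *: v) = `|s - t| * edist v 0.
Proof.
rewrite /edist -sqrtr_sqr -sqrtrM ?sqr_ge0// mulr_sumr; congr Num.sqrt.
by apply: eq_bigr => i _; rewrite !mxE; ring.
Qed.

Lemma inner_dist_segment A (x y : 'rV[R]_N) :
  (forall t : R, 0 <= t <= 1 -> A (x + t *: (y - x))) ->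
  (inner_dist A x y <= (edist x y)%:E)%E.
Proof.
move=> xyA; pose g (t : R) := x + t *: (y - x).
apply: (@le_trans _ _ (curve_length g 0 1)).
  apply: ereal_inf_lbound; exists g, 0, 1; split => //; split => //.
  - apply: continuous_subspaceT => t; apply: cvgD; first exact: cvg_cst.
    by apply: cvgZr_tmp.
  - by move=> _ [t /= + <-]; rewrite in_itv/=; exact: xyA.
  - by rewrite /g scale0r addr0.
  - by rewrite /g scale1r subrKC.
apply: ge_ereal_sup => _ [s sp <-]; rewrite lee_fin.
suff -> : polygon_length g 0 s = (1 - 0) * edist (y - x) 0.
  rewrite subr0 mul1r /edist le_eqVlt; apply/orP; left; apply/eqP.
  by congr Num.sqrt; apply: eq_bigr => i _; rewrite !mxE; ring.
elim: s (0 : R) sp => [|u s ih] a [] /=.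
  by move=> _ /eqP <-; rewrite polygon_length_nil subrr mul0r.
move=> /andP[au us] l1; rewrite polygon_length_cons (ih _ (conj us l1)).
rewrite edist_segment ltr0_norm ?subr_lt0//; ring.
Qed.

Lemma inner_distxx A x : A x -> inner_dist A x x = 0%E.
Proof.
move=> Ax; apply/eqP; rewrite eq_le inner_dist_ge0 andbT.
rewrite (_ : 0%E = (edist x x)%:E); last by rewrite edistxx.
by apply: inner_dist_segment => t _; rewrite subrr scaler0 addr0.
Qed.

Lemma inner_dist_subset A B x y : A `<=` B ->
  (inner_dist B x y <= inner_dist A x y)%E.
Proof.
move=> AB; apply: le_ereal_inf_tmp => _ [g [a [b [[ab cg gA ga gb] ->]]]].
apply: ereal_inf_lbound; exists g, a, b; split => //; split => //.
exact: subset_trans AB.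
Qed.

End inner_metric.

Section slit_domain.
Context {R : realType} {n : nat} (S : slit_system R n).
Implicit Types (x y : 'rV[R]_n.+1) (i : nat).

Definition slit_domain i : set 'rV[R]_n.+1 :=
  box S `\` \bigcup_(j in `I_i) slits S j.

Lemma slit_domain_sub i j : (i <= j)%N -> slit_domain j `<=` slit_domain i.
Proof.
move=> ij x [xI xs]; split => // -[k /= ki xk]; apply: xs; exists k => //=.
exact: leq_trans ij.
Qed.

Let lt_finitely (f : nat -> R) i : (forall j, 0 < f j) ->
  exists2 e : R, 0 < e & forall j, (j < i)%N -> e < f j.
Proof.
move=> f0; elim: i => [|i [e e0 ef]]; first by exists 1.
exists (Num.min e (f i / 2)); first by rewrite lt_min e0 divr_gt0.
move=> j; rewrite ltnS leq_eqVlt => /predU1P[->|ji].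
  by rewrite gt_min ltr_pdivrMr// ltr_pMr// ltr1n orbT.
by rewrite gt_min ef.
Qed.

Let box_convex x y (t : R) : box S x -> box S y -> 0 <= t <= 1 ->
  box S (x + t *: (y - x)).
Proof.
move=> xI yI /andP[t0 t1] k; rewrite !mxE.
have /andP[h1 h2] := xI k; have /andP[h3 h4] := yI k.
have mid (p q : R) : 0 < p -> 0 < q -> 0 < p + t * (q - p).
  move=> p0 q0; rewrite (_ : _ + _ = (1 - t) * p + t * q); last by ring.
  have [t2|t2] := leP t 2^-1.
    by apply: ltr_pwDl; [apply: mulr_gt0|apply: mulr_ge0] => //; lra.
  by apply: ltr_wpDl; [apply: mulr_ge0|apply: mulr_gt0] => //; lra.
move: (mid (x 0 k - box_lo S 0 k) (y 0 k - box_lo S 0 k)).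
move: (mid (box_hi S 0 k - x 0 k) (box_hi S 0 k - y 0 k)).
rewrite !subr_gt0 => /(_ h2 h4) H1 /(_ h1 h3) H2.
by apply/andP; split; lra.
Qed.

Lemma inner_dist_slit_domain_lty i x y :
  slit_domain i x -> slit_domain i y ->
  (inner_dist (slit_domain i) x y < +oo)%E.
Proof.
set A := slit_domain i => Ax Ay.
have chain (u v w : 'rV[R]_n.+1) : (inner_dist A u v < +oo -> inner_dist A v w < +oo ->
    inner_dist A u w < +oo)%E.
  move=> uv vw; apply: le_lt_trans (inner_dist_triangle A v u w) _.
  exact: lte_add_pinfty.
have seg (u v : 'rV[R]_n.+1) : (forall t : R, 0 <= t <= 1 -> A (u + t *: (v - u))) ->
    (inner_dist A u v < +oo)%E.
  by move=> /inner_dist_segment/le_lt_trans; apply; rewrite ltry.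
have [c cP] := choice (slitsP S).
have {cP}[l lP] := choice cP.
pose k1 := Ordinal (slit_system_dim S).
have k10 : k1 != 0 by [].
have top j : c j 0 k1 + l j < box_hi S 0 k1.
  have [lj sj] := lP j.
  pose p : 'rV[R]_n.+1 := \row_k (if k == 0 then c j 0 0 else c j 0 k + l j).
  have : slits S j p.
    rewrite sj; split => [|k k0]; rewrite !mxE ?eqxx// (negbTE k0).
    by rewrite lexx andbT lerDl ltW.
  by move=> /slits_sub /(_ k1); rewrite mxE (negbTE k10) => /andP[].
pose off (u : 'rV[R]_n.+1) := forall j, (j < i)%N -> u 0 0 != c j 0 0.
have off_domain (u : 'rV[R]_n.+1) : box S u -> off u -> A u.
  move=> uI uo; split => // -[j /= ji]; rewrite (lP j).2 => -[/eqP].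
  by rewrite (negbTE (uo j ji)).
have escape (u : 'rV[R]_n.+1) : A u -> exists u', [/\ box S u', off u' &
    (inner_dist A u u' < +oo)%E].
  move=> Au; have [uI us] := Au.
  pose f j := if j is j'.+1
    then (if u 0 0 < c j' 0 0 then c j' 0 0 - u 0 0 else 1)
    else box_hi S 0 0 - u 0 0.
  have f0 j : 0 < f j.
    case: j => [|j] /=; first by have /andP[] := uI 0; rewrite subr_gt0.
    by case: ifPn => //; rewrite subr_gt0.
  have [e e0 ef] := lt_finitely i.+1 f0.
  pose v (t : R) : 'rV[R]_n.+1 := u + t *: (e *: delta_mx 0 0).
  have v0 t : v t 0 0 = u 0 0 + t * e.
    by rewrite /v !mxE !eqxx mulr1.
  have vI t : 0 <= t <= 1 -> box S (v t).
    move=> /andP[t0 t1] k; have [->|k0] := eqVneq k 0.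
      rewrite v0; have /andP[h1 _] := uI 0.
      by have /= := ef 0%N isT => h; apply/andP; split; nra.
    by rewrite /v !mxE eqxx (negbTE k0) /= !mulr0 addr0.
  have voff t : 0 < t <= 1 -> off (v t).
    move=> /andP[t0 t1] j ji; rewrite v0.
    have /= := ef j.+1 ji; case: ifPn => [ulc h|].
      by rewrite lt_eqF//; nra.
    by rewrite -leNgt => clu _; rewrite gt_eqF//; nra.
  exists (v 1); split; [by apply: vI; rewrite lexx ler01| |].
    by apply: voff; rewrite lexx ltr01.
  apply: seg => t t01.
  rewrite (_ : u + _ = v t); last by rewrite /v scale1r [X in X - u]addrC addrK.
  have [->|t0] := eqVneq t 0; first by rewrite /v scale0r addr0.
  apply: off_domain; first exact: vI.
  by apply: voff; rewrite lt_neqAle eq_sym t0.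
have [e e0 ef] := lt_finitely i.+1 (f := fun j => if j is j'.+1
    then box_hi S 0 k1 - (c j' 0 k1 + l j') else box_hi S 0 k1 - box_lo S 0 k1)
  (ltac:(by case => [|j] /=; rewrite subr_gt0 ?box_lt ?top)).
pose z (t : R) : 'rV[R]_n.+1 := \row_k (if k == 0 then t else
  if k == k1 then box_hi S 0 k1 - e else (box_lo S 0 k + box_hi S 0 k) / 2).
have zI t : box_lo S 0 0 < t < box_hi S 0 0 -> box S (z t).
  move=> tI k; rewrite mxE; have [->//|k0] := eqVneq k 0.
  have [->|kk1] := eqVneq k k1.
    by have /= h := ef 0%N isT; apply/andP; split; lra.
  by have h := box_lt S k; apply/andP; split; lra.
have cross (u : 'rV[R]_n.+1) : box S u -> off u ->
    (inner_dist A u (z (u 0%R 0%R)) < +oo)%E.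
  move=> uI uo; apply: seg => t t01; apply: off_domain.
    by apply: box_convex => //; exact: zI.
  by move=> j ji; rewrite !mxE eqxx subrr mulr0 addr0; exact: uo.
have along (u v : 'rV[R]_n.+1) : box S u -> box S v ->
    (inner_dist A (z (u 0%R 0%R)) (z (v 0%R 0%R)) < +oo)%E.
  move=> uI vI; apply: seg => t t01; split.
    by apply: box_convex => //; exact: zI.
  move=> [j /= ji]; rewrite (lP j).2 => -[_ /(_ k1 k10)].
  rewrite !mxE (negbTE k10) eqxx subrr mulr0 addr0 => /andP[_].
  by have /= := ef j.+1 ji; lra.
have [x' [x'I x'o xx']] := escape x Ax.
have [y' [y'I y'o yy']] := escape y Ay.
apply: (chain _ _ _ xx'); apply: (chain _ _ _ (cross _ x'I x'o)).
apply: (chain _ _ _ (along _ _ x'I y'I)); rewrite inner_dist_sym.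
exact: (chain _ _ _ yy' (cross _ y'I y'o)).
Qed.

Definition inner_space i : Type := set_type (slit_domain i).

HB.instance Definition _ i := Choice.on (inner_space i).

(* [fine] loses nothing here, by inner_dist_slit_domain_lty. *)
Definition inner_space_dist i (x y : inner_space i) : R :=
  fine (inner_dist (slit_domain i) (val x) (val y)).

Let inner_space_distE i (x y : inner_space i) :
  (inner_space_dist x y)%:E = inner_dist (slit_domain i) (val x) (val y).
Proof.
rewrite fineK// ge0_fin_numE ?inner_dist_ge0//.
by apply: inner_dist_slit_domain_lty; apply: set_mem; exact: valP.
Qed.

Let inner_space_distxx i (x : inner_space i) : inner_space_dist x x = 0.
Proof.
by rewrite /inner_space_dist inner_distxx//; apply: set_mem; exact: valP.
Qed.

Let inner_space_dist_eq0 i (x y : inner_space i) :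
  inner_space_dist x y = 0 -> x = y.
Proof.
move=> xy0; apply/val_inj/edist_eq0/eqP; rewrite eq_le edist_ge0 andbT.
have := edist_le_inner_dist (slit_domain i) (val x) (val y).
by rewrite -inner_space_distE xy0 lee_fin.
Qed.

Let inner_space_distC i (x y : inner_space i) :
  inner_space_dist x y = inner_space_dist y x.
Proof. by rewrite /inner_space_dist inner_dist_sym. Qed.

Let inner_space_dist_triangle i (y x z : inner_space i) :
  inner_space_dist x z <= inner_space_dist x y + inner_space_dist y z.
Proof.
by rewrite -lee_fin EFinD !inner_space_distE; exact: inner_dist_triangle.
Qed.

HB.instance Definition _ i := isMetric.Build R (inner_space i)
  (@inner_space_distxx i) (@inner_space_dist_eq0 i)
  (@inner_space_distC i) (@inner_space_dist_triangle i).

Definition inner_space_incl i j (ij : (i <= j)%N) (x : inner_space j) :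
    inner_space i :=
  SigSub (mem_set (slit_domain_sub ij (set_mem (valP x)))).

Lemma inner_space_incl_lip i j (ij : (i <= j)%N) (x y : inner_space j) :
  mdist (inner_space_incl ij x) (inner_space_incl ij y) <= mdist x y.
Proof.
rewrite -lee_fin !inner_space_distE; apply: inner_dist_subset.
exact: slit_domain_sub.
Qed.

End slit_domain.

Section completion.
Context {R : realType} (T : metricType R).

Definition cauchy_seqs : Type := set_type [set u : nat -> T | cauchy (u @ \oo)].

HB.instance Definition _ := Choice.on cauchy_seqs.

Definition seq_of (u : cauchy_seqs) : nat -> T := val u.

Implicit Types (u v w : cauchy_seqs).

Lemma cauchy_mdistP (s : nat -> T) : cauchy (s @ \oo) <->
  forall e : R, 0 < e ->
    \forall m \near \oo, \forall k \near \oo, mdist (s m) (s k) < e.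
Proof.
split=> [/cauchy_ballP sc e e0|sc].
  have [/= [A B] [[N1 _ A1] [N2 _ B1]] AB] := sc e e0.
  exists N1 => // m /= Nm; exists N2 => // k /= Nk.
  have := AB (s m, s k); rewrite ballEmdist; apply; split.
    exact: A1.
  exact: B1.
apply: cauchy_exP => e e0; have [N _ /(_ N (leqnn N))] := sc e e0.
by move=> H; exists (s N); rewrite ballEmdist.
Qed.

Lemma mdist_diff (x y z t : T) :
  `|mdist x y - mdist z t| <= mdist x z + mdist y t.
Proof.
rewrite ler_norml; apply/andP; split.
  have h1 := metric_triangle z x t; have h2 := metric_triangle x y t.
  by rewrite (metric_sym x z); lra.
have h1 := metric_triangle x z y; have h2 := metric_triangle z t y.
by rewrite (metric_sym y t); lra.
Qed.

Lemma cvg_mdist_seq u v : cvgn (fun k => mdist (seq_of u k) (seq_of v k)).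
Proof.
apply: R_complete; apply: cauchy_exP => e e0.
have e20 : 0 < e / 2 by rewrite divr_gt0.
have /cauchy_mdistP/(_ _ e20) cu : cauchy (seq_of u @ \oo) := set_mem (valP u).
have /cauchy_mdistP/(_ _ e20) cv : cauchy (seq_of v @ \oo) := set_mem (valP v).
near \oo => N; exists (mdist (seq_of u N) (seq_of v N)).
have uN : \forall k \near \oo, mdist (seq_of u N) (seq_of u k) < e / 2.
  by near: N.
have vN : \forall k \near \oo, mdist (seq_of v N) (seq_of v k) < e / 2.
  by near: N.
change (\forall k \near \oo, ball (mdist (seq_of u N) (seq_of v N)) e
  (mdist (seq_of u k) (seq_of v k))).
near=> k; rewrite -ball_normE/=; apply: le_lt_trans (mdist_diff _ _ _ _) _.
by rewrite [ltRHS]splitr; apply: ltrD; near: k.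
Unshelve. all: by end_near. Qed.

Definition seq_dist u v : R := limn (fun k => mdist (seq_of u k) (seq_of v k)).

Lemma seq_distxx u : seq_dist u u = 0.
Proof.
rewrite /seq_dist (_ : (fun _ => _) = fun=> 0) ?lim_cst//.
by apply/funext => k; rewrite mdistxx.
Qed.

Lemma seq_distC u v : seq_dist u v = seq_dist v u.
Proof. by congr (limn _); apply/funext => k; rewrite metric_sym. Qed.

Lemma seq_dist_triangle v u w : seq_dist u w <= seq_dist u v + seq_dist v w.
Proof.
rewrite -limD; [|exact: cvg_mdist_seq|exact: cvg_mdist_seq].
apply: ler_lim; [exact: cvg_mdist_seq| |].
  by apply: is_cvgD; exact: cvg_mdist_seq.
by apply: nearW => k; exact: metric_triangle.
Qed.

Lemma seq_dist_ge0 u v : 0 <= seq_dist u v.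
Proof.
apply: limr_ge; first exact: cvg_mdist_seq.
by apply: nearW => k; exact: mdist_ge0.
Qed.

Definition cauchy_equiv u v : bool := seq_dist u v == 0.

Lemma cauchy_equiv_refl : reflexive cauchy_equiv.
Proof. by move=> u; rewrite /cauchy_equiv seq_distxx. Qed.

Lemma cauchy_equiv_sym : symmetric cauchy_equiv.
Proof. by move=> u v; rewrite /cauchy_equiv seq_distC. Qed.

Lemma cauchy_equiv_trans : transitive cauchy_equiv.
Proof.
move=> v u w /eqP uv /eqP vw; rewrite /cauchy_equiv eq_le seq_dist_ge0 andbT.
by apply: le_trans (seq_dist_triangle v u w) _; rewrite uv vw addr0.
Qed.

Canonical cauchy_equiv_rel := EquivRel cauchy_equiv
  cauchy_equiv_refl cauchy_equiv_sym cauchy_equiv_trans.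

Definition completion : Type := {eq_quot cauchy_equiv}%qT.

HB.instance Definition _ := Choice.on completion.

Definition completion_pi (u : cauchy_seqs) : completion :=
  (\pi_({eq_quot cauchy_equiv}) u)%qT.

Definition completion_repr (p : completion) : cauchy_seqs :=
  repr (p : {eq_quot cauchy_equiv}%qT).

Lemma completion_reprK p : completion_pi (completion_repr p) = p.
Proof. exact: reprK. Qed.

Lemma completion_piP u v : completion_pi u = completion_pi v <->
  seq_dist u v = 0.
Proof.
split=> [|/eqP uv]; first by move=> /(@eqmodP _ cauchy_equiv_rel)/eqP.
exact/(@eqmodP _ cauchy_equiv_rel).
Qed.

Definition completion_dist (p q : completion) : R :=
  seq_dist (completion_repr p) (completion_repr q).

Let completion_distxx p : completion_dist p p = 0.
Proof. exact: seq_distxx. Qed.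

Let completion_dist_eq0 p q : completion_dist p q = 0 -> p = q.
Proof.
by move=> pq; rewrite -(completion_reprK p) -(completion_reprK q); apply/completion_piP.
Qed.

Let completion_distC p q : completion_dist p q = completion_dist q p.
Proof. exact: seq_distC. Qed.

Let completion_dist_triangle q p r :
  completion_dist p r <= completion_dist p q + completion_dist q r.
Proof. exact: seq_dist_triangle. Qed.

HB.instance Definition _ := isMetric.Build R completion
  completion_distxx completion_dist_eq0 completion_distC
  completion_dist_triangle.

Lemma completion_pi_dist u v :
  mdist (completion_pi u) (completion_pi v) = seq_dist u v.
Proof.
have repr0 w : seq_dist (completion_repr (completion_pi w)) w = 0.
  by apply/completion_piP; exact: completion_reprK.
apply/eqP; rewrite eq_le; apply/andP; split.
  apply: le_trans (seq_dist_triangle u _ _) _; rewrite repr0 add0r.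
  apply: le_trans (seq_dist_triangle v _ _) _.
  by rewrite [X in _ + X]seq_distC repr0 addr0.
apply: le_trans (seq_dist_triangle (completion_repr (completion_pi u)) _ _) _.
rewrite [X in X + _]seq_distC repr0 add0r.
apply: le_trans (seq_dist_triangle (completion_repr (completion_pi v)) _ _) _.
by rewrite repr0 addr0.
Qed.

End completion.

Section completion_map.
Context {R : realType} (T U : metricType R) (f : T -> U)
  (f_lip : forall x y, mdist (f x) (f y) <= mdist x y).

Lemma cauchy_lip (u : cauchy_seqs T) :
  (f \o seq_of u) \in [set v : nat -> U | cauchy (v @ \oo)].
Proof.
apply/mem_set.
have /cauchy_mdistP cu : cauchy (seq_of u @ \oo) := set_mem (valP u).
apply/cauchy_mdistP => e e0; apply: filterS (cu _ e0) => m.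
by apply: filterS => k; exact: le_lt_trans (f_lip _ _).
Qed.

Definition completion_map (p : completion T) : completion U :=
  completion_pi (SigSub (cauchy_lip (completion_repr p))).

Lemma completion_map_lip p q :
  mdist (completion_map p) (completion_map q) <= mdist p q.
Proof.
rewrite completion_pi_dist; apply: ler_lim.
- exact: cvg_mdist_seq.
- exact: cvg_mdist_seq.
- by apply: nearW => k; exact: f_lip.
Qed.

End completion_map.

Section slit_space.
Context {R : realType} {n : nat} (S : slit_system R n).

Definition slit_completion (i : nat) : metricType R :=
  completion (inner_space S i).

Definition slit_tau i j (ij : (i <= j)%N) :
    slit_completion j -> slit_completion i :=
  completion_map (inner_space_incl_lip ij).

Definition slit_limit : Type :=
  {p : forall i, slit_completion i |
    forall i j (ij : (i <= j)%N), slit_tau ij (p j) = p i}.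

HB.instance Definition _ := gen_eqMixin slit_limit.
HB.instance Definition _ := gen_choiceMixin slit_limit.

Definition slit_dist_seq (p q : slit_limit) : nat -> R :=
  fun i => mdist (sval p i) (sval q i).

(* d_S is the limit of these nondecreasing sequences. It is a real-valued
   metric on M(S) exactly when they all converge. *)
Definition slit_dist_cvg : Prop :=
  forall p q : slit_limit, cvgn (slit_dist_seq p q).

Lemma slit_dist_seq_nd p q : nondecreasing_seq (slit_dist_seq p q).
Proof.
move=> i j ij; rewrite /slit_dist_seq -(svalP p _ _ ij) -(svalP q _ _ ij).
exact: completion_map_lip.
Qed.

Definition slit_space (Scvg : slit_dist_cvg) : Type := slit_limit.

Context (Scvg : slit_dist_cvg).

HB.instance Definition _ := Choice.on (slit_space Scvg).

Definition slit_space_dist (p q : slit_space Scvg) : R :=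
  limn (slit_dist_seq p q).

Let slit_space_distxx p : slit_space_dist p p = 0.
Proof.
rewrite /slit_space_dist (_ : slit_dist_seq p p = fun=> 0) ?lim_cst//.
by apply/funext => i; exact: mdistxx.
Qed.

Let slit_space_dist_eq0 p q : slit_space_dist p q = 0 -> p = q.
Proof.
move=> pq0; apply: eq_sig_hprop => [r|]; first exact: Prop_irrelevance.
apply: functional_extensionality_dep => i; apply: mdist_positivity.
apply/eqP; rewrite eq_le mdist_ge0 andbT -pq0.
exact: (nondecreasing_cvgn_le (@slit_dist_seq_nd p q) (@Scvg p q) i).
Qed.

Let slit_space_distC p q : slit_space_dist p q = slit_space_dist q p.
Proof. by congr (limn _); apply/funext => i; exact: metric_sym. Qed.

Let slit_space_dist_triangle q p r :
  slit_space_dist p r <= slit_space_dist p q + slit_space_dist q r.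
Proof.
rewrite -limD; [|exact: (@Scvg _ _)|exact: (@Scvg _ _)].
apply: ler_lim; [exact: (@Scvg _ _)|by apply: is_cvgD; exact: (@Scvg _ _)|].
by apply: nearW => i; exact: metric_triangle.
Qed.

HB.instance Definition _ := isMetric.Build R (slit_space Scvg)
  slit_space_distxx slit_space_dist_eq0 slit_space_distC
  slit_space_dist_triangle.

(* The completion of S_0 = I is identified with the closure of I in R^(n+1),
   by sending a point to the limit of the Cauchy sequences that represent it. *)
Definition slit_tau0 (p : slit_space Scvg) : 'rV[R]_n.+1 :=
  limn (fun k => val (seq_of (completion_repr (sval p 0%N)) k)).

Definition peripheral_sphere (P : set (slit_space Scvg)) : Prop :=
  (exists i, P = slit_tau0 @^-1` slits S i) \/
  P = slit_tau0 @^-1` boundary (box S).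

Definition porous : Prop :=
  exists2 A : R, 0 < A & forall (x : slit_space Scvg) (r : R),
    0 < r < diam mdist [set: slit_space Scvg] ->
    exists P, [/\ peripheral_sphere P, P `<=` ball x r &
                  r / A <= diam mdist P].

End slit_space.

Section quasisymmetric.
Context {R : realType} {X Y : metricType R}.

Definition homeo_onto_image (f : X -> Y) : Prop :=
  [/\ injective f, continuous f &
      forall U : set X, open U ->
        exists2 V : set Y, open V & f @` U = V `&` range f].

Definition qs_embedding (f : X -> Y) : Prop :=
  homeo_onto_image f /\
  exists eta : R -> R, [/\
    forall t, 0 <= t -> 0 <= eta t,
    forall s t, 0 <= s -> s < t -> eta s < eta t &
    forall x y z, x != y -> y != z -> x != z ->
      mdist (f x) (f y) / mdist (f y) (f z) <=
      eta (mdist x y / mdist y z)].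

End quasisymmetric.

Definition qs_coHopfian {R : realType} (X : metricType R) : Prop :=
  forall f : X -> X, qs_embedding f -> range f = setT.

(* Main.v *)
From Pilot Require Import Defs.
From HB Require Import structures.
From mathcomp Require Import all_boot all_order all_algebra all_fingroup.
From mathcomp Require Import all_classical all_reals all_analysis.
From mathcomp Require Import zify ring lra.
Import Pilot.Defs.

Set Implicit Arguments.
Unset Strict Implicit.
Unset Printing Implicit Defensive.

Import Order.TTheory GRing.Theory Num.Theory numFieldNormedType.Exports.

(** Write N = n + 1 and work in the unit box of R^N with the sup norm. The centres q_j of the
    slits are fixed first. They lie on pairwise distinct planes x_0 = q_j0 and come in dyadic
    blocks 2^b <= j + 1 < 2^(b+1): the centres of a block cluster near one point of the box, and
    every point of the box is approached by such blocks with arbitrarily late b. The half sizes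
    h_j are then chosen one after the other, each tiny compared with everything that the earlier
    ones determine.

    Not porous. Some points stay at distance e' from the boundary and from the planes of the
    first J slits. A peripheral sphere inside the ball of radius e'/2 at such a point comes from a
    slit of index at least J, and its diameter is of order h_J, which is negligible compared with
    e' (not_porous).

    Co-Hopfian: every quasisymmetric embedding f of the space X into itself is the identity.
    The map f satisfies the weak quasisymmetry condition wqs with some constant H. Its upper and
    lower moduli of continuity are controlled by H and by the distance of two image points, and
    by nothing else: the bounds hold for all admissible sizes h at once (modulus_upper,
    modulus_lower). Therefore h_J can be chosen after these bounds, and then the images of all
    slits of index at least J are invisible at a scale e fixed in advance. Around a point x that is
    far from the first J slits, f looks at this scale like a map defined on a cube of R^N.

    Target side. The map opening k pulls the two sides of the slit k apart and so represents X,
    near that slit, by a part of R^N with a hole at q_k (opening_inv, opening_lip, chart_dist).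
    Let c be a point of the hole close to the image of f x. The map g = (opening of f) - c omits 0,
    sends x close to 0 and the far points away from 0, and nearby source points have nearby
    values, except across slits of index at least J. If all these jumps were small compared with
    |g|, a labelling of a fine grid would contradict the lemma of Kuhn (kuhn_cell,
    labelling_absurd): a grid point with small |g| is moved to a point of the far layer whose
    direction g / |g| has the same colour, and the colours come from a brick pattern on the
    boundary of the cube, in which two of N + 1 neighbouring points always have the same colour
    (brick_multiplicity).
    So some slit i >= J near x has an image that is large compared with its distance to c
    (puncture).

    Since the images of the slits i >= J are small, this excludes that f x lies close to one of
    the first J slits (avoids_plates). Next take a block near f x, beyond J, and let k = j run
    through it. Each j yields a slit i with J <= i <= j and an image close to q_j (caught), and
    distinct j give distinct i since f shrinks slit i below the distances between the planes
    of the block. The block has more elements than there are indices before it, so some i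
    belongs to the block: this slit is close to f x and also close to x. Hence f moves x only
    slightly (near_identity). Letting J grow and using that such points x become dense, f is the
    identity (qs_embedding_id). *)

(** * Kuhn's combinatorial lemma on a cubical grid *)

Section Kuhn.
Local Open Scope nat_scope.

(** A parity sum vanishes under an involution without fixed points that preserves the
    summand: the elements cancel in pairs. *)
Lemma addb_involution (T : finType) (P F : pred T) (phi : T -> T) :
  (forall x, P x -> [/\ P (phi x), phi (phi x) = x, phi x != x & F (phi x) = F x]) ->
  \big[addb/false]_(x | P x) F x = false.
Proof.
move=> H.
rewrite (bigID (fun x => enum_rank x < enum_rank (phi x))) /=.
rewrite [X in _ (+) X](reindex_onto phi phi) /=; last first.
  by move=> x /andP[/H[]].
rewrite [X in _ (+) X](_ : _ = \big[addb/false]_(x | P x && (enum_rank x < enum_rank (phi x))) F x).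
  by rewrite addbb.
apply: eq_big => [x|x /andP[/andP[Px _] /eqP e]]; last first.
  by have [_ _ _ Fx] := H _ Px; rewrite -Fx e.
apply/idP/idP => [/andP[/andP[Px h] /eqP e]|/andP[Px h]].
  have [P1 _ n _] := H _ Px; rewrite e in P1 n h; rewrite P1 /=.
  move: h; rewrite -leqNgt leq_eqVlt => /orP[/eqP/val_inj/enum_rank_inj h|//].
  by case/eqP: n.
have [-> e n _] := H _ Px; rewrite e eqxx andbT /=.
by rewrite -leqNgt ltnW.
Qed.

Definition all_labels (L : nat -> nat) d := all (fun l => has (fun j => L j == l) (iota 0 d.+1)) (iota 0 d.+1).
(** The doors of Sperner's lemma: facet i, opposite to the i-th vertex, carries all the
    labels below d. *)
Definition door (L : nat -> nat) d i := all (fun l => has (fun j => (j != i) && (L j == l)) (iota 0 d.+1)) (iota 0 d).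

Lemma all_labelsP L d :
  reflect (forall l, l <= d -> exists2 j, j <= d & L j = l) (all_labels L d).
Proof.
apply: (iffP allP) => [H l ld|H l].
  have /hasP[j] : has (fun j => L j == l) (iota 0 d.+1) by apply: H; rewrite mem_iota.
  by rewrite mem_iota => jd /eqP <-; exists j.
rewrite mem_iota add0n ltnS => /H[j jd <-]; apply/hasP; exists j => //.
by rewrite mem_iota.
Qed.

Lemma doorP L d i :
  reflect (forall l, l < d -> exists j, [/\ j <= d, j != i & L j = l]) (door L d i).
Proof.
apply: (iffP allP) => [H l ld|H l].
  have /hasP[j] : has (fun j => (j != i) && (L j == l)) (iota 0 d.+1) by apply: H; rewrite mem_iota.
  by rewrite mem_iota => jd /andP[ji /eqP <-]; exists j.
rewrite mem_iota add0n => /andP[_ /H[j [jd ji <-]]]; apply/hasP; exists j.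
  by rewrite mem_iota.
by rewrite ji eqxx.
Qed.

(** The parity step inside one simplex: a fully labelled simplex has one door, the facet
    opposite to its vertex of label d; any other simplex with a door has two, because exactly
    one label is repeated. *)
Lemma all_labels_doors L d : (forall j, j <= d -> L j <= d) ->
  all_labels L d = \big[addb/false]_(i < d.+1) door L d i.
Proof.
move=> Ld.
pose g (i : 'I_d.+1) : 'I_d.+1 := inord (L i).
have gE i : g i = L i :> nat by rewrite inordK// ltnS Ld// -ltnS.
have doorE (i : 'I_d.+1) : door L d i <-> (forall l : 'I_d.+1, l < d -> exists2 j, j != i & g j = l).
  split=> [/doorP H l /H[j [jd ji e]]|H].
    by exists (inord j); rewrite -?val_eqE /= ?inordK//; apply: ord_inj; rewrite gE inordK.
  apply/doorP => l ld; have [|j ji e] := H (inord l); first by rewrite inordK// ltnS ltnW.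
  exists j; split => //; first by rewrite -ltnS.
  by rewrite -gE e inordK// ltnS ltnW.
have allE : all_labels L d <-> (forall l, exists j, g j = l).
  split=> [/all_labelsP H l|H].
    have [|j jd e] := H l; first by rewrite -ltnS.
    by exists (inord j); apply: ord_inj; rewrite gE inordK.
  apply/all_labelsP => l ld; have [j e] := H (inord l).
  by exists j; [rewrite -ltnS|rewrite -gE e inordK].
have [/injectiveP gi|] := boolP (injectiveb g).
  have [g' gK g'K] := injF_bij gi.
  have -> : all_labels L d by apply/allE => l; exists (g' l).
  have doorE' (i : 'I_d.+1) : door L d i = (i == g' ord_max).
    apply/idP/eqP => [/doorE H|->].
      apply: (gi); rewrite g'K; have [//|/eqP e] := eqVneq (g i) ord_max.
      have [|j ji /gi e'] := H (g i); last by rewrite e' eqxx in ji.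
      have := ltn_ord (g i); rewrite ltnS leq_eqVlt => /orP[/eqP e'|//].
      by case: e; apply: val_inj.
    apply/doorE => l ld; exists (g' l); rewrite ?g'K//.
    by apply/eqP => /(can_inj g'K) e; rewrite e ltnn in ld.
  rewrite (bigD1 (g' ord_max)) //= doorE' eqxx big1//.
  by move=> i; rewrite doorE' => /negbTE.
move=> /injectivePn[a [b ab gab]].
have -> : all_labels L d = false.
  apply/negP => /allE /fin_all_exists[s sK].
  have [s' sK' s'K] := injF_bij (can_inj sK).
  by move: ab; rewrite -(s'K a) -(s'K b) in gab *; rewrite !sK in gab; rewrite gab eqxx.
have [/existsP[i di]|] := boolP [exists i : 'I_d.+1, door L d i]; last first.
  by move=> /existsPn H; rewrite big1// => i _; exact/negbTE.
have /fin_all_exists[s sP] : forall l : 'I_d.+1, exists j,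
    if l < d then j != i /\ g j = l else j = i.
  move=> l; case: ltnP => [ld|_]; last by exists i.
  have [j ji e] := (doorE i).1 di l ld; by exists j.
have lmax (l : 'I_d.+1) : (l < d) = false -> l = ord_max.
  by move=> h; apply: val_inj; have /= := ltn_ord l; lia.
have s_inj : injective s.
  move=> l l' e; have H := sP l; have H' := sP l'; rewrite e in H.
  move: H H'; case: ifP => [_ [n e1]|/lmax l1 e1]; case: ifP => [_ [n' e2]|/lmax l2 e2].
  - exact: etrans (esym e1) e2.
  - by rewrite e2 eqxx in n.
  - by rewrite e1 eqxx in n'.
  - by rewrite l1.
have [s' sK s'K] := injF_bij s_inj.
have outi j : j != i -> g j < d /\ j = s (g j).
  move=> ji; have := sP (s' j); rewrite s'K; case: ifP => [h [_ ->]|_ e].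
    by rewrite s'K.
  by rewrite e eqxx in ji.
have {a b ab gab}[b bi gb] : exists2 b, b != i & g b = g i.
  have [ai|ai] := eqVneq a i; first by exists b; rewrite -ai// eq_sym.
  exists a => //; have [<- //|bi] := eqVneq b i.
  by case/eqP: ab; rewrite (outi _ ai).2 gab -(outi _ bi).2.
have db : door L d b.
  apply/doorE => l ld; have [e|n] := eqVneq l (g b).
    by exists i; rewrite 1?eq_sym// e.
  have := sP l; rewrite ld => -[_ e]; exists (s l) => //.
  by apply: contra_neq n => <-.
rewrite (bigD1 i)//= (bigD1 b)//= di db big1// => c /andP[ci cb].
apply/negbTE/negP => /doorE H; have [gc e] := outi _ ci.
have [j jc gj] := H _ gc; case/eqP: jc.
have [ji|ji] := eqVneq j i.
  by case/eqP: cb; rewrite e -gj ji -gb -(outi _ bi).2.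
by rewrite e -gj -(outi _ ji).2.
Qed.


Section Grid.
Variables (n M : nat).
Local Notation N := n.+1.
Local Notation pt := {ffun 'I_N -> 'I_M.+1}.
Variable lab : pt -> nat.
Hypothesis labN : forall v, lab v <= N.
Hypothesis lab0 : forall (v : pt) (k : 'I_N), v k = 0 :> nat -> lab v != k.
Hypothesis labM : forall (v : pt) (k : 'I_N), v k = M :> nat -> lab v <= k.

(** The simplices of the Freudenthal triangulation are coded by a lowest corner v and a
    permutation p; the i-th vertex raises the coordinates k with p k < i. *)
Definition vert (v : pt) (p : {perm 'I_N}) i : pt :=
  [ffun k => inord (v k + (p k < i))].

(** The d-simplices of the face of the grid on which the coordinates of index at least d are
    equal to M. *)
Definition simp d (v : pt) (p : {perm 'I_N}) :=
  [forall k : 'I_N, if k < d then v k < M else (v k == M :> nat) && (p k == k)].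

Definition labs v p i := lab (vert v p i).

Lemma simpP d v p (k : 'I_N) : simp d v p -> if k < d then v k < M else (v k == M :> nat) && (p k == k).
Proof. by move/forallP/(_ k). Qed.

Lemma simp_perm d v p (k : 'I_N) : simp d v p -> (p k < d) = (k < d).
Proof.
move=> s; have := simpP k s; case: ltnP => [kd _|dk /andP[_ /eqP ->]]; last first.
  by rewrite ltnNge dk.
apply/negbNE/negP; rewrite -leqNgt => h; have := simpP (p k) s.
by rewrite ltnNge h /= => /andP[_ /eqP/perm_inj e]; rewrite e in h; lia.
Qed.

Lemma vertE d v p i k : simp d v p -> i <= d -> vert v p i k = v k + (p k < i) :> nat.
Proof.
move=> s id; rewrite ffunE inordK//.
have := simpP k s; have := simp_perm k s; case: (ltnP k d) => kd kp.
  by move=> vk; case: (_ < i); lia.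
by move=> /andP[/eqP -> _]; case: ltnP => //; lia.
Qed.

(** On this face the hypothesis on the coordinates equal to M bounds the labels by d. *)
Lemma labs_le d v p i : simp d v p -> i <= d -> labs v p i <= d.
Proof.
move=> s id; have [Nd|dN] := leqP N d; first exact: leq_trans (labN _) Nd.
apply: (labM (k := Ordinal dN)); rewrite (vertE _ s id).
have := simp_perm (Ordinal dN) s; have := simpP (Ordinal dN) s; rewrite /= ltnn.
by move=> /andP[/eqP -> _] h; case: ltnP => //; lia.
Qed.

Section Rot.
Variables (d : nat) (dN : d < N).

(** Dropping the first vertex of a simplex and adding a new last one rotates its permutation
    cyclically. *)
Definition rot_fun (j : 'I_N) : 'I_N :=
  if j == 0 :> nat then Ordinal dN else if j <= d then inord j.-1 else j.

Lemma rot_funE j : rot_fun j = (if j == 0 :> nat then d else if j <= d then j.-1 else j) :> nat.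
Proof.
by rewrite /rot_fun; have := ltn_ord j; case: ifP => //; case: ifP => // *; rewrite inordK//; lia.
Qed.

Lemma rot_fun_inj : injective rot_fun.
Proof.
move=> i j e; have h := f_equal (@nat_of_ord _) e; rewrite !rot_funE in h; apply: val_inj => /=.
by move: h; do ? case: ifP; lia.
Qed.

Definition rotp := perm rot_fun_inj.

Lemma rotpE j : rotp j = (if j == 0 :> nat then d else if j <= d then j.-1 else j) :> nat.
Proof. by rewrite permE rot_funE. Qed.

Lemma rotpVE j : (rotp^-1)%g j = (if j == d :> nat then 0 else if j < d then j.+1 else j) :> nat.
Proof.
have := rotpE ((rotp^-1)%g j); rewrite permKV; set i := (rotp^-1)%g j.
by have := ltn_ord i; do ? case: ifP; lia.
Qed.

(** The neighbour across the facet opposite to the first vertex; the map down below crosses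
    the facet opposite to the last one. *)
Definition up (x : pt * {perm 'I_N}) : pt * {perm 'I_N} :=
  ([ffun k => inord (x.1 k + (x.2 k == 0 :> nat))], x.2 * rotp)%g.
Definition down (x : pt * {perm 'I_N}) : pt * {perm 'I_N} :=
  ([ffun k => inord (x.1 k - (x.2 k == d :> nat))], x.2 * rotp^-1)%g.

Definition can_up (x : pt * {perm 'I_N}) := [forall k, (x.2 k == 0 :> nat) ==> (x.1 k < M.-1)].
Lemma upE x k : simp d.+1 x.1 x.2 -> (up x).1 k = x.1 k + (x.2 k == 0 :> nat) :> nat.
Proof.
move=> s; rewrite ffunE inordK//.
have := simpP k s; have := simp_perm k s; case: (ltnP k d.+1) => kd kp.
  by move=> vk; case: (_ == _); lia.
by move=> /andP[/eqP -> _]; case: eqP => // e; lia.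
Qed.

Lemma downE x k : (down x).1 k = x.1 k - (x.2 k == d :> nat) :> nat.
Proof. by rewrite ffunE inordK//; have := ltn_ord (x.1 k); lia. Qed.

Lemma labs_up x i : simp d.+1 x.1 x.2 -> i <= d ->
  labs (up x).1 (up x).2 i = labs x.1 x.2 i.+1.
Proof.
move=> s id; congr lab; apply/ffunP => k; apply: ord_inj; rewrite (vertE _ s)//.
have e : (up x).1 k + ((up x).2 k < i) = x.1 k + (x.2 k < i.+1).
  rewrite upE// permM rotpE.
  by do ? case: ifP; case: eqP; lia.
rewrite ffunE inordK e//.
have := simpP k s; have := simp_perm k s; case: (ltnP k d.+1) => kd kp.
  by move=> vk; do ? case: ifP; lia.
by move=> /andP[/eqP -> _]; do ? case: ifP; lia.
Qed.

Hypothesis M0 : 0 < M.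

Lemma simp_up x : simp d.+1 x.1 x.2 -> can_up x -> simp d.+1 (up x).1 (up x).2.
Proof.
move=> s /forallP cu; apply/forallP => k; have := simpP k s; have := cu k.
case: (ltnP k d.+1) => kd /=; rewrite upE//.
  by case: eqP => /= _; lia.
move=> + /andP[/eqP -> /eqP pk]; rewrite pk => _; apply/andP; split; apply/eqP; first by lia.
by apply: ord_inj; rewrite permM rotpE pk; do ? case: ifP; lia.
Qed.

Lemma simp_down x : simp d.+1 x.1 x.2 -> simp d.+1 (down x).1 (down x).2.
Proof.
move=> s; apply/forallP => k; have := simpP k s.
case: (ltnP k d.+1) => kd /=; rewrite downE; first by lia.
move=> /andP[/eqP -> /eqP pk]; rewrite pk; apply/andP; split; apply/eqP; first by case: eqP; lia.
by apply: ord_inj; rewrite permM rotpVE pk; do ? case: ifP; lia.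
Qed.

Lemma upK x : simp d.+1 x.1 x.2 -> down (up x) = x.
Proof.
move=> s; rewrite [RHS]surjective_pairing; congr pair; last by rewrite /= mulgK.
apply/ffunP => k; apply: ord_inj; rewrite downE upE//= permM rotpE.
have := ltn_ord (x.2 k).
by do ? case: ifP; case: eqP; case: eqP; lia.
Qed.

Lemma downK (x : pt * {perm 'I_N}) : (forall k, x.2 k = d :> nat -> 0 < x.1 k) -> up (down x) = x.
Proof.
move=> cd; rewrite [RHS]surjective_pairing; congr pair; last by rewrite /= mulgKV.
apply/ffunP => k; apply: ord_inj; rewrite ffunE; have := cd k.
have -> : (down x).1 k + ((down x).2 k == 0 :> nat) = x.1 k - (x.2 k == d :> nat) + (x.2 k == d :> nat).
  by rewrite downE /= permM rotpVE; do ? case: ifP; case: eqP; lia.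
move=> h; have := ltn_ord (x.1 k); have -> : x.1 k - (x.2 k == d :> nat) + (x.2 k == d :> nat) = x.1 k.
  by case: eqP h => [e /(_ e)|]; lia.
by move=> ?; rewrite inordK.
Qed.

Lemma can_up_down (x : pt * {perm 'I_N}) : simp d.+1 x.1 x.2 -> (forall k, x.2 k = d :> nat -> 0 < x.1 k) -> can_up (down x).
Proof.
move=> s cd; apply/forallP => k; apply/implyP; rewrite downE /= permM rotpVE.
case: (eqVneq (x.2 k : nat) d) => [h _|h].
  have kd : k < d.+1 by rewrite -(simp_perm k s) h.
  by have := simpP k s; have := cd k h; rewrite kd; lia.
by case: ifP => // h2 /eqP e; lia.
Qed.

Lemma door_up x : simp d.+1 x.1 x.2 ->
  door (labs (up x).1 (up x).2) d.+1 d.+1 = door (labs x.1 x.2) d.+1 0.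
Proof.
move=> s; apply/doorP/doorP => H l /H[j [jd jn <-]] {H}.
  have jd' : j <= d by lia.
  by exists j.+1; rewrite labs_up.
case: j jd jn => // j jd _; exists j; rewrite labs_up//; split => //; lia.
Qed.

(** A door never lies on a face where a coordinate vanishes, since that coordinate is then
    missing among the labels. *)
Lemma door_can_down (x : pt * {perm 'I_N}) : simp d.+1 x.1 x.2 -> door (labs x.1 x.2) d.+1 d.+1 ->
  forall k, x.2 k = d :> nat -> 0 < x.1 k.
Proof.
move=> s /doorP H k xk; rewrite lt0n; apply/eqP => xk0.
have := simp_perm k s; rewrite xk ltnSn => /esym kd.
have [j [jd jn]] := H k kd; apply/eqP; apply: lab0.
by rewrite (vertE _ s)// xk0 xk; case: ltnP => //; lia.
Qed.

(** Crossing the facet opposite to an inner vertex i exchanges two consecutive directions. *)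
Definition swapo (i : nat) : {perm 'I_N} := tperm (inord i.-1) (inord i).
Definition swap i (x : pt * {perm 'I_N}) := (x.1, x.2 * swapo i)%g.

Lemma swapoE i (j : 'I_N) : 0 < i -> i < N -> swapo i j =
  (if j == i.-1 :> nat then i else if j == i :> nat then i.-1 else j) :> nat.
Proof.
move=> i0 iN; have e1 : (inord i : 'I_N) = i :> nat by rewrite inordK.
have e2 : (inord i.-1 : 'I_N) = i.-1 :> nat by rewrite inordK//; lia.
rewrite /swapo; case: tpermP => [->|->|/eqP + /eqP].
- by rewrite e1 e2 eqxx.
- by rewrite e1 e2; do ? case: ifP; lia.
by rewrite -!val_eqE /= e1 e2 => /negbTE -> /negbTE ->.
Qed.

Lemma labs_swap i x j : 0 < i -> i <= d -> j != i ->
  labs (swap i x).1 (swap i x).2 j = labs x.1 x.2 j.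
Proof.
move=> i0 id ji; congr lab; apply/ffunP => k; rewrite !ffunE /= permM swapoE//; last by lia.
by congr (inord (_ + nat_of_bool _)); do ? case: ifP; lia.
Qed.

Lemma simp_swap i x : 0 < i -> i <= d -> simp d.+1 x.1 x.2 ->
  simp d.+1 (swap i x).1 (swap i x).2.
Proof.
move=> i0 id s; apply/forallP => k; have := simpP k s; case: (ltnP k d.+1) => //= kd.
move=> /andP[-> /eqP pk] /=; apply/eqP/val_inj; rewrite /= permM pk swapoE//; last by lia.
by do ? case: ifP; lia.
Qed.

Lemma swapK i (x : pt * {perm 'I_N}) : swap i (swap i x) = x.
Proof. by case: x => v p; rewrite /swap /= -mulgA tperm2 mulg1. Qed.

Lemma swap_neq i x : 0 < i -> i <= d -> swap i x != x.
Proof.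
move=> i0 id; apply/eqP => /(congr1 snd) /= /eqP; rewrite -{2}[x.2]mulg1.
move=> /eqP/mulgI/permP/(_ (inord i)) /(congr1 (@nat_of_ord _)).
rewrite swapoE//; last by lia.
by rewrite perm1 inordK; [do ? case: ifP|]; lia.
Qed.

(** The simplex on the other side of a facet, together with the number of this facet there. *)
Definition flip (z : pt * {perm 'I_N} * 'I_d.+2) : pt * {perm 'I_N} * 'I_d.+2 :=
  if z.2 == ord0 then (up z.1, ord_max) else
  if z.2 == ord_max then (down z.1, ord0) else (swap z.2 z.1, z.2).

Definition is_door (z : pt * {perm 'I_N} * 'I_d.+2) :=
  simp d.+1 z.1.1 z.1.2 && door (labs z.1.1 z.1.2) d.+1 z.2.
(** A facet on the top face, with nothing on its other side. *)
Definition at_top (z : pt * {perm 'I_N} * 'I_d.+2) := (z.2 == ord0) && ~~ can_up z.1.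

Lemma flipP z : is_door z && ~~ at_top z ->
  [/\ is_door (flip z) && ~~ at_top (flip z), flip (flip z) = z, flip z != z & true = true].
Proof.
case: z => x i /andP[/andP[/= s dr]]; rewrite /at_top /flip /is_door /=.
case: (eqVneq i ord0) => [i0|i0] /=.
  rewrite negbK => cu; rewrite i0 in dr *; split => //.
  - by rewrite simp_up//= -[X in door _ _ X]/d.+1 door_up// dr.
  - by rewrite eqxx upK.
  - by rewrite xpair_eqE andbC.
case: (eqVneq i ord_max) => [i1|i1] /= _.
  rewrite i1 in dr *; have cd := door_can_down s dr; split => //.
  - rewrite simp_down//= can_up_down// andbT.
    by have := door_up (simp_down s); rewrite downK// => <-.
  - by rewrite ?eqxx downK.
  - by rewrite xpair_eqE andbC.
have id : i <= d by have := ltn_ord i; rewrite -val_eqE /= in i1; lia.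
have i00 : 0 < i by rewrite lt0n.
rewrite (negbTE i0) (negbTE i1) /=; split => //; last first.
- by apply/eqP => -[] /eqP; apply/negP; exact: swap_neq.
- by rewrite swapK.
rewrite simp_swap//= andbT; apply/doorP => l ld.
by have [j [jd ji <-]] := doorP _ _ _ dr l ld; exists j; rewrite labs_swap.
Qed.

(** The doors on the top face are the fully labelled simplices of the next lower dimension. *)
Lemma top_door x : simp d.+1 x.1 x.2 && door (labs x.1 x.2) d.+1 0 && ~~ can_up x ->
  simp d (up x).1 (up x).2 && all_labels (labs (up x).1 (up x).2) d.
Proof.
move=> /andP[/andP[s dr] /forallPn[k]]; rewrite negb_imply -leqNgt => /andP[/eqP pk Mk].
have kd : k < d.+1 by rewrite -(simp_perm k s) pk.
have vk : x.1 k = M.-1 :> nat by have := simpP k s; rewrite kd; lia.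
have ed : k = d :> nat.
  apply/eqP; rewrite eqn_leq -ltnS kd /=.
  have [j [jd j0 <-]] := doorP _ _ _ dr d (ltnSn d).
  apply: labM; rewrite (vertE _ s)// pk vk lt0n j0; lia.
apply/andP; split; last first.
  apply/all_labelsP => l; rewrite -ltnS => /(doorP _ _ _ dr)[[|j] [jd //= _ <-]].
  by exists j; rewrite ?labs_up.
apply/forallP => k'; rewrite upE//; have := simpP k' s.
have [k'd|k'd|k'd] := ltngtP k' d.
- rewrite (ltnW k'd : k' < d.+1); suff /negbTE -> : x.2 k' != 0 :> nat by rewrite addn0.
  apply/eqP => e; have e' : x.2 k' = x.2 k by apply: ord_inj; rewrite e pk.
  by move/perm_inj: e' => e'; rewrite -e' in ed; lia.
- have -> /= : (k' < d.+1) = false by lia.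
  move=> /andP[/eqP -> /eqP pk']; apply/andP; split; apply/eqP; first by rewrite pk'; lia.
  by apply: ord_inj; rewrite permM rotpE pk'; do ? case: ifP; lia.
have -> : k' = k by apply: ord_inj; rewrite ed.
move=> _; rewrite pk vk /=; apply/andP; split; apply/eqP; first by lia.
by apply: ord_inj; rewrite permM rotpE pk /= ed.
Qed.

Lemma bottom_door y : simp d y.1 y.2 -> all_labels (labs y.1 y.2) d ->
  [/\ simp d.+1 (down y).1 (down y).2, door (labs (down y).1 (down y).2) d.+1 0,
      ~~ can_up (down y) & up (down y) = y].
Proof.
move=> s al; have pE k : (y.2 k == d :> nat) = (k == d :> nat).
  have := simp_perm k s; have := simpP k s; case: (ltnP k d) => h.
    by move=> _ h'; rewrite !ltn_eqF.
  by move=> /andP[_ /eqP ->].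
have cd k : y.2 k = d :> nat -> 0 < y.1 k.
  move/eqP; rewrite pE => /eqP kd; have := simpP k s; rewrite kd ltnn.
  by move=> /andP[/eqP ->].
have sd : simp d.+1 (down y).1 (down y).2.
  apply/forallP => k; rewrite downE pE; have := simpP k s.
  have [kd|kd|kd] := ltngtP k d.
  - by rewrite (ltnW kd : k < d.+1) subn0.
  - have -> /= : (k < d.+1) = false by lia.
    move=> /andP[/eqP -> /eqP pk]; apply/andP; split; apply/eqP; first by lia.
    by apply: ord_inj; rewrite permM rotpVE pk; do ? case: ifP; lia.
  by rewrite kd ltnSn => /andP[/eqP -> _]; lia.
split => //; last exact: downK.
  apply/doorP => l ld; have [j jd <-] := all_labelsP _ _ al l ld.
  exists j.+1; split => //; rewrite -(labs_up sd) ?downK//.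
apply/forallPn; exists (Ordinal dN); rewrite negb_imply downE pE /= eqxx permM rotpVE.
rewrite pE /= eqxx /=; have := simpP (Ordinal dN) s; rewrite /= ltnn => /andP[/eqP -> _]; lia.
Qed.

(** Count the doors of all simplices in two ways. An inner door is seen twice and cancels;
    the doors on the top face remain, and they are the fully labelled simplices of one
    dimension less. *)
Lemma parity_step :
  \big[addb/false]_(x : pt * {perm 'I_N} | simp d.+1 x.1 x.2) all_labels (labs x.1 x.2) d.+1 =
  \big[addb/false]_(x : pt * {perm 'I_N} | simp d x.1 x.2) all_labels (labs x.1 x.2) d.
Proof.
transitivity (\big[addb/false]_(z : pt * {perm 'I_N} * 'I_d.+2 | is_door z) true).
  rewrite (eq_bigr (fun x => \big[addb/false]_(i < d.+2) door (labs x.1 x.2) d.+1 i)); last first.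
    by move=> x s; apply: all_labels_doors => j; exact: labs_le.
  rewrite pair_big_dep /= [LHS]big_mkcond [RHS]big_mkcond /=; apply: eq_bigr => -[x i] _.
  by rewrite /is_door /= andbT; case: (simp _ _ _) => //=; case: door.
rewrite (bigID at_top) /= [X in _ (+) X](addb_involution flipP) addbF.
transitivity (\big[addb/false]_(x : pt * {perm 'I_N} |
    simp d.+1 x.1 x.2 && door (labs x.1 x.2) d.+1 0 && ~~ can_up x) true).
  rewrite (reindex_onto (fun x => (x, ord0)) fst) /=; last first.
    by move=> [x i] /andP[_ /andP[/eqP /= -> _]].
  by apply: eq_bigl => x; rewrite /is_door /at_top /= !eqxx andbT.
rewrite (reindex_onto down up) /=; last by move=> x /andP[/andP[s _] _]; exact: upK.
rewrite [RHS]big_mkcond [LHS]big_mkcond /=; apply: eq_bigr => y _.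
have [h|h] := boolP (simp d y.1 y.2 && all_labels (labs y.1 y.2) d).
  by case/andP: h => s al; have [-> -> -> ->] := bottom_door s al; rewrite eqxx s al.
case: ifP => [/andP[A /eqP e]|_].
  by have := @top_door (down y) A; rewrite e (negbTE h).
by move: h; case: ifP => // _ /= /negbTE.
Qed.
End Rot.

Lemma kuhn_parity d : 0 < M -> d <= N ->
  \big[addb/false]_(x : pt * {perm 'I_N} | simp d x.1 x.2) all_labels (labs x.1 x.2) d.
Proof.
move=> M0; elim: d => [|d ih] dN; last by rewrite parity_step//; apply: ih; exact: ltnW.
pose x0 : pt * {perm 'I_N} := ([ffun=> ord_max], 1%g).
have s0 : simp 0 x0.1 x0.2 by apply/forallP => k; rewrite /= ffunE perm1 !eqxx.
rewrite (bigD1 x0)//= big1; last first.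
  move=> x /andP[s /eqP[]]; rewrite [x]surjective_pairing; congr pair.
    by apply/ffunP => k; apply: val_inj; have := simpP k s; rewrite /= ffunE => /andP[/eqP ->].
  by apply/permP => k; have := simpP k s; rewrite /= perm1 => /andP[_ /eqP].
rewrite addbF; apply/all_labelsP => l; rewrite leqn0 => /eqP ->; exists 0 => //.
by apply/eqP; rewrite -leqn0; exact: (labs_le s0).
Qed.

(** A fully labelled simplex exists since their number is odd; the unit cell that contains it
    is kept. *)
Lemma kuhn_cell : 0 < M -> exists w : pt, (forall k, w k < M) /\
  forall l, l <= N -> exists v : pt, lab v = l /\ forall k, w k <= v k <= (w k).+1.
Proof.
move=> M0; have := kuhn_parity M0 (leqnn N).
have [/existsP[[v p] /andP[/= s al]] _|/existsPn H] :=
    boolP [exists x : pt * {perm 'I_N}, simp N x.1 x.2 && all_labels (labs x.1 x.2) N]; last first.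
  rewrite big1// => x s; apply/negbTE; have := H x; rewrite negb_and => /orP[|//].
  by rewrite s.
exists v; split=> [k|l lN]; first by have := simpP k s; rewrite ltn_ord.
have [j jN <-] := all_labelsP _ _ al l lN; exists (vert v p j); split => // k.
by rewrite (vertE _ s)//; case: (_ < _); lia.
Qed.
End Grid.
End Kuhn.

Local Open Scope classical_set_scope.
Local Open Scope ring_scope.

(** * A brick colouring of low multiplicity *)

Lemma int_eq_close (x y : int) : x - y < 1 -> y - x < 1 -> x = y.
Proof. by lia. Qed.

Lemma int_lt_add2 (x y : int) : x < y + 2 -> x <= y + 1.
Proof. by lia. Qed.

Section Brick.
Context {R : realType}.
Implicit Types (th : nat -> R) (k : nat).

(** The rows of bricks of direction k are translated by an amount that depends on the code of
    the first k directions; distinct codes get distinct translations in the interval from 1/4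
    to 3/4. *)
Definition shift k (c : nat) : R := 4^-1 + c%:R / (2 * 3 ^+ k).

(** The bricks of the directions before k, each reduced modulo 3, written as digits in base
    3. For points at distance less than 1 the residue determines the brick. *)
Fixpoint code th k : nat :=
  if k is j.+1 then (code th j + 3 ^ j * absz (modz (Num.floor (th j + shift j (code th j))) 3))%N
  else 0%N.

Definition brick th k : int := Num.floor (th k + shift k (code th k)).

Definition digit th k : nat := absz (modz (brick th k) 3).

Lemma codeS th k : code th k.+1 = (code th k + 3 ^ k * digit th k)%N.
Proof. by []. Qed.

Lemma digit_lt th k : (digit th k < 3)%N.
Proof.
by rewrite /digit -ltz_nat gez0_abs ?modz_ge0// ltz_pmod.
Qed.

Lemma code_lt th k : (code th k < 3 ^ k)%N.
Proof.
elim: k => // k ih; rewrite codeS expnS; have := digit_lt th k; nia.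
Qed.

Lemma code_mod th k : (code th k.+1 %% 3 ^ k)%N = code th k.
Proof.
rewrite codeS; move: (code_lt th k) (digit th k); move: (code th k) (3 ^ k)%N => c m cm e.
by rewrite addnC mulnC modnMDl modn_small.
Qed.

Lemma code_digit th th' k : code th k.+1 = code th' k.+1 ->
  code th k = code th' k /\ digit th k = digit th' k.
Proof.
move=> e; have e1 : code th k = code th' k by rewrite -(code_mod th k) -(code_mod th' k) e.
split => //; move: e; rewrite !codeS e1 => /addnI/eqP.
by rewrite eqn_pmul2l ?expn_gt0// => /eqP.
Qed.

(** The translation keeps away from integers, so that an integer coordinate is never close to
    the boundary of its brick. *)
Lemma shift_itv th k : 4^-1 <= shift k (code th k) < 3 * 4^-1.
Proof.
have p0 : (0 : R) < 3 ^+ k by rewrite exprn_gt0.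
have h : (code th k)%:R < 3 ^+ k :> R by rewrite -(natrX R 3 k) ltr_nat code_lt.
rewrite /shift; have : 0 <= (code th k)%:R / (2 * 3 ^+ k) :> R.
  by rewrite divr_ge0// mulr_ge0// ltW.
have : (code th k)%:R / (2 * 3 ^+ k) < 2^-1 :> R.
  by rewrite ltr_pdivrMr ?mulr_gt0// mulrA mulVf// mul1r.
by move=> *; apply/andP; split; lra.
Qed.

Lemma shift_sep k (c c' : nat) : c != c' ->
  (2 * 3 ^+ k)^-1 <= `|shift k c - shift k c'| :> R.
Proof.
move=> cc'; rewrite /shift opprD addrACA subrr add0r -mulrBl normrM.
have p0 : (0 : R) < 2 * 3 ^+ k by rewrite mulr_gt0// exprn_gt0.
have p1 : (0 : R) < (2 * 3 ^+ k)^-1 by rewrite invr_gt0.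
rewrite (gtr0_norm p1) ler_peMl ?(ltW p1)//.
have -> : c%:R - c'%:R = (c%:Z - c'%:Z)%:~R :> R by rewrite intrB.
by rewrite -intr_norm (ler_int R 1); move: cc'; lia.
Qed.

Lemma brick_floor th k : (brick th k)%:~R <= th k + shift k (code th k) < (brick th k)%:~R + 1.
Proof. by have := floor_itv (th k + shift k (code th k)); rewrite intrD. Qed.

(** For points closer than 1 equal codes mean equal bricks: the translations agree by
    induction, the bricks differ by at most 1, and the residues modulo 3 agree. *)
Lemma code_brick th th' k : (forall j, (j < k)%N -> `|th j - th' j| < 1) ->
  code th k = code th' k -> forall j, (j < k)%N -> brick th j = brick th' j.
Proof.
elim: k => // k ih H /code_digit[e d] j; rewrite ltnS leq_eqVlt => /predU1P[->|]; last first.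
  by apply: ih => // i ik; apply: H; exact: ltnW.
have := brick_floor th k; have := brick_floor th' k; rewrite e.
have := H k (ltnSn k); rewrite ltr_norml => /andP[h1 h2] /andP[h3 h4] /andP[h5 h6].
have : (brick th k)%:~R - (brick th' k)%:~R < 2%:~R :> R by lra.
have : (brick th' k)%:~R - (brick th k)%:~R < 2%:~R :> R by lra.
rewrite -!intrB !ltr_int; move: d; rewrite /digit.
have n3 : (3 : int) != 0 by [].
have := modz_ge0 (brick th k) n3; have := modz_ge0 (brick th' k) n3.
by lia.
Qed.

Lemma brick_code th th' k : (forall j, (j < k)%N -> brick th j = brick th' j) ->
  code th k = code th' k.
Proof.
elim: k => // k ih H; rewrite !codeS /digit H//; congr addn.
by apply: ih => j jk; apply: H; exact: ltnW.
Qed.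

Lemma brick_close th th' k : (forall j, (j < k)%N -> brick th j = brick th' j) ->
  forall j, (j < k)%N -> `|th j - th' j| < 1.
Proof.
move=> H j jk; have e : code th j = code th' j.
  by apply: brick_code => i ij; apply: H; exact: ltn_trans jk.
have := brick_floor th j; have := brick_floor th' j; rewrite e H//.
by rewrite ltr_norml => /andP[? ?] /andP[? ?]; apply/andP; split; lra.
Qed.

Lemma size_inj (s t : seq nat) (f : nat -> nat) : uniq s ->
  (forall x, x \in s -> f x \in t) -> {in s &, injective f} -> (size s <= size t)%N.
Proof.
move=> us st fi; rewrite -(size_map f s); apply: uniq_leq_size.
  by rewrite map_inj_in_uniq.
by move=> _ /mapP[x xs ->]; exact: st.
Qed.

(** Consider the number of codes of length k that occur among the points. Each direction adds
    at most one: a wall between two bricks passes near the points for at most one of the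
    codes of length k, since the walls of different codes are translated by different amounts
    and the points are much closer than that. The direction k0, where all the points are
    close to an integer, adds none. So at most N codes of length N occur, and N + 1 points
    must repeat one. *)
Lemma brick_multiplicity N m (th : 'I_m -> nat -> R) (lambda : R) (k0 : nat) (z : int) :
  8 * 3 ^+ N * lambda <= 1 -> 
  (forall a b k, (k < N)%N -> `|th a k - th b k| <= lambda) ->
  (k0 < N)%N -> (forall a, `|th a k0 - z%:~R| <= lambda) ->
  (N < m)%N -> exists a b, a != b /\ code (th a) N = code (th b) N.
Proof.
move=> lN close k0N near Nm.
have N0 : (0 : R) < 3 ^+ N by rewrite exprn_gt0.
have lam k : (k < N)%N -> 8 * 3 ^+ k * lambda <= 3^-1.
  move=> kN; have [l0|l0] := leP lambda 0.
    apply: (@le_trans _ _ 0); last by lra.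
    by rewrite mulr_ge0_le0// mulr_ge0// exprn_ge0.
  have : (3 : R) ^+ k.+1 <= 3 ^+ N by rewrite ler_eXn2l// ltr1n.
  rewrite exprS => h; have := ler_wpM2r (ltW l0) h; nra.
have lam1 : lambda <= 24^-1.
  have := lam 0%N (leq_ltn_trans (leq0n _) k0N); rewrite expr0; lra.
pose C k := undup [seq code (th a) k | a <- enum 'I_m].
have CP k c : reflect (exists a, c = code (th a) k) (c \in C k).
  rewrite mem_undup; apply: (iffP mapP) => [[a _ ->]|[a ->]]; exists a => //.
  by rewrite mem_enum.
have uC k : uniq (C k) by exact: undup_uniq.
have CS k c : c \in C k.+1 -> (c %% 3 ^ k)%N \in C k.
  by move=> /CP[a ->]; apply/CP; exists a; rewrite code_mod.
(* No wall of direction k0 passes near an integer, so this direction adds no code. *)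
have stay : (size (C k0.+1) <= size (C k0))%N.
  apply: (size_inj (f := fun c => c %% 3 ^ k0)%N) => //; first exact: CS.
  move=> _ _ /CP[a ->] /CP[b ->]; rewrite !code_mod => e.
  suff : brick (th a) k0 = brick (th b) k0 by rewrite !codeS /digit e => ->.
  suff bz c : brick (th c) k0 = z by rewrite !bz.
  apply/floor_def; rewrite intrD; have := shift_itv (th c) k0; have := near c.
  by rewrite ler_norml => /andP[? ?] /andP[? ?]; apply/andP; split; lra.
have step k : (k < N)%N -> (size (C k.+1) <= (size (C k)).+1)%N.
  move=> kN.
  have cl (a b : 'I_m) : code (th a) k = code (th b) k ->
      (brick (th b) k <= brick (th a) k + 1).
    move=> e; have := brick_floor (th a) k; have := brick_floor (th b) k; rewrite e.
    have := close a b k kN; rewrite ler_norml => /andP[? ?] /andP[? ?] /andP[? ?].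
    have : (brick (th b) k)%:~R < (brick (th a) k + 2)%:~R :> R by rewrite intrD; lra.
    by rewrite ltr_int => /int_lt_add2.
  have jump (a b : 'I_m) c : code (th a) k = code (th b) k -> brick (th a) k < brick (th b) k ->
      `|th c k + shift k (code (th a) k) - (brick (th b) k)%:~R| <= 2 * lambda.
    move=> e ab; have := brick_floor (th a) k; have := brick_floor (th b) k; rewrite -e.
    have : (brick (th a) k + 1)%:~R <= (brick (th b) k)%:~R :> R by rewrite ler_int; lia.
    rewrite intrD; have := close a b k kN; have := close c a k kN; have := close c b k kN.
    rewrite !ler_norml => /andP[? ?] /andP[? ?] /andP[? ?] ? /andP[? ?] /andP[? ?].
    by apply/andP; split; lra.
  (* Walls of direction k that meet the points for two different codes would contradict
     shift_sep. *)
  have one (a b a' b' : 'I_m) : code (th a) k = code (th b) k -> brick (th a) k < brick (th b) k ->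
      code (th a') k = code (th b') k -> brick (th a') k < brick (th b') k ->
      code (th a) k = code (th a') k.
    move=> e1 l1 e2 l2; apply/eqP; apply/negPn/negP => /shift_sep - /(_ k).
    have := jump _ _ a e1 l1; have := jump _ _ a e2 l2.
    have := shift_itv (th a) k; have := shift_itv (th a') k.
    set s := shift _ _; set s' := shift _ _ => /andP[? ?] /andP[? ?].
    rewrite !ler_norml => /andP[? ?] /andP[? ?].
    have h1 : (brick (th b) k)%:~R - (brick (th b') k)%:~R < 1%:~R :> R by lra.
    have h2 : (brick (th b') k)%:~R - (brick (th b) k)%:~R < 1%:~R :> R by lra.
    rewrite -!intrB !ltr_int in h1 h2.
    have eb : brick (th b) k = brick (th b') k by exact: int_eq_close.
    have eb' : (brick (th b) k)%:~R = (brick (th b') k)%:~R :> R by rewrite eb.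
    have k3 : (0 : R) < 2 * 3 ^+ k by rewrite mulr_gt0// exprn_gt0.
    rewrite -(ler_pM2l k3) mulfV ?gt_eqF// => h.
    have : `|s' - s| <= 4 * lambda.
      rewrite ler_norml; apply/andP; split; lra.
    move=> /(ler_wpM2l (ltW k3)) h'; have := lam k kN.
    have -> : 8 * 3 ^+ k * lambda = 2 * 3 ^+ k * (4 * lambda) by ring.
    by lra.
  have [inj|] := pselect ({in C k.+1 &, injective (fun c => c %% 3 ^ k)%N}).
    by apply: leqW; apply: (size_inj (f := fun c => c %% 3 ^ k)%N) => //; exact: CS.
  move=> /existsNP[c1 /existsNP[c2 /not_implyP[c1C /not_implyP[c2C /not_implyP[e12 n12]]]]].
  have [a [b [eab lab]]] : exists a b : 'I_m, code (th a) k = code (th b) k /\ brick (th a) k < brick (th b) k.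
    move: (CP _ _ c1C) (CP _ _ c2C) => [a ea] [b eb]; rewrite ea eb !code_mod in e12 n12.
    have [l|l|l] := ltgtP (brick (th a) k) (brick (th b) k).
    - by exists a, b.
    - by exists b, a.
    by case: n12; rewrite !codeS /digit l e12.
  pose c := code (th b) k.+1.
  have cC : c \in C k.+1 by apply/CP; exists b.
  have -> : size (C k.+1) = (size (rem c (C k.+1))).+1.
    by rewrite size_rem// prednK//; case: (C k.+1) cC.
  rewrite ltnS; apply: (size_inj (f := fun c => c %% 3 ^ k)%N).
  - exact: rem_uniq.
  - by move=> x /mem_rem /CS.
  move=> x y; rewrite !mem_rem_uniq// !inE => /andP[xc /CP[a' ex]] /andP[yc /CP[b' ey]].
  rewrite ex ey !code_mod => e.
  have up (a1 b1 : 'I_m) : code (th a1) k = code (th b1) k -> brick (th a1) k < brick (th b1) k ->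
      code (th b1) k.+1 = c.
    move=> e1 l1; have ea := one _ _ _ _ eab lab e1 l1.
    rewrite /c !codeS /digit -e1 -eab ea; congr (_ + _ * absz (modz _ _))%N.
    have := cl a b1; have := cl a b; have := cl a1 b.
    by rewrite -eab -ea -e1 -ea => /(_ erefl) ? /(_ erefl) ? /(_ erefl) ?; lia.
  have [l|l|l] := ltgtP (brick (th a') k) (brick (th b') k).
  - by case/eqP: yc; rewrite ey (up a' b').
  - by case/eqP: xc; rewrite ex (up b' a').
  by rewrite !codeS /digit l e.
have bound k : (k <= N)%N -> (size (C k) + (k0 < k) <= k.+1)%N.
  elim: k => [|k ih] kN.
    rewrite addn0; apply: (uniq_leq_size (s2 := [:: 0%N])) => // x /CP[a ->].
    by rewrite inE.
  have := ih (ltnW kN); have [e|ne] := eqVneq k k0.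
    by move: stay; rewrite -e ltnSn ltnn; lia.
  by have := step k kN; move: ne; case: (ltngtP k0 k) => //; lia.
have [inj|] := pselect (injective (fun a => code (th a) N)).
  have : (m <= size (C N))%N.
    rewrite -(size_enum_ord m) -(size_map (fun a => code (th a) N)).
    apply: uniq_leq_size; first by rewrite map_inj_uniq ?enum_uniq.
    by move=> _ /mapP[a _ ->]; apply/CP; exists a.
  by have := bound N (leqnn N); rewrite k0N; lia.
move=> /existsNP[a /existsNP[b /not_implyP[e n]]]; exists a, b; split => //.
exact/eqP.
Qed.
End Brick.

(** * Sup norm, sparse slits and the slit system *)

Section SupNorm.
Context {R : realType} {n : nat}.
Implicit Types (x y : 'rV[R]_n.+1).

Lemma coord_le x k : `|x 0 k| <= `|x|.
Proof. by rewrite [leRHS]mx_normrE; apply: (le_bigmax _ (fun ij => `|x ij.1 ij.2|) (0, k)). Qed.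

Lemma norm_le_coord x (r : R) : 0 <= r -> (forall k, `|x 0 k| <= r) -> `|x| <= r.
Proof.
move=> r0 H; rewrite [leLHS]mx_normrE; apply: bigmax_le => // -[i k] _ /=.
by rewrite ord1.
Qed.

Lemma norm_attained x : exists k, `|x| = `|x 0 k|.
Proof.
have [->|x0] := eqVneq x 0; first by exists ord0; rewrite mxE !normr0.
have /mx_norm_neq0[[i k] e] : mx_norm x != 0 by rewrite -[mx_norm x]/`|x| normr_eq0.
by exists k; move: e; rewrite /= ord1.
Qed.

Lemma coord_dist x y k : `|x 0 k - y 0 k| <= `|x - y|.
Proof. by have := coord_le (x - y) k; rewrite !mxE. Qed.

Lemma dist_le_coord x y (r : R) : 0 <= r -> (forall k, `|x 0 k - y 0 k| <= r) -> `|x - y| <= r.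
Proof. by move=> r0 H; apply: norm_le_coord => // k; rewrite !mxE. Qed.

Lemma coord_le_edist x y k : `|x 0 k - y 0 k| <= edist x y.
Proof.
rewrite -sqrtr_sqr ler_sqrt; last by apply: sumr_ge0 => i _; exact: sqr_ge0.
by rewrite (bigD1 k)//= lerDl; apply: sumr_ge0 => i _; exact: sqr_ge0.
Qed.

Lemma norm_le_edist x y : `|x - y| <= edist x y.
Proof. by apply: dist_le_coord => [|k]; [exact: edist_ge0|exact: coord_le_edist]. Qed.

Lemma edist_le_sum x y : edist x y <= \sum_k `|x 0 k - y 0 k|.
Proof.
have s0 : 0 <= \sum_k `|x 0 k - y 0 k| by apply: sumr_ge0.
rewrite -[leRHS]ger0_norm// -sqrtr_sqr ler_sqrt ?sqr_ge0//.
have -> : \sum_k (x 0 k - y 0 k) ^+ 2 = \sum_k `|x 0 k - y 0 k| * `|x 0 k - y 0 k|.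
  by apply: eq_bigr => k _; rewrite -expr2 real_normK// num_real.
rewrite expr2 mulr_suml; apply: ler_sum => k _; apply: ler_wpM2l => //.
by rewrite [leRHS](bigD1 k)//= lerDl sumr_ge0.
Qed.

Lemma edist_le_norm x y : edist x y <= n.+1%:R * `|x - y|.
Proof.
apply: le_trans (edist_le_sum x y) _.
apply: (@le_trans _ _ (\sum_(k < n.+1) `|x - y|)).
  by apply: ler_sum => k _; exact: coord_dist.
by rewrite sumr_const card_ord mulr_natl.
Qed.

Lemma edist_one_coord x y k : (forall i, i != k -> x 0 i = y 0 i) ->
  edist x y = `|x 0 k - y 0 k|.
Proof.
move=> H; apply/eqP; rewrite eq_le coord_le_edist andbT.
apply: le_trans (edist_le_sum x y) _; rewrite (bigD1 k)//= big1 ?addr0// => i ik.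
by rewrite H// subrr normr0.
Qed.

End SupNorm.

Section SetBounds.
Context {R : realType} {T : Type} (d : T -> T -> R).

Lemma diam_ge (E : set T) (B : R) x y : (forall x y, E x -> E y -> d x y <= B) ->
  E x -> E y -> d x y <= diam d E.
Proof.
move=> H Ex Ey; apply: ub_le_sup; last by exists x => //; exists y.
by exists B => _ [u Eu [v Ev <-]]; exact: H.
Qed.

Lemma diam_le (E : set T) (B : R) : 0 <= B -> (forall x y, E x -> E y -> d x y <= B) ->
  diam d E <= B.
Proof.
move=> B0 H; have [[x Ex]|E0] := pselect (E !=set0).
  by apply: ge_sup; [exists (d x x), x => //; exists x|move=> _ [u Eu [v Ev <-]]; exact: H].
have e : [set d x y | x in E & y in E] = set0.
  by apply/seteqP; split => // t [u Eu]; case: E0; exists u.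
by rewrite /diam e sup0.
Qed.

Lemma set_dist_ge (E F : set T) (B : R) : E !=set0 -> F !=set0 ->
  (forall x y, E x -> F y -> B <= d x y) -> B <= set_dist d E F.
Proof.
move=> [x Ex] [y Fy] H; apply: lb_le_inf; first by exists (d x y), x => //; exists y.
by move=> _ [u Eu [v Ev <-]]; exact: H.
Qed.

End SetBounds.

(** All separation conditions on the slits are checked with the relative distance 1. *)
Lemma rel_dist_ge1 {R : realType} {N : nat} (E F : set 'rV[R]_N) (B : R) :
  E !=set0 -> F !=set0 -> (forall x y, E x -> F y -> B <= edist x y) ->
  0 < diam edist E -> 0 < diam edist F -> Num.min (diam edist E) (diam edist F) <= B ->
  1 <= rel_dist E F.
Proof.
move=> E0 F0 H dE dF mB; rewrite /rel_dist ler_pdivlMr ?lt_min ?dE// mul1r.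
by apply: le_trans mB _; exact: set_dist_ge.
Qed.

Section Design.
Context {R : realType} {n : nat}.
Local Notation N := (n.+1%:R : R).
Local Notation vec := 'rV[R]_n.+1.

(** A slit by its centre and half size, which is the form in which all estimates use it. *)
Definition in_slit (c : vec) (h : R) (z : vec) : Prop :=
  z 0 0 = c 0 0 /\ forall k, k != 0 -> `|z 0 k - c 0 k| <= h.

Definition corner (c : vec) (h : R) : vec :=
  \row_k (if k == 0 then c 0 0 else c 0 k - h).

Lemma slitE c h : slit (corner c h) (2 * h) = in_slit c h.
Proof.
apply/seteqP; split => z [z0 H].
  split; first by rewrite z0 mxE.
  move=> k k0; have := H k k0; rewrite mxE (negbTE k0) ler_norml => /andP[? ?].
  by apply/andP; split; lra.
split; first by rewrite z0 mxE.
move=> k k0; have := H k k0; rewrite mxE (negbTE k0) ler_norml => /andP[? ?].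
by apply/andP; split; lra.
Qed.

(** The coordinate of index 1 serves to move around slits: it is parallel to all of them. *)
Definition second : 'I_n.+1 := inord 1.

(** The field q_half leaves the hyperplane where the second coordinate is 1/2 free of
    centres, and q_dense expresses that entire dyadic blocks of centres approach any given
    point, with a bound on the block that is uniform in the point. *)
Record placement (q : nat -> vec) : Prop := Placement {
  q_box : forall j k, 0 < q j 0 k < 1 ;
  q_inj : forall i j, q i 0 0 = q j 0 0 -> i = j ;
  q_half : forall j, q j 0 second != 2^-1 ;
  q_dense : forall (e : R) (beta : nat), 0 < e -> exists beta', forall y : vec,
    (forall k, 0 <= y 0 k <= 1) -> exists b, [/\ (beta <= b < beta')%N &
      forall j, (2 ^ b <= j.+1 < 2 ^ b.+1)%N -> `|q j - y| <= e]
}.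

(** The field h_gap separates the planes of two slits by much more than the size of the
    smaller one, and h_half keeps the slits away from the hyperplane where the second
    coordinate is 1/2. *)
Record sizes (q : nat -> vec) (h : nat -> R) : Prop := Sizes {
  h_gt0 : forall j, 0 < h j ;
  h_first : h 0%N <= 8^-1 ;
  h_step : forall j, 8 * h j.+1 <= h j ;
  h_gap : forall i j, (i < j)%N -> 16 * N * h j < `|q i 0 0 - q j 0 0| ;
  h_box : forall j k, 16 * N * h j < q j 0 k < 1 - 16 * N * h j ;
  h_half : forall j, h j < `|q j 0 second - 2^-1|
}.

Section System.
Variables (q : nat -> vec) (h : nat -> R).
Hypotheses (n_ge1 : (1 <= n)%N) (pq : placement q) (sh : sizes q h).

Lemma N_ge2 : 2 <= N.
Proof. by rewrite ler_nat. Qed.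

Lemma second_neq0 : second != 0.
Proof. by rewrite -val_eqE /= inordK. Qed.

Lemma h_anti i j : (i <= j)%N -> h j <= h i.
Proof.
elim: j => [|j ih]; first by rewrite leqn0 => /eqP ->.
rewrite leq_eqVlt => /predU1P[->//|]; rewrite ltnS => /ih.
by have := h_step sh j; have := h_gt0 sh j.+1; lra.
Qed.

Lemma h_lt i j : (i < j)%N -> 8 * h j <= h i.
Proof. by case: j => // j ij; apply: le_trans (h_step sh j) _; exact: h_anti. Qed.

Lemma h_exp j : h j <= 8^-1 ^+ j.+1.
Proof.
elim: j => [|j ih]; first by rewrite expr1 (h_first sh).
by rewrite exprS; have := h_step sh j; lra.
Qed.

Lemma gap_neq i j : i != j -> 16 * N * h j < `|q i 0 0 - q j 0 0| \/ 16 * N * h i < `|q i 0 0 - q j 0 0|.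
Proof.
move=> ij; have [l|l|e] := ltngtP i j; last by rewrite e eqxx in ij.
  by left; exact: h_gap.
by right; rewrite distrC; exact: h_gap.
Qed.

Lemma slit_box j z : in_slit (q j) (h j) z -> forall k, 8 * N * h j < z 0 k < 1 - 8 * N * h j.
Proof.
move=> [z0 H] k; have /andP[b1 b2] := h_box sh j k; have h0 := h_gt0 sh j.
have Nh : 2 * h j <= N * h j by rewrite ler_wpM2r ?N_ge2// ltW.
have [k0|k0] := eqVneq k 0.
  by move: b1 b2; rewrite k0 z0 => ? ?; apply/andP; split; lra.
have := H k k0; rewrite ler_norml => /andP[? ?].
by apply/andP; split; lra.
Qed.

Lemma slit_edist_le j x y : in_slit (q j) (h j) x -> in_slit (q j) (h j) y ->
  edist x y <= 2 * N * h j.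
Proof.
move=> [x0 Hx] [y0 Hy]; apply: le_trans (edist_le_norm x y) _.
have h0 := h_gt0 sh j.
rewrite (_ : 2 * N * h j = N * (2 * h j)); last by ring.
apply: ler_wpM2l; first exact: ler0n.
apply: dist_le_coord => [|k]; first by lra.
have [->|k0] := eqVneq k 0; first by rewrite x0 y0 subrr normr0; lra.
have := Hx k k0; have := Hy k k0; rewrite !ler_norml => /andP[? ?] /andP[? ?].
by apply/andP; split; lra.
Qed.

Lemma center_in_slit j : in_slit (q j) (h j) (q j).
Proof. by split=> // k _; rewrite subrr normr0 ltW// (h_gt0 sh). Qed.

Lemma slit_diam_gt0 j : 0 < diam edist (in_slit (q j) (h j)).
Proof.
have h0 := h_gt0 sh j.
pose z : vec := \row_k (if k == 0 then q j 0 0 else q j 0 k + h j).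
have zs : in_slit (q j) (h j) z.
  split; first by rewrite mxE.
  by move=> k k0; rewrite mxE (negbTE k0) addrAC subrr add0r gtr0_norm.
apply: lt_le_trans (diam_ge (@slit_edist_le j) zs (center_in_slit j)).
apply: lt_le_trans (coord_le_edist _ _ second).
by rewrite mxE (negbTE second_neq0) addrAC subrr add0r gtr0_norm.
Qed.

Lemma slit_diam_le j : diam edist (in_slit (q j) (h j)) <= 2 * N * h j.
Proof.
apply: diam_le => [|x y]; last exact: slit_edist_le.
by rewrite mulr_ge0 ?ltW ?(h_gt0 sh)// mulr_ge0.
Qed.

(** A point with all its coordinates strictly inside is interior. *)
Lemma boundary_unit_box (x : vec) : boundary (open_box 0 (const_mx 1)) x ->
  exists k, x 0 k <= 0 \/ 1 <= x 0 k.
Proof.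
move=> [_ nint]; apply: contrapT => /forallNP H; apply: nint.
have xk k : 0 < x 0 k < 1 by have /not_orP[/negP + /negP] := H k; rewrite -!ltNge => -> ->.
have [e e0 eP] : exists2 e : R, 0 < e & forall k, e <= x 0 k /\ e <= 1 - x 0 k.
  exists (\big[Num.min/1]_k Num.min (x 0 k) (1 - x 0 k)).
    by apply: lt_bigmin => // k _; rewrite lt_min subr_gt0.
  move=> k; have := bigmin_le_cond 1 (fun k => Num.min (x 0 k) (1 - x 0 k)) (isT : xpredT k).
  by rewrite le_min => /andP[].
apply/nbhs_ballP; exists e => //= y; rewrite -ball_normE /= => xy k.
have [e1 e2] := eP k; have := le_lt_trans (coord_dist x y k) xy.
by rewrite !mxE ltr_norml => /andP[? ?]; apply/andP; split; lra.
Qed.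

Lemma boundary_corner (t : R) : t = 0 \/ t = 1 -> boundary (open_box 0 (const_mx 1)) (const_mx t : vec).
Proof.
move=> t01; split.
  move=> B /nbhs_ballP[e /= e0 eB].
  pose d := Num.min (e / 2) 2^-1.
  have d0 : 0 < d by rewrite lt_min !divr_gt0//= invr_gt0.
  have de : d < e by rewrite gt_min ltr_pdivrMr// ltr_pMr// ltr1n.
  have d1 : d < 1 by rewrite gt_min [_ < 1 in X in _ || X](_ : _ = true) ?orbT//; apply/idP; lra.
  pose s : R := if t == 0 then d else 1 - d.
  have s01 : 0 < s < 1 by rewrite /s; case: ifP => _; apply/andP; split; lra.
  have st : `|t - s| <= d.
    rewrite /s; case: eqP => [->|t0]; first by rewrite sub0r normrN gtr0_norm.
    by case: t01 => // ->; rewrite opprB addrC subrK gtr0_norm.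
  exists (const_mx s : vec); split; first by move=> k; rewrite !mxE.
  apply: eB; rewrite -ball_normE /=; apply: le_lt_trans de.
  by apply: dist_le_coord => [|k]; rewrite ?mxE// ltW.
move=> /interior_subset /(_ 0); rewrite !mxE; case: t01 => ->; first by rewrite ltxx.
by rewrite ltxx andbF.
Qed.

Lemma boundary_diam_gt0 : 0 < diam edist (boundary (open_box 0 (const_mx 1) : set vec)).
Proof.
have cl (x : vec) : boundary (open_box 0 (const_mx 1)) x -> forall k, - 1 <= x 0 k <= 2.
  move=> [clx _] k; have /clx[y [yb]] : nbhs x (ball x 1) by exact: nbhsx_ballx.
  rewrite -ball_normE /= => xy; have := le_lt_trans (coord_dist x y k) xy.
  have := yb k; rewrite !mxE ltr_norml => /andP[? ?] /andP[? ?].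
  by apply/andP; split; lra.
apply: lt_le_trans (@diam_ge _ _ _ _ (3 * N) (const_mx 1) 0 _ _ _).
- apply: lt_le_trans (coord_le_edist _ _ 0); rewrite !mxE subr0 normr1; exact: ltr01.
- move=> x y /cl bx /cl by_; apply: le_trans (edist_le_norm x y) _.
  rewrite mulrC ler_wpM2r// ?ler0n//; apply: dist_le_coord => // k.
  have /andP[? ?] := bx k; have /andP[? ?] := by_ k.
  by rewrite ler_norml; apply/andP; split; lra.
- by apply: boundary_corner; right.
- by rewrite -[0]/(const_mx 0); apply: boundary_corner; left.
Qed.

Definition the_slits j : set vec := slit (corner (q j) (h j)) (2 * h j).

Lemma system_slitsP j : exists (c : vec) (l : R), 0 < l /\ the_slits j = slit c l.
Proof. by exists (corner (q j) (h j)), (2 * h j); rewrite mulr_gt0 ?(h_gt0 sh). Qed.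

Lemma system_box_lt (k : 'I_n.+1) : (0 : vec) 0 k < (const_mx 1 : vec) 0 k.
Proof. by rewrite !mxE ltr01. Qed.

Lemma system_slits_sub j : the_slits j `<=` open_box 0 (const_mx 1).
Proof.
move=> z; rewrite /the_slits slitE => /slit_box H k; rewrite !mxE.
have /andP[? ?] := H k; have : 0 <= 8 * N * h j.
  by rewrite mulr_ge0 ?mulr_ge0// ltW ?(h_gt0 sh).
by move=> ?; apply/andP; split; lra.
Qed.

Lemma system_slits_disjoint i j : i != j -> the_slits i `&` the_slits j = set0.
Proof.
move=> ij; apply/seteqP; split => // z []; rewrite /the_slits !slitE => -[e1 _] [e2 _].
by case/eqP: ij; apply: (q_inj pq); rewrite -e1 -e2.
Qed.

(** Two slits are at least as far apart as their planes, which h_gap compares with the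
    smaller slit; the distance to the boundary comes from h_box in the same way. *)
Lemma system_separated : exists sigma : R, [/\ 0 < sigma,
    forall i j, i != j -> sigma <= rel_dist (the_slits i) (the_slits j) &
    forall i, sigma <= rel_dist (the_slits i) (boundary (open_box 0 (const_mx 1)))].
Proof.
exists 1; split => // [i j ij|i]; rewrite /the_slits !slitE.
  apply: (rel_dist_ge1 (B := `|q i 0 0 - q j 0 0|)).
  - by exists (q i); exact: center_in_slit.
  - by exists (q j); exact: center_in_slit.
  - by move=> x y [<- _] [<- _]; exact: coord_le_edist.
  - exact: slit_diam_gt0.
  - exact: slit_diam_gt0.
  - have di := slit_diam_le i; have dj := slit_diam_le j.
    have Nh k : 0 <= N * h k by rewrite mulr_ge0// ltW ?(h_gt0 sh).
    have := Nh i; have := Nh j => ? ?.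
    by rewrite ge_min; case: (gap_neq ij) => g; apply/orP; [right|left]; lra.
apply: (rel_dist_ge1 (B := 8 * N * h i)).
- by exists (q i); exact: center_in_slit.
- by exists (const_mx 1); apply: boundary_corner; right.
- move=> x y /slit_box xs /boundary_unit_box[k yk].
  apply: le_trans (coord_le_edist _ _ k); have /andP[? ?] := xs k.
  by rewrite ler_normr; case: yk => ?; apply/orP; [left|right]; lra.
- exact: slit_diam_gt0.
- exact: boundary_diam_gt0.
- rewrite ge_min; apply/orP; left; apply: le_trans (slit_diam_le i) _.
  have : 0 <= N * h i by rewrite mulr_ge0// ltW ?(h_gt0 sh).
  by lra.
Qed.

Lemma system_diam_cvg0 : diam edist (the_slits j) @[j --> \oo] --> (0 : R).
Proof.
apply: (@squeeze_cvgr _ _ _ _ (fun=> 0) (fun j => 2 * N * 8^-1 * 8^-1 ^+ j)).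
- apply: nearW => j; rewrite /the_slits slitE ltW ?slit_diam_gt0//=.
  apply: le_trans (slit_diam_le j) _; rewrite -(mulrA (2 * N)) -exprS; apply: ler_wpM2l (h_exp j).
  by rewrite mulr_ge0.
- exact: cvg_cst.
- rewrite -[X in _ --> X](mulr0 (2 * N * 8^-1)); apply: cvgM; first exact: cvg_cst.
  by apply: cvg_expr; rewrite ger0_norm ?invr_ge0// invf_lt1// ltr1n.
Qed.

(** By q_dense there are centres arbitrarily close to every point. *)
Lemma system_dense : open_box 0 (const_mx 1) `<=` closure (\bigcup_j the_slits j).
Proof.
move=> y yb B /nbhs_ballP[e /= e0 eB]; have e2 : 0 < e / 2 by rewrite divr_gt0.
have [b' /(_ y)[k|b [_ H]]] := q_dense pq 0 e2.
  by have := yb k; rewrite !mxE => /andP[/ltW -> /ltW ->].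
have := H (2 ^ b).-1; rewrite prednK ?expn_gt0// leqnn ltn_exp2l// ltnSn => /(_ isT) qy.
exists (q (2 ^ b).-1); split.
  by exists (2 ^ b).-1 => //; rewrite /the_slits slitE; exact: center_in_slit.
apply: eB; rewrite -ball_normE /= distrC; apply: le_lt_trans qy _.
by rewrite ltr_pdivrMr// ltr_pMr// ltr1n.
Qed.

Definition system : slit_system R n :=
  @SlitSystem R n 0 (const_mx 1) the_slits n_ge1 system_box_lt system_slitsP
    system_slits_sub system_slits_disjoint system_separated system_diam_cvg0
    system_dense.

End System.
End Design.

(** * Rectangular paths around the slits *)

Section Levels.
Context {R : realType} {n : nat}.
Local Notation N := (n.+1%:R : R).
Local Notation vec := 'rV[R]_n.+1.
Local Notation second := (@second n).
Variables (q : nat -> vec) (h : nat -> R).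
Hypotheses (n_ge1 : (1 <= n)%N) (pq : placement q) (sh : sizes q h).
Local Notation S := (system n_ge1 pq sh).

Definition in_box (z : vec) : Prop := forall k, 0 < z 0 k < 1.
(** Points off all the planes of the slits: at such a point one can move freely inside the
    plane with the same coordinate of index 0. *)
Definition gen (z : vec) : Prop := in_box z /\ forall j, z 0 0 != q j 0 0.
Definition between (a b c : R) := (a < c < b) || (b < c < a).

Lemma domainP i z : slit_domain S i z <->
  in_box z /\ forall j, (j < i)%N -> ~ in_slit (q j) (h j) z.
Proof.
split=> [[zb zs]|[zb zs]].
  split=> [k|j ji zj]; first by have := zb k; rewrite !mxE.
  by apply: zs; exists j => //=; rewrite /the_slits slitE.
split=> [k|[j /= ji]]; first by have := zb k; rewrite !mxE.
by rewrite /the_slits slitE; exact: zs.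
Qed.

Lemma box_segment u w (t : R) : in_box u -> in_box w -> 0 <= t <= 1 ->
  in_box (u + t *: (w - u)).
Proof.
move=> ub wb /andP[t0 t1] k; rewrite !mxE; have /andP[? ?] := ub k; have /andP[? ?] := wb k.
have -> : u 0 k + t * (w 0 k - u 0 k) = (1 - t) * u 0 k + t * w 0 k by ring.
have [th|th] := leP t 2^-1; apply/andP; split; nra.
Qed.

Lemma segment_dist i u w : in_box u -> in_box w ->
  (forall j (t : R), (j < i)%N -> 0 <= t <= 1 -> ~ in_slit (q j) (h j) (u + t *: (w - u))) ->
  (inner_dist (slit_domain S i) u w <= (edist u w)%:E)%E.
Proof.
move=> ub wb H; apply: inner_dist_segment => t t01; apply/domainP; split.
  exact: box_segment.
by move=> j ji; exact: H.
Qed.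

(** A plane that contains no slit can be followed along a straight segment. *)
Lemma plane_dist i u w : gen u -> in_box w -> w 0 0 = u 0 0 ->
  (inner_dist (slit_domain S i) u w <= (edist u w)%:E)%E.
Proof.
move=> [ub uq] wb w0; apply: segment_dist => // j t _ _ [/eqP].
by rewrite !mxE w0 subrr mulr0 addr0 (negbTE (uq j)).
Qed.

(** A segment orthogonal to the slits is admissible if it passes beside every slit whose
    plane it crosses. *)
Lemma cross_dist i w v : gen w -> gen v -> (forall k, k != 0 -> w 0 k = v 0 k) ->
  (forall j, (j < i)%N -> between (w 0 0) (v 0 0) (q j 0 0) ->
     exists2 k, k != 0 & h j < `|v 0 k - q j 0 k|) ->
  (inner_dist (slit_domain S i) w v <= (edist w v)%:E)%E.
Proof.
move=> [wb wq] [vb vq] wv H; apply: segment_dist => // j t ji /andP[t0 t1] [e0 es].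
have b : between (w 0 0) (v 0 0) (q j 0 0).
  move: e0; rewrite !mxE /between; have := wq j; have := vq j.
  set x := w 0 0; set y := v 0 0; set c := q j 0 0 => yc xc e.
  have xlty : x < y \/ y < x.
    have [l|l|l] := ltgtP x y; [by left|by right|].
    by case/eqP: xc; rewrite -e l subrr mulr0 addr0.
  have t0' : 0 < t.
    by rewrite lt_neqAle t0 andbT; apply: contra_neq xc => te; rewrite -e -te mul0r addr0.
  have t1' : t < 1.
    rewrite lt_neqAle t1 andbT; apply: contra_neq yc => te; rewrite -e te mul1r.
    by rewrite addrC subrK.
  by rewrite -e; case: xlty => l; apply/orP; [left|right]; apply/andP; split; nra.
have [k k0] := H j ji b; apply/negP; rewrite -leNgt; have := es k k0.
by rewrite !mxE wv// subrr mulr0 addr0.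
Qed.

(** The projections of the slits of index at least m to the second axis do not cover an
    interval of length 4 h_m: each step of the induction keeps a part of the interval that
    one slit leaves free, and the sizes decrease by the factor 8. *)
Lemma uncovered i m (a T : R) : 4 * h m <= T ->
  exists2 b, a < b < a + T & forall j, (m <= j < i)%N -> h j < `|b - q j 0 second|.
Proof.
move: {2}(i - m)%N (leqnn (i - m)) => k; elim: k m a T => [|k ih] m a T im hT.
  have h0 := h_gt0 sh m; exists (a + T / 2); first by apply/andP; split; lra.
  by move=> j; lia.
have h0 := h_gt0 sh m; have h1 := h_step sh m; set c := q m 0 second.
have hm : h m < `|c - a - T / 2| \/ `|c - a - T / 2| <= h m by have [|] := ltP (h m) `|c - a - T / 2|; [left|right].
have [b ab Hb] : exists2 b, a < b < a + T & h m < `|b - c| /\ forall j, (m.+1 <= j < i)%N -> h j < `|b - q j 0 second|.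
  have [cT|cT] := leP c (a + T / 2).
    pose a' := Num.max a (c + h m).
    have aa' : a <= a' by rewrite le_max lexx.
    have ca' : c + h m <= a' by rewrite le_max lexx orbT.
    have a'T : a' <= a + T / 2 + h m by rewrite ge_max; apply/andP; split; lra.
    have [||b ab Hb] := ih m.+1 a' (a + T - a'); first by lia.
      by lra.
    move: ab => /andP[? ?]; exists b; first by apply/andP; split; lra.
    by split => //; rewrite ltr_normr; apply/orP; left; lra.
  pose b' := Num.min (a + T) (c - h m).
  have aa' : b' <= a + T by rewrite ge_min lexx.
  have ca' : b' <= c - h m by rewrite ge_min lexx orbT.
  have a'T : a + T / 2 - h m <= b' by rewrite le_min; apply/andP; split; lra.
  have [||b ab Hb] := ih m.+1 a (b' - a); first by lia.
    by lra.
  move: ab => /andP[? ?]; exists b; first by apply/andP; split; lra.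
  by split => //; rewrite ltr_normr; apply/orP; right; lra.
exists b => // j /andP[]; rewrite leq_eqVlt => /predU1P[<- _|mj ji]; first by case: Hb.
by apply: Hb.2; rewrite mj.
Qed.

Lemma h_le8 m : h m <= 8^-1.
Proof. exact: le_trans (h_anti sh (leq0n m)) (h_first sh). Qed.

(** The distance is estimated along a path in three pieces: inside the plane of u to a point
    w that has the coordinates of v except for a second coordinate b, then across all the
    planes to w', then inside the plane of v. The value b is chosen within 4 h_m of the
    coordinate of v so that the crossing misses the slits of index at least m; the hypothesis
    takes care of the others. *)
Lemma rect_path i m u v : gen u -> gen v ->
  (forall j, (j < m)%N -> between (u 0 0) (v 0 0) (q j 0 0) ->
     exists2 k, k != 0 & h j + 4 * h m < `|v 0 k - q j 0 k|) ->
  (inner_dist (slit_domain S i) u v <= (N * `|u - v| + 8 * h m)%:E)%E.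
Proof.
move=> gu gv H; have [ub uq] := gu; have [vb vq] := gv.
have h0 := h_gt0 sh m; have h8 := h_le8 m; have s0 := second_neq0 n_ge1.
have /andP[v0 v1] := vb second.
have [b [bv b01 Hb]] : exists b, [/\ `|b - v 0 second| < 4 * h m, 0 < b < 1 &
    forall j, (m <= j < i)%N -> h j < `|b - q j 0 second|].
  have [v2|v2] := leP (v 0 second) 2^-1.
    have [b /andP[? ?] Hb] := uncovered i (v 0 second) (lexx (4 * h m)).
    exists b; split => //; last by apply/andP; split; lra.
    by rewrite ltr_norml; apply/andP; split; lra.
  have [b /andP[? ?] Hb] := uncovered i (v 0 second - 4 * h m) (lexx (4 * h m)).
  exists b; split => //; last by apply/andP; split; lra.
  by rewrite ltr_norml; apply/andP; split; lra.
pose w : vec := \row_k if k == 0 then u 0 0 else if k == second then b else v 0 k.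
pose w' : vec := \row_k if k == second then b else v 0 k.
have w0 : w 0 0 = u 0 0 by rewrite mxE eqxx.
have w'0 : w' 0 0 = v 0 0 by rewrite mxE eq_sym (negbTE s0).
have wb : in_box w by move=> k; rewrite mxE; case: eqP => // _; case: eqP.
have w'b : in_box w' by move=> k; rewrite mxE; case: eqP.
have gw : gen w by split => // j; rewrite w0.
have gw' : gen w' by split => // j; rewrite w'0.
apply: le_trans (inner_dist_triangle _ w _ _) _.
apply: (@le_trans _ _ ((n%:R * `|u - v| + 4 * h m)%:E + (`|u - v| + 4 * h m)%:E)%E); last first.
  rewrite -EFinD lee_fin -natr1; lra.
apply: leeD.
  apply: le_trans (plane_dist i gu wb w0) _; rewrite lee_fin.
  apply: le_trans (edist_le_sum _ _) _; rewrite (bigD1 0)//= w0 subrr normr0 add0r.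
  rewrite (bigD1 second)//=.
  have : \sum_(k < n.+1 | (k != 0) && (k != second)) `|u 0 k - w 0 k| <= n.-1%:R * `|u - v|.
    apply: (@le_trans _ _ (\sum_(k < n.+1 | (k != 0) && (k != second)) `|u - v|)).
      apply: ler_sum => k /andP[k0 ks]; rewrite mxE (negbTE k0) (negbTE ks).
      exact: coord_dist.
    rewrite sumr_const -[leLHS]mulr_natl; apply: ler_wpM2r => //; rewrite ler_nat.
    have -> : #|[pred k : 'I_n.+1 | (k != 0) && (k != second)]| = #|(~: [set 0; second])%SET|.
      by apply: eq_card => k; rewrite !inE negb_or.
    have := cardsC [set 0; second]%SET; rewrite cards2 eq_sym s0 card_ord; lia.
  move=> hs; have : `|u 0 second - w 0 second| <= `|u - v| + 4 * h m.
    rewrite mxE (negbTE s0) eqxx.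
    have -> : u 0 second - b = (u 0 second - v 0 second) - (b - v 0 second) by ring.
    by apply: le_trans (ler_normB _ _) _; apply: lerD; [exact: coord_dist|exact: ltW].
  have -> : n%:R = n.-1%:R + 1 :> R by rewrite natr1 prednK.
  lra.
apply: le_trans (inner_dist_triangle _ w' _ _) _; rewrite EFinD; apply: leeD.
  apply: (@le_trans _ _ (edist w w')%:E); last first.
    rewrite lee_fin (edist_one_coord (k := 0)) ?w0 ?w'0; first exact: coord_dist.
    by move=> k k0; rewrite !mxE (negbTE k0).
  apply: cross_dist => //; first by move=> k k0; rewrite !mxE (negbTE k0).
  rewrite w0 w'0 => j ji bt; have [jm|mj] := ltnP j m; last first.
    by exists second => //; rewrite mxE eqxx; apply: Hb; rewrite mj.
  have [k k0 hk] := H j jm bt; exists k => //; rewrite mxE; case: eqP => [ks|_]; last by lra.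
  have -> : b - q j 0 k = (v 0 k - q j 0 k) + (b - v 0 k) by ring.
  rewrite ks in hk *; have := ler_normD (v 0 second - q j 0 second + (b - v 0 second)) (- (b - v 0 second)).
  by rewrite addrK normrN; lra.
rewrite inner_dist_sym; apply: le_trans (plane_dist i gv w'b w'0) _; rewrite lee_fin.
rewrite (edist_one_coord (k := second)).
  by rewrite mxE eqxx distrC ltW.
by move=> k ks; rewrite mxE (negbTE ks).
Qed.

End Levels.

(** * Points of the slit space and their distances *)

(** The triangle inequality in a form that leaves the arithmetic to a separate goal. *)
Lemma mdist_tri2 {R : realType} {T : metricType R} (a b c : T) (x y z : R) :
  mdist a b <= x -> mdist b c <= y -> x + y <= z -> mdist a c <= z.
Proof.
by move=> ab bc; apply: le_trans; apply: le_trans (metric_triangle a b c) _; exact: lerD.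
Qed.

Lemma mdist_tri3 {R : realType} {T : metricType R} (a b c d : T) (x y z t : R) :
  mdist a b <= x -> mdist b c <= y -> mdist c d <= z -> x + y + z <= t -> mdist a d <= t.
Proof.
move=> ab bc cd; apply: mdist_tri2 (mdist_tri2 ab bc (lexx _)) cd.
Qed.

Section Points.
Context {R : realType} {n : nat}.
Local Notation N := (n.+1%:R : R).
Local Notation vec := 'rV[R]_n.+1.
Local Notation second := (@second n).
Variables (q : nat -> vec) (h : nat -> R).
Hypotheses (n_ge1 : (1 <= n)%N) (pq : placement q) (sh : sizes q h).
Local Notation S := (system n_ge1 pq sh).
Local Notation gen := (gen q).

(** Points of the box off all the slits. They include the generic points, and also the
    hyperplane where the second coordinate is 1/2. *)
Definition free (z : vec) : Prop := in_box z /\ forall j, ~ in_slit (q j) (h j) z.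

Lemma gen_free z : gen z -> free z.
Proof. by move=> [zb zq]; split => // j [/eqP]; rewrite (negbTE (zq j)). Qed.

Lemma half_free z : in_box z -> z 0 second = 2^-1 -> free z.
Proof.
move=> zb zs; split => // j [_ /(_ second (second_neq0 n_ge1))]; rewrite zs distrC.
by apply/negP; rewrite -ltNge (h_half sh).
Qed.

Lemma free_domain i z : free z -> slit_domain S i z.
Proof. by move=> [zb zq]; apply/domainP. Qed.

(** A reference point off all the slits. *)
Definition middle : vec := const_mx 2^-1.

Lemma middle_free : free middle.
Proof.
by apply: half_free => [k|]; rewrite mxE// invr_gt0 ltr0n invf_lt1// ltr1n.
Qed.

(** Points off the domain go to the reference point, which keeps the map total. *)
Definition in_level i (z : vec) : inner_space S i :=
  match pselect (slit_domain S i z) with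
  | left zi => SigSub (mem_set zi)
  | right _ => SigSub (mem_set (free_domain i middle_free))
  end.

Lemma in_levelE i z : slit_domain S i z -> val (in_level i z) = z.
Proof. by rewrite /in_level; case: pselect. Qed.

Lemma cst_cauchy i (x : inner_space S i) : (fun _ : nat => x) \in [set u : nat -> inner_space S i | cauchy (u @ \oo)].
Proof.
by apply/mem_set/cauchy_mdistP => e e0; do 2 apply: nearW => ?; rewrite mdistxx.
Qed.

Definition cst_seq i (x : inner_space S i) : cauchy_seqs (inner_space S i) := SigSub (cst_cauchy x).

Lemma cst_seq_dist i (x y : inner_space S i) : seq_dist (cst_seq x) (cst_seq y) = mdist x y.
Proof. by rewrite /seq_dist (_ : (fun k => _) = fun=> mdist x y) ?lim_cst. Qed.

Definition level_pt i (z : vec) : slit_completion S i := completion_pi (cst_seq (in_level i z)).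

Lemma level_mdist i u v : free u -> free v ->
  (mdist (level_pt i u) (level_pt i v))%:E = inner_dist (slit_domain S i) u v.
Proof.
move=> fu fv; rewrite completion_pi_dist cst_seq_dist /mdist /= /inner_space_dist.
rewrite !in_levelE; try exact: free_domain.
rewrite fineK// ge0_fin_numE ?inner_dist_ge0//.
by apply: inner_dist_slit_domain_lty; exact: free_domain.
Qed.

Lemma dist_le_level i u v : free u -> free v -> edist u v <= mdist (level_pt i u) (level_pt i v).
Proof. by move=> fu fv; rewrite -lee_fin level_mdist// edist_le_inner_dist. Qed.

Lemma slit_tau_level i j (ij : (i <= j)%N) z : free z -> slit_tau ij (level_pt j z) = level_pt i z.
Proof.
move=> fz; apply/completion_piP; apply/eqP; rewrite eq_le seq_dist_ge0 andbT.
set w := completion_repr _.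
have w0 : seq_dist w (cst_seq (in_level j z)) = 0.
  by apply/completion_piP; exact: completion_reprK.
have e : in_level i z = inner_space_incl ij (in_level j z).
  apply: val_inj; rewrite (in_levelE (free_domain i fz)).
  exact: esym (in_levelE (free_domain j fz)).
rewrite -w0 e; apply: ler_lim; [exact: cvg_mdist_seq|exact: cvg_mdist_seq|].
by apply: nearW => k; exact: inner_space_incl_lip.
Qed.

Definition thread_pred (p : forall i, slit_completion S i) : Prop :=
  forall i j (ij : (i <= j)%N), slit_tau ij (p j) = p i.

(** A point that lies in all the domains defines a thread of the inverse limit; other points
    get a default value. *)
Definition thread (z : vec) : slit_limit S :=
  match pselect (free z) with
  | left fz => exist thread_pred (fun i => level_pt i z) (fun i j ij => slit_tau_level ij fz)
  | right _ => exist thread_pred (fun i => level_pt i middle) (fun i j ij => slit_tau_level ij middle_free)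
  end.

Lemma threadE z i : free z -> sval (thread z) i = level_pt i z.
Proof. by rewrite /thread; case: pselect. Qed.

(** An interval of positive length is not countable. *)
Lemma avoid_countable (f : nat -> R) (a b : R) : a < b ->
  exists2 x, a < x < b & forall j, x != f j.
Proof.
move=> ab; apply: contrapT => H.
have sub : `]a, b[%classic `<=` range f.
  move=> x /=; rewrite in_itv /= => xab; apply: contrapT => xf; apply: H; exists x => // j.
  by apply/eqP => xfj; apply: xf; exists j.
have c : countable `]a, b[%classic.
  apply: sub_countable (subset_card_le sub) _.
  exact: sub_countable (card_image_le f setT) (countableP _).
have := countable_lebesgue_measure0 c; rewrite lebesgue_measure_itv /= lte_fin ab -EFinD => -[/eqP].
by rewrite subr_eq0 => /eqP ba; rewrite ba ltxx in ab.
Qed.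

(** Small motions along the coordinate of index 0 stay in the open domain and leave the
    countably many slit planes. *)
Lemma nearby_gen i z (e : R) : 0 < e -> slit_domain S i z ->
  exists2 u, gen u & (inner_dist (slit_domain S i) z u <= e%:E)%E.
Proof.
move=> e0 /domainP[zb zs].
have [d d0 Hd] : exists2 d, 0 < d & forall j, (j < i)%N -> z 0 0 < q j 0 0 -> z 0 0 + d <= q j 0 0.
  elim: {zs} i => [|i [d d0 Hd]]; first by exists 1.
  have [zq|zq] := ltP (z 0 0) (q i 0 0).
    exists (Num.min d (q i 0 0 - z 0 0)); first by rewrite lt_min d0 subr_gt0.
    move=> j; rewrite ltnS leq_eqVlt => /predU1P[->|ji] zj.
      by rewrite -lerBrDl ge_min lexx orbT.
    by apply: le_trans (Hd j ji zj); rewrite lerD2l ge_min lexx.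
  exists d => // j; rewrite ltnS leq_eqVlt => /predU1P[->|ji] zj; last exact: Hd.
  by move: zq; rewrite leNgt zj.
have /andP[z0 z1] := zb 0.
have [x /andP[zx xd] xq] := @avoid_countable (fun j => q j 0 0) (z 0 0)
  (z 0 0 + Num.min d (Num.min e (1 - z 0 0))) (ltac:(by rewrite ltrDl !lt_min d0 e0 subr_gt0)).
move: xd; rewrite -ltrBlDl !lt_min => /and3P[xd xe x1].
pose u : vec := \row_k (if k == 0 then x else z 0 k).
have u0 : u 0 0 = x by rewrite mxE eqxx.
have ub : in_box u.
  by move=> k; rewrite mxE; case: eqP => [_|_]; [apply/andP; split; lra|exact: zb].
exists u; first by split => // j; rewrite u0.
apply: (@le_trans _ _ (edist z u)%:E); last first.
  rewrite lee_fin (edist_one_coord (k := 0)) ?u0; last by move=> k k0; rewrite mxE (negbTE k0).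
  by rewrite ltr0_norm ?subr_lt0// opprB ltW.
apply: segment_dist => // j t ji /andP[t0 t1].
have [->|tn] := eqVneq t 0; first by rewrite scale0r addr0; exact: zs.
have tp : 0 < t by rewrite lt_neqAle eq_sym tn.
move=> [] ; rewrite !mxE eqxx => e1 _.
have : z 0 0 < q j 0 0 by rewrite -e1 ltrDl mulr_gt0// subr_gt0.
by move=> /(Hd j ji); rewrite -e1; nra.
Qed.

Lemma level_approx i (p : slit_completion S i) (e : R) : 0 < e ->
  exists2 u, gen u & mdist p (level_pt i u) < e.
Proof.
move=> e0; have e4 : 0 < e / 4 by rewrite divr_gt0.
have e44 : e / 4 + e / 4 < e by lra.
pose s := completion_repr p.
have /cauchy_mdistP/(_ _ e4)[k _ /(_ k (leqnn k)) ks] : cauchy (seq_of s @ \oo) := set_mem (valP s).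
have sk := set_mem (valP (seq_of s k)).
have [u gu zu] := nearby_gen e4 sk.
exists u => //; have fu := gen_free gu.
apply: le_lt_trans (metric_triangle _ (completion_pi (cst_seq (seq_of s k))) _) _.
have h1 : mdist p (completion_pi (cst_seq (seq_of s k))) <= e / 4.
  rewrite -[p in mdist p]completion_reprK completion_pi_dist.
  apply: limr_le; first exact: cvg_mdist_seq.
  by apply: filterS ks => m; rewrite metric_sym => /ltW.
have h2 : mdist (completion_pi (cst_seq (seq_of s k))) (level_pt i u) <= e / 4.
  rewrite completion_pi_dist cst_seq_dist -lee_fin /mdist /= /inner_space_dist fineK.
    by rewrite (in_levelE (free_domain i fu)).
  rewrite ge0_fin_numE ?inner_dist_ge0//; apply: inner_dist_slit_domain_lty => //.
  by rewrite (in_levelE (free_domain i fu)); exact: free_domain.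
exact: le_lt_trans (lerD h1 h2) e44.
Qed.

Lemma gen_dist_le i m u v : gen u -> gen v ->
  (forall j, (j < m)%N -> between (u 0 0) (v 0 0) (q j 0 0) ->
     exists2 k, k != 0 & h j + 4 * h m < `|v 0 k - q j 0 k|) ->
  mdist (level_pt i u) (level_pt i v) <= N * `|u - v| + 8 * h m.
Proof.
move=> gu gv H; rewrite -lee_fin level_mdist; try exact: gen_free.
exact: rect_path.
Qed.

Lemma gen_level_bound i u v : gen u -> gen v ->
  mdist (level_pt i u) (level_pt i v) <= N + 8 * h 0%N.
Proof.
move=> gu gv; apply: le_trans (gen_dist_le i (m := 0) gu gv _) _; first by [].
rewrite lerD2r ler_piMr//; apply: dist_le_coord => // k.
have /andP[? ?] := gu.1 k; have /andP[? ?] := gv.1 k.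
by rewrite ler_norml; apply/andP; split; lra.
Qed.

(** The level distances of two threads are bounded, by rect_path between generic
    approximations, and they are nondecreasing. *)
Lemma slit_space_cvg : slit_dist_cvg S.
Proof.
move=> p r; apply: nondecreasing_is_cvgn; first exact: slit_dist_seq_nd.
exists (N + 3) => _ [i _ <-]; rewrite /slit_dist_seq.
have h01 := h_first sh; have ar : 1 + (N + 8 * h 0%N) + 1 <= N + 3 by lra.
have [u gu /ltW pu] := level_approx (sval p i) (@ltr01 R).
have [v gv /ltW rv] := level_approx (sval r i) (@ltr01 R).
rewrite metric_sym in rv; apply: mdist_tri3 pu _ rv ar.
exact: gen_level_bound.
Qed.

Lemma dist_seq_le (p r : slit_limit S) i : slit_dist_seq p r i <= limn (slit_dist_seq p r).
Proof.
by have := nondecreasing_cvgn_le (@slit_dist_seq_nd _ _ _ p r) (@slit_space_cvg p r); apply.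
Qed.

Local Notation X := (slit_space slit_space_cvg).
Implicit Types (p r : X).

Lemma level_le i p r : mdist (sval p i) (sval r i) <= mdist p r.
Proof.
change (slit_dist_seq p r i <= limn (slit_dist_seq p r)).
exact: dist_seq_le.
Qed.

(** The distance is the limit of the level distances, so a bound on cofinally many levels
    suffices. *)
Lemma mdist_le p r (B : R) : (forall m, exists2 i, (m <= i)%N & mdist (sval p i) (sval r i) <= B) ->
  mdist p r <= B.
Proof.
move=> H; change (limn (slit_dist_seq p r) <= B).
apply: limr_le; first exact: slit_space_cvg.
apply: nearW => m; have [i mi hB] := H m; apply: le_trans hB.
exact: slit_dist_seq_nd.
Qed.

(** The point of the slit space over a free point of the box. *)
Definition pt (z : vec) : X := thread z.

Lemma pt_mdist_le u v (B : R) : free u -> free v ->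
  (forall i, (inner_dist (slit_domain S i) u v <= B%:E)%E) -> mdist (pt u) (pt v) <= B.
Proof.
move=> fu fv H; apply: mdist_le => m; exists m => //.
by rewrite !threadE// -lee_fin level_mdist.
Qed.

Lemma pt_edist_le u v : free u -> free v -> edist u v <= mdist (pt u) (pt v).
Proof.
move=> fu fv; apply: le_trans (level_le 0 _ _); rewrite !threadE//.
exact: dist_le_level.
Qed.

Lemma pt_norm_le u v : free u -> free v -> `|u - v| <= mdist (pt u) (pt v).
Proof. by move=> fu fv; apply: le_trans (pt_edist_le fu fv); exact: norm_le_edist. Qed.

(** The estimate of rect_path is uniform in the level, hence passes to the slit space. *)
Lemma pt_dist_le m u v : gen u -> gen v ->
  (forall j, (j < m)%N -> between (u 0 0) (v 0 0) (q j 0 0) ->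
     exists2 k, k != 0 & h j + 4 * h m < `|v 0 k - q j 0 k|) ->
  mdist (pt u) (pt v) <= N * `|u - v| + 8 * h m.
Proof.
move=> gu gv H; have fu := gen_free gu; have fv := gen_free gv.
by apply: pt_mdist_le => // i; exact: rect_path.
Qed.

Lemma pt_plane u w : gen u -> in_box w -> w 0 0 = u 0 0 -> mdist (pt u) (pt w) = edist u w.
Proof.
move=> gu wb w0; have gw : gen w by split => // j; rewrite w0; exact: gu.2.
have fu := gen_free gu; have fw := gen_free gw.
apply/eqP; rewrite eq_le pt_edist_le// andbT.
by apply: pt_mdist_le => // i; exact: plane_dist.
Qed.

(** The segment inside the hyperplane where the second coordinate is 1/2 meets no slit. *)
Lemma pt_half u w : in_box u -> in_box w -> u 0 second = 2^-1 -> w 0 second = 2^-1 ->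
  mdist (pt u) (pt w) = edist u w.
Proof.
move=> ub wb us ws; have fu := half_free ub us; have fw := half_free wb ws.
apply/eqP; rewrite eq_le pt_edist_le// andbT.
apply: pt_mdist_le => // i; apply: segment_dist => // j t _ t01.
apply: (half_free _ _).2; first exact: box_segment.
by rewrite !mxE us ws subrr mulr0 addr0.
Qed.

Lemma space_diam p r : mdist p r <= N + 3.
Proof.
have h01 := h_first sh; have ar : 1 + (N + 8 * h 0%N) + 1 <= N + 3 by lra.
apply: mdist_le => i; exists i => //.
have [u gu /ltW pu] := level_approx (sval p i) (@ltr01 R).
have [v gv /ltW rv] := level_approx (sval r i) (@ltr01 R).
rewrite metric_sym in rv; apply: mdist_tri3 pu _ rv ar.
exact: gen_level_bound.
Qed.

End Points.

(** * Dense sets of points, close pairs, points deep between the slits *)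

Section Density.
Context {R : realType} {n : nat}.
Local Notation N := (n.+1%:R : R).
Local Notation vec := 'rV[R]_n.+1.
Local Notation second := (@second n).
Variables (q : nat -> vec) (h : nat -> R).
Hypotheses (n_ge1 : (1 <= n)%N) (pq : placement q) (sh : sizes q h).
Local Notation S := (system n_ge1 pq sh).
Local Notation gen := (gen q).
Local Notation X := (slit_space (@slit_space_cvg _ _ _ _ n_ge1 pq sh)).
Local Notation pt := (pt n_ge1 pq sh).

Lemma h_small (e : R) : 0 < e -> exists m, h m < e.
Proof.
move=> e0; have c : (8^-1 : R) ^+ k @[k --> \oo] --> (0 : R).
  by apply: cvg_expr; rewrite ger0_norm ?invr_ge0// invf_lt1// ltr1n.
have /cvgr0Pnorm_lt/(_ e e0)[k _ /(_ k.+1 (leqnSn k)) ke] := c.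
exists k; apply: le_lt_trans (h_exp sh k) _.
by apply: le_lt_trans ke; rewrite ler_norm.
Qed.

Lemma N1 : 1 <= N. Proof. by rewrite ler1n. Qed.

Lemma plane_gap m i j : (i < m)%N -> (j < m)%N -> i != j -> 16 * N * h m < `|q i 0 0 - q j 0 0|.
Proof.
move=> im jm ij; have [g|g] := gap_neq sh ij; apply: le_lt_trans g;
  by rewrite ler_wpM2l ?mulr_ge0// (h_anti sh)// ltnW.
Qed.

Lemma between_dist (a b c : R) : between a b c -> `|a - c| < `|a - b| /\ `|b - c| < `|a - b|.
Proof.
move=> /orP[] /andP[x y]; have z := lt_trans x y.
  by rewrite (distrC a c) (distrC a b) !gtr0_norm ?subr_gt0//; split; lra.
by rewrite (distrC b c) !gtr0_norm ?subr_gt0//; split; lra.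
Qed.

Lemma between_sym (a b c : R) : between a b c = between b a c.
Proof. by rewrite /between orbC. Qed.

(** Values that all lie in a short interval meet at most one of the first m planes;
    infinitely many of them lie on the same side of it as some chosen one. *)
Lemma one_side (u : nat -> R) m (d : R) : 0 < d -> d <= h m ->
  (forall i k, `|u i - u k| < 2 * d) ->
  exists i, forall k0, exists2 k, (k0 <= k)%N &
    forall j, (j < m)%N -> ~ between (u i) (u k) (q j 0 0).
Proof.
move=> d0 dh uu; have N0 := N1; have h0 := h_gt0 sh m.
have [[j [jm [i1 [k1 b]]]]|none] := pselect (exists j, (j < m)%N /\ exists i k, between (u i) (u k) (q j 0 0)); last first.
  by exists 0%N => k0; exists k0 => // j jm b; apply: none; exists j; split => //; exists 0%N, k0.
have nearj k : `|u k - q j 0 0| < 4 * d.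
  have := (between_dist b).1; have := uu i1 k1; have := uu k i1.
  by have := ler_distD (u i1) (u k) (q j 0 0); lra.
have only i k j' : (j' < m)%N -> between (u i) (u k) (q j' 0 0) -> j' = j.
  move=> jm' b'; apply/eqP/negPn/negP => jj'; have := plane_gap jm' jm jj'.
  have := (between_dist b').1; have := uu i k; have := nearj i.
  have := ler_distD (u i) (q j' 0 0) (q j 0 0); rewrite (distrC (q j' 0 0) (u i)).
  have : h m <= N * h m by rewrite ler_peMl// ltW.
  by lra.
have [i2 [k2 [l2 r2]]] : exists i k, u i < q j 0 0 /\ q j 0 0 < u k.
  by case/orP: b => /andP[? ?]; [exists i1, k1|exists k1, i1].
have [inf|/existsNP[k0 fin]] := pselect (forall k0, exists2 k, (k0 <= k)%N & u k < q j 0 0).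
  exists i2 => k0; have [k k0k uk] := inf k0; exists k => // j' jm' b'.
  by move: (b'); rewrite (only _ _ _ jm' b') /between => /orP[] /andP[? ?]; lra.
exists k2 => k1'; exists (maxn k0 k1'); first by rewrite leq_maxr.
move=> j' jm' b'; move: (b'); rewrite (only _ _ _ jm' b') /between => /orP[] /andP[? ?].
  by lra.
by apply: fin; exists (maxn k0 k1'); rewrite ?leq_maxl.
Qed.

(** Approximate p at each level k by a generic point u k. All these points are close in the
    sup norm, but a slit may separate them; by one_side some u i has infinitely many u k on
    its side, and then rect_path bounds its distance to p at infinitely many levels. *)
Lemma gen_dense (p : X) (e : R) : 0 < e -> exists2 u, gen u & mdist p (pt u) <= e.
Proof.
move=> e0; have N0 := N1.
have [m hm] : exists m, h m < e / 16 by apply: h_small; rewrite divr_gt0.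
have h0 := h_gt0 sh m.
pose d := Num.min (h m) (e / (8 * N)).
have d0 : 0 < d by rewrite lt_min h0 divr_gt0// mulr_gt0// ltr0n.
have dh : d <= h m by rewrite ge_min lexx.
have dN : N * d <= e / 8.
  have : d <= e / (8 * N) by rewrite ge_min lexx orbT.
  by rewrite ler_pdivlMr ?mulr_gt0 ?ltr0n//; lra.
have ar : d + (N * (2 * d) + 8 * h m) <= e.
  by have := ler_wpM2r (ltW d0) N0; rewrite mul1r; lra.
have /choice[u uP] : forall k, exists u, gen u /\ mdist (sval p k) (level_pt n_ge1 pq sh k u) < d.
  by move=> k; have [u gu pu] := level_approx (sval p k) d0; exists u.
have gu k : gen (u k) := (uP k).1.
have fu k := gen_free h (gu k).
have uu i k : `|u i - u k| < 2 * d.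
  wlog ik : i k / (i <= k)%N.
    by move=> H; case: (leqP i k) => [|/ltnW] /H//; rewrite distrC.
  apply: le_lt_trans (norm_le_edist _ _) _.
  apply: le_lt_trans (dist_le_level n_ge1 pq sh i (fu i) (fu k)) _.
  apply: le_lt_trans (metric_triangle _ (sval p i) _) _; rewrite metric_sym mulr_natl mulr2n.
  apply: ltrD; first exact: (uP i).2.
  apply: le_lt_trans (uP k).2; rewrite -(slit_tau_level n_ge1 pq sh ik (fu k)) -(svalP p _ _ ik).
  exact: completion_map_lip.
have [i Hi] := one_side d0 dh (fun i k => le_lt_trans (coord_dist (u i) (u k) 0) (uu i k)).
exists (u i) => //; apply: mdist_le => k0; have [k k0k Hk] := Hi k0; exists k => //.
rewrite threadE//; apply: mdist_tri2 (ltW (uP k).2) _ ar.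
apply: le_trans (gen_dist_le n_ge1 pq sh k (m := m) (gu k) (gu i) _) _.
  by move=> j jm; rewrite between_sym => /(Hk _ jm).
by rewrite lerD2r ler_wpM2l// ltW.
Qed.

Definition near_slit i (u : vec) := `|u - q i| <= 2 * h i.

(** Two points near slit i are joined around its edge, at a cost proportional to its size. *)
Lemma near_slit_dist i u v : gen u -> gen v -> near_slit i u -> near_slit i v ->
  mdist (pt u) (pt v) <= (4 * N + 8) * h i.
Proof.
move=> gu gv nu nv; have h0 := h_gt0 sh i; have N0 := N1.
have uv : `|u - v| <= 4 * h i.
  by apply: le_trans (ler_distD (q i) _ _) _; rewrite (distrC (q i)); move: nu nv; rewrite /near_slit; lra.
apply: le_trans (pt_dist_le (m := i) n_ge1 pq sh gu gv _) _.
  move=> j ji b; exfalso; have := h_gap sh ji.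
  have := (between_dist b).1; have := coord_dist u v 0; have := coord_dist u (q i) 0.
  have : h i <= N * h i by rewrite ler_peMl// ltW.
  have := ler_distD (u 0 0) (q j 0 0) (q i 0 0); rewrite (distrC (q j 0 0) (u 0 0)).
  move: nu; rewrite /near_slit; lra.
have := ler_wpM2l (ler0n R n.+1) uv; lra.
Qed.

(** Points that are close in the sup norm are close in the space unless a slit of index below
    m separates them, and a slit separates them only if they are close to it as a whole. *)
Lemma cell_dichotomy m u v : gen u -> gen v -> `|u - v| <= h m ->
  mdist (pt u) (pt v) <= N * `|u - v| + 8 * h m \/
  exists i, [/\ (i < m)%N, near_slit i u, near_slit i v & between (u 0 0) (v 0 0) (q i 0 0)].
Proof.
move=> gu gv uv; have h0 := h_gt0 sh m; have N0 := N1.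
have [H|H] := pselect (exists i, [/\ (i < m)%N, near_slit i u, near_slit i v & between (u 0 0) (v 0 0) (q i 0 0)]).
  by right.
left; apply: pt_dist_le => // i im b.
have h8 : 8 * h m <= h i by exact: (h_lt sh).
have bu := (between_dist b).1; have bv := (between_dist b).2.
have uv0 := coord_dist u v 0.
have [k k0 far] : exists2 k, k != 0 & 2 * h i < `|u 0 k - q i 0 k| \/ 2 * h i < `|v 0 k - q i 0 k|.
  apply: contrapT => C; apply: H; exists i; split => //.
    apply: dist_le_coord => [|k]; first by lra.
    have [->|k0] := eqVneq k 0; first by lra.
    by rewrite leNgt; apply/negP => far; apply: C; exists k => //; left.
  apply: dist_le_coord => [|k]; first by lra.
  have [->|k0] := eqVneq k 0; first by lra.
  by rewrite leNgt; apply/negP => far; apply: C; exists k => //; right.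
exists k => //; have := coord_dist u v k.
have := ler_distD (v 0 k) (u 0 k) (q i 0 k).
by case: far; lra.
Qed.

Definition deep J (e : R) (x : vec) :=
  (forall i, (i < J)%N -> e < `|x 0 0 - q i 0 0|) /\ forall k, e < x 0 k < 1 - e.

Definition clearance J (e : R) :=
  [/\ 0 < e, 16 * e < 1, forall i, (i < J)%N -> 4 * e < q i 0 0 < 1 - 4 * e &
   forall i j, (i < J)%N -> (j < J)%N -> i != j -> 4 * e < `|q i 0 0 - q j 0 0|].

(** One avoids a neighbourhood of a separated set of values without crossing any of them, by
    moving away from the only value that is close. *)
Lemma step_away (F : R -> Prop) (f : nat -> R) (e y : R) : 0 < e ->
  (forall c c', F c -> F c' -> c = c' \/ 4 * e < `|c - c'|) ->
  (forall c, F c -> y != c) -> (forall j, y != f j) ->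
  exists x, [/\ `|y - x| <= 2 * e, forall j, x != f j &
    forall c, F c -> e < `|x - c| /\ ~ between y x c].
Proof.
move=> e0 sep yF yf.
have [H|/existsNP[c /not_implyP[Fc /negP]]] := pselect (forall c, F c -> e < `|y - c|).
  exists y; split => //; first by rewrite subrr normr0; lra.
  by move=> c Fc; split; [exact: H|rewrite /between orbb => /andP[? ?]; lra].
rewrite -leNgt ler_norml => /andP[c1 c2].
have far x : `|x - c| <= 2 * e -> forall c', F c' -> 4 * e < `|c - c'| -> e < `|x - c'| /\ ~ between y x c'.
  rewrite ler_norml => /andP[? ?] c' Fc' cc'; split.
    by move: cc'; rewrite !ltr_normr => /orP[] ?; apply/orP; [left|right]; lra.
  by move: cc'; rewrite !ltr_normr /between => /orP[] ? /orP[] /andP[? ?]; lra.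
have [lt|lt|e'] := ltgtP y c; last by have := yF c Fc; rewrite e' eqxx.
  have [x /andP[x1 x2] xf] := @avoid_countable R f (c - 2 * e) (c - e) (ltac:(lra)).
  exists x; split => //; first by rewrite ler_norml; apply/andP; split; lra.
  move=> c' Fc'; have [<-|cc'] := sep _ _ Fc Fc'; last first.
    by apply: far => //; rewrite ler_norml; apply/andP; split; lra.
  split; first by rewrite ltr_normr; apply/orP; right; lra.
  by rewrite /between => /orP[] /andP[? ?]; lra.
have [x /andP[x1 x2] xf] := @avoid_countable R f (c + e) (c + 2 * e) (ltac:(lra)).
exists x; split => //; first by rewrite ler_norml; apply/andP; split; lra.
move=> c' Fc'; have [<-|cc'] := sep _ _ Fc Fc'; last first.
  by apply: far => //; rewrite ler_norml; apply/andP; split; lra.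
split; first by rewrite ltr_normr; apply/orP; left; lra.
by rewrite /between => /orP[] /andP[? ?]; lra.
Qed.

(** Push u away from the nearest of the first J planes and from the boundary. No plane of
    index below J is crossed, hence rect_path applies. *)
Lemma deep_dense J e u : clearance J e -> gen u ->
  exists x, [/\ gen x, deep J e x & mdist (pt u) (pt x) <= 2 * N * e + 8 * h J].
Proof.
move=> [e0 e1 eq eqq] gu; have [ub uq] := gu; have /andP[u0 u1] := ub 0.
pose F c := c = 0 \/ c = 1 \/ exists2 i, (i < J)%N & c = q i 0 0.
have [x0 [ux0 x0q x0F]] : exists x, [/\ `|u 0 0 - x| <= 2 * e, forall j, x != q j 0 0 &
    forall c, F c -> e < `|x - c| /\ ~ between (u 0 0) x c].
  apply: step_away => //.
    move=> c c' [->|[->|[i iJ ->]]] [->|[->|[j jJ ->]]].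
    - by left.
    - by right; rewrite ltr_normr; apply/orP; right; lra.
    - by right; have /andP[? ?] := eq j jJ; rewrite ltr_normr; apply/orP; right; lra.
    - by right; rewrite ltr_normr; apply/orP; left; lra.
    - by left.
    - by right; have /andP[? ?] := eq j jJ; rewrite ltr_normr; apply/orP; left; lra.
    - by right; have /andP[? ?] := eq i iJ; rewrite ltr_normr; apply/orP; left; lra.
    - by right; have /andP[? ?] := eq i iJ; rewrite ltr_normr; apply/orP; right; lra.
    - by have [->|ij] := eqVneq i j; [left|right; exact: eqq].
  move=> c [->|[->|[i iJ ->]]]; [by rewrite gt_eqF|by rewrite lt_eqF|exact: uq].
have x0b : e < x0 < 1 - e.
  have [a1 b1] := x0F 0 (or_introl erefl); have [a2 b2] := x0F 1 (or_intror (or_introl erefl)).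
  have x00 : 0 <= x0 by rewrite leNgt; apply/negP => l; apply: b1; rewrite /between l u0 orbT.
  have x01 : x0 <= 1 by rewrite leNgt; apply/negP => l; apply: b2; rewrite /between l u1.
  move: a1 a2; rewrite subr0 ger0_norm// ler0_norm ?subr_le0//.
  by move=> ? ?; apply/andP; split; lra.
pose x : vec := \row_k if k == 0 then x0 else Num.max (2 * e) (Num.min (u 0 k) (1 - 2 * e)).
have x00 : x 0 0 = x0 by rewrite mxE eqxx.
have xb k : e < x 0 k < 1 - e.
  have [->|k0] := eqVneq k 0; first by rewrite x00.
  rewrite mxE (negbTE k0) lt_max gt_max gt_min.
  by apply/andP; split; [|apply/andP; split]; apply/orP || idtac; (left; lra) || (right; lra) || lra.
have gx : gen x.
  split; last by move=> j; rewrite x00.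
  by move=> k; have /andP[? ?] := xb k; apply/andP; split; lra.
exists x; split => //; first split => //.
  by move=> i iJ; rewrite x00; apply: (x0F _ _).1; right; right; exists i.
have ux : `|u - x| <= 2 * e.
  apply: dist_le_coord => [|k]; first by lra.
  have [->|k0] := eqVneq k 0; first by rewrite x00.
  rewrite mxE (negbTE k0); have /andP[? ?] := ub k.
  rewrite ler_norml; case: (leP (u 0 k) (1 - 2 * e)) => ?.
    by case: (leP (2 * e) (u 0 k)) => ?; apply/andP; split; lra.
  by case: (leP (2 * e) (1 - 2 * e)) => ?; apply/andP; split; lra.
apply: le_trans (pt_dist_le (m := J) n_ge1 pq sh gu gx _) _.
  move=> j jJ; rewrite x00 => b; exfalso; apply: (x0F (q j 0 0) _).2 b.
  by right; right; exists j.
by rewrite lerD2r (mulrC 2 N) -mulrA; apply: ler_wpM2l.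
Qed.

End Density.

(** * Opening a slit into a hole *)

Section Opening.
Context {R : realType} {n : nat}.
Local Notation N := (n.+1%:R : R).
Local Notation vec := 'rV[R]_n.+1.
Local Notation second := (@second n).
Variables (q : nat -> vec) (h : nat -> R).
Hypotheses (n_ge1 : (1 <= n)%N) (pq : placement q) (sh : sizes q h).
Local Notation S := (system n_ge1 pq sh).
Local Notation gen := (gen q).
Local Notation X := (slit_space (@slit_space_cvg _ _ _ _ n_ge1 pq sh)).
Local Notation pt := (pt n_ge1 pq sh).

(** For z in the plane of slit k, the width of the hole over z; it vanishes off the cube of
    half size h k around the slit. *)
Definition bump k (z : vec) : R := Num.max 0 (h k - `|z - q k|).
Definition side k (z : vec) : R := if z 0 0 < q k 0 0 then -1 else 1.
(** Pulls the two sides of slit k apart along the coordinate of index 0. The image of the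
    generic points omits a double pyramid over the slit. *)
Definition opening k (z : vec) : vec :=
  \row_i if i == 0 then z 0 0 + 2^-1 * (side k z * bump k z) else z 0 i.

Lemma opening0 k (z : vec) : opening k z 0 0 = z 0 0 + 2^-1 * (side k z * bump k z).
Proof. by rewrite mxE eqxx. Qed.

Lemma openingN k (z : vec) i : i != 0 -> opening k z 0 i = z 0 i.
Proof. by rewrite mxE => /negbTE ->. Qed.

Lemma bump_ge0 k (z : vec) : 0 <= bump k z.
Proof. by rewrite /bump le_max lexx. Qed.

Lemma bump_lip k (u v : vec) : bump k u <= bump k v + `|u - v|.
Proof.
rewrite /bump ge_max; apply/andP; split.
  by rewrite addr_ge0// le_max lexx.
have : h k - `|v - q k| <= Num.max 0 (h k - `|v - q k|) by rewrite le_max lexx orbT.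
have := ler_distD u v (q k); rewrite (distrC v u).
by lra.
Qed.

Lemma sideP k (z : vec) : (z 0 0 < q k 0 0 /\ side k z = -1) \/ (q k 0 0 <= z 0 0 /\ side k z = 1).
Proof. by rewrite /side; case: ltP => ?; [left|right]. Qed.

Lemma opening_inv_real (x y c a b s t nn D : R) :
  (x < c /\ s = -1) \/ (c <= x /\ s = 1) -> (y < c /\ t = -1) \/ (c <= y /\ t = 1) ->
  0 <= a -> 0 <= b -> a <= b + nn -> b <= a + nn -> `|x - y| = nn ->
  `|x + 2^-1 * (s * a) - (y + 2^-1 * (t * b))| <= D -> nn <= 2 * D.
Proof.
move=> S T a0 b0 ab ba; rewrite ler_norml.
have [xy|xy] := leP x y.
  rewrite ler0_norm ?subr_le0// => e.
  by case: S => -[xc ->]; case: T => -[yc ->] /andP[? ?]; lra.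
rewrite gtr0_norm ?subr_gt0// => e.
by case: S => -[xc ->]; case: T => -[yc ->] /andP[? ?]; lra.
Qed.

(** On one side of the plane the bump changes the coordinate of index 0 with Lipschitz
    constant 1/2; on opposite sides the opening only increases the distance. *)
Lemma opening_inv k (u v : vec) : `|u - v| <= 2 * `|opening k u - opening k v|.
Proof.
have [i e] := norm_attained (u - v).
have [i0|i0] := eqVneq i 0; last first.
  have := coord_dist (opening k u) (opening k v) i; rewrite !openingN//.
  by rewrite e !mxE; have := normr_ge0 (opening k u - opening k v); lra.
have := bump_lip k v u; rewrite (distrC v u) => ba.
apply: opening_inv_real (sideP k u) (sideP k v) (bump_ge0 k u) (bump_ge0 k v)
  (bump_lip k u v) ba _ _; first by rewrite e i0 !mxE.
by rewrite -!opening0; exact: coord_dist.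
Qed.

Lemma bump_gt0 k (u : vec) : 0 < bump k u -> `|u - q k| < h k /\ bump k u = h k - `|u - q k|.
Proof.
rewrite /bump lt_max ltxx /= subr_gt0 => l; split => //.
by rewrite max_r// subr_ge0 ltW.
Qed.

(** A path that connects the two sides of slit k has to go around its edge, which costs at
    least the two distances to the edge. *)
Lemma crossing_cost k u v : gen u -> gen v -> u 0 0 < q k 0 0 <= v 0 0 ->
  0 < bump k u -> 0 < bump k v ->
  ((bump k u + bump k v)%:E <= inner_dist (slit_domain S k.+1) u v)%E.
Proof.
move=> gu gv /andP[uq qv] /bump_gt0[hu ->] /bump_gt0[hv ->].
apply: le_ereal_inf_tmp => _ [g [a [b [[ab cg gA ga gb] ->]]]].
have [t tab ht] : exists2 t, a <= t <= b & h k <= `|g t - q k|.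
  apply: contrapT => C.
  have inside t : a <= t <= b -> `|g t - q k| < h k.
    by move=> tab; rewrite ltNge; apply/negP => ?; apply: C; exists t.
  have cg0 : {within `[a, b], continuous (fun t => g t 0 0)}.
    move: cg => /subspace_continuousP cg; apply/subspace_continuousP => t tab.
    exact: cvg_comp (cg t tab) (@coord_continuous _ _ _ 0 0 (g t)).
  have [|c cab gc] := IVT ab cg0 (v := q k 0 0).
    by rewrite ga gb ge_min le_max (ltW uq) qv orbT.
  have /domainP[_ /(_ k (ltnSn k))] : slit_domain S k.+1 (g c) by apply: gA; exists c.
  apply; split => // i _; apply/ltW/(le_lt_trans (coord_dist _ _ i)).
  by apply: inside; move: cab; rewrite in_itv.
have ta : a < t.
  rewrite lt_neqAle (andP tab).1 andbT; apply/eqP => e; move: ht hu.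
  by rewrite -e ga leNgt => /negP.
have tb : t < b.
  rewrite lt_neqAle (andP tab).2 andbT; apply/eqP => e; move: ht hv.
  by rewrite e gb leNgt => /negP.
have P : itv_partition a b [:: t; b] by split => //=; rewrite ta tb.
apply: le_trans (curve_length_ub g P); rewrite lee_fin.
rewrite !polygon_length_cons polygon_length_nil addr0 ga gb.
have := norm_le_edist u (g t); have := norm_le_edist (g t) v.
have := ler_distD u (g t) (q k); have := ler_distD v (g t) (q k).
by rewrite (distrC u (g t)); lra.
Qed.

Lemma opening_lip_real (x y c a b s t nn d : R) : 
  (x < c /\ s = -1) \/ (c <= x /\ s = 1) -> (y < c /\ t = -1) \/ (c <= y /\ t = 1) ->
  0 <= a -> 0 <= b -> a <= b + nn -> b <= a + nn -> `|x - y| <= nn -> nn <= d ->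
  (x < c <= y -> 0 < a -> 0 < b -> a + b <= d) -> (y < c <= x -> 0 < b -> 0 < a -> b + a <= d) ->
  `|x + 2^-1 * (s * a) - (y + 2^-1 * (t * b))| <= 2 * d.
Proof.
move=> S T a0 b0 ab ba; rewrite !ler_norml => /andP[x1 x2] nd H1 H2.
have ab2 : x < c <= y -> a + b <= d + nn.
  move=> xy; have [a'|a'] := leP a 0; first by lra.
  have [b'|b'] := leP b 0; first by lra.
  by have := H1 xy a' b'; lra.
have ba2 : y < c <= x -> a + b <= d + nn.
  move=> xy; have [a'|a'] := leP a 0; first by lra.
  have [b'|b'] := leP b 0; first by lra.
  by have := H2 xy b' a'; lra.
case: S => -[xc ->]; case: T => -[yc ->].
- by apply/andP; split; lra.
- by have := ab2; rewrite xc yc => /(_ isT) ?; apply/andP; split; lra.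
- by have := ba2; rewrite xc yc => /(_ isT) ?; apply/andP; split; lra.
- by apply/andP; split; lra.
Qed.

(** On one side of the plane the Lipschitz constant is at most 3/2. Points on opposite sides
    are moved apart by half the sum of their bumps, and crossing_cost bounds this sum by the
    distance in the space. *)
Lemma opening_lip k u v : gen u -> gen v ->
  `|opening k u - opening k v| <= 2 * mdist (pt u) (pt v).
Proof.
move=> gu gv; have fu := gen_free h gu; have fv := gen_free h gv.
have uv := pt_norm_le n_ge1 pq sh fu fv.
have cost w z : gen w -> gen z -> w 0 0 < q k 0 0 <= z 0 0 -> 0 < bump k w -> 0 < bump k z ->
    bump k w + bump k z <= mdist (pt w) (pt z).
  move=> gw gz wz bw bz; apply: le_trans (level_le k.+1 _ _); rewrite !threadE; try exact: gen_free.
  rewrite -lee_fin level_mdist; try exact: gen_free.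
  exact: crossing_cost.
have d1 : 0 <= mdist (pt u) (pt v) by exact: mdist_ge0.
have d0 : 0 <= 2 * mdist (pt u) (pt v) by rewrite mulr_ge0.
apply: dist_le_coord => // i; have [->|i0] := eqVneq i 0; last first.
  rewrite !openingN//; apply: le_trans (coord_dist _ _ _) _; apply: le_trans uv _.
  by rewrite ler_peMl// (ler_nat R 1 2).
have := bump_lip k v u; rewrite (distrC v u) => ba.
rewrite !opening0; apply: opening_lip_real (sideP k u) (sideP k v) (bump_ge0 k u) (bump_ge0 k v)
  (bump_lip k u v) ba (coord_dist u v 0) uv _ _; first exact: cost.
by rewrite metric_sym; exact: cost.
Qed.

Lemma invS_small (e : R) : 0 < e -> exists k : nat, k.+1%:R^-1 < e.
Proof.
move=> e0; exists (Num.truncn e^-1); rewrite invf_plt ?posrE//.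
by rewrite truncnS_gt.
Qed.

(** A Lipschitz map on the dense set of generic points extends; the extension is specified by
    an estimate rather than by a limit. *)
Lemma lip_extend (F : vec -> vec) :
  (forall u v, gen u -> gen v -> `|F u - F v| <= 2 * mdist (pt u) (pt v)) ->
  exists G : X -> vec, forall p u, gen u -> `|G p - F u| <= 2 * mdist p (pt u).
Proof.
move=> FL.
suff H (p : X) : exists y, forall u, gen u -> `|y - F u| <= 2 * mdist p (pt u).
  by have [G HG] := choice H; exists G.
have /choice[w wP] : forall k : nat, exists u, gen u /\ mdist p (pt u) <= k.+1%:R^-1.
  by move=> k; have [u gu pu] := gen_dense p (ltac:(by rewrite invr_gt0) : (0 : R) < k.+1%:R^-1); exists u.
have gw k := (wP k).1.
have Fw i u : gen u -> `|F (w i) - F u| <= 2 * (mdist p (pt u) + i.+1%:R^-1).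
  move=> gu; apply: le_trans (FL _ _ (gw i) gu) _; rewrite ler_wpM2l// addrC.
  apply: le_trans (metric_triangle _ p _) _; rewrite lerD2r metric_sym; exact: (wP i).2.
have cv : cvgn (fun k => F (w k)).
  apply: cauchy_cvg; apply/cauchy_exP => e e0.
  have e8 : 0 < e / 8 by rewrite divr_gt0.
  have [k ke] := invS_small e8; exists (F (w k)); exists k => // j /= kj.
  rewrite -ball_normE /=; apply: le_lt_trans (Fw k _ (gw j)) _.
  have jk : j.+1%:R^-1 <= k.+1%:R^-1 :> R by rewrite lef_pV2 ?posrE// ler_nat.
  have := (wP j).2 => pj.
  have : mdist p (pt (w j)) + k.+1%:R^-1 < e / 4.
    apply: (@le_lt_trans _ _ (k.+1%:R^-1 + k.+1%:R^-1)).
      by rewrite lerD2r; apply: le_trans pj jk.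
    by rewrite (_ : e / 4 = e / 8 + e / 8) ?ltrD//; field.
  rewrite -(ltr_pM2l (_ : 0 < 2))// => /lt_trans; apply.
  rewrite mulrCA gtr_pMr//; lra.
exists (limn (fun k => F (w k))) => u gu.
apply/ler_addgt0Pr => e e0.
have e4 : 0 < e / 4 by rewrite divr_gt0.
have [k0 _ H] : \forall k \near \oo, ball (limn (fun k => F (w k))) (e / 4) (F (w k)).
  by apply: cv; exact: nbhsx_ballx.
have [k1 ke] := invS_small e4; pose k := maxn k0 k1.
have := H k; rewrite /= leq_maxl -ball_normE /= => /(_ isT) hk.
have kk : k.+1%:R^-1 <= e / 4.
  by apply: le_trans (ltW ke); rewrite lef_pV2 ?posrE// ler_nat ltnS leq_maxr.
apply: le_trans (ler_distD (F (w k)) _ _) _.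
apply: le_trans (lerD (ltW hk) (Fw k u gu)) _.
rewrite mulrDr addrCA lerD2l.
apply: (@le_trans _ _ (e / 4 + 2 * (e / 4))); first by rewrite lerD2l ler_wpM2l.
have -> : e / 4 + 2 * (e / 4) = e * (3 / 4) by field.
by rewrite ler_piMr ?ltW// ltr_pdivrMr// mul1r ltr_nat.
Qed.

Lemma quarter_bound (a b c e : R) : a <= c + e / 4 -> b <= e / 4 -> 2 * a + 2 * b <= 2 * c + e.
Proof. by move=> ? ?; lra. Qed.

(** Through generic approximations, with an arbitrarily small error. *)
Lemma extend_lip (F : vec -> vec) (G : X -> vec) :
  (forall p u, gen u -> `|G p - F u| <= 2 * mdist p (pt u)) ->
  forall p r, `|G p - G r| <= 2 * mdist p r.
Proof.
move=> H p r; apply/ler_addgt0Pr => e e0; have e4 : 0 < e / 4 by rewrite divr_gt0.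
have [u gu pu] := gen_dense p e4.
apply: le_trans (ler_distD (F u) _ _) _; rewrite addrC.
have h1 := H p u gu; have h2 := H r u gu.
have h3 : mdist r (pt u) <= mdist p r + e / 4.
  by apply: le_trans (metric_triangle r p _) _; rewrite metric_sym lerD2l.
rewrite [X in X + _]distrC; apply: le_trans (lerD h2 h1) _.
exact: quarter_bound h3 pu.
Qed.

(** A point c deep in the opened hole has distance at least dl from the image of the generic
    points: over the ball of radius dl around c the half width of the hole exceeds the
    distance from c to the central plane by dl. *)
Lemma opening_margin k (c u : vec) (r dl : R) : 0 < dl ->
  (forall i, i != 0 -> `|c 0 i - q k 0 i| <= r) ->
  0 <= r -> `|c 0 0 - q k 0 0| + dl <= 2^-1 * (h k - r - dl) ->
  dl <= `|opening k u - c|.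
Proof.
move=> dl0 cr r0 cm; rewrite leNgt; apply/negP => H.
have Hi i : `|opening k u 0 i - c 0 i| < dl by apply: le_lt_trans (coord_dist _ _ _) H.
have ui i : i != 0 -> `|u 0 i - q k 0 i| <= r + dl.
  move=> i0; have := Hi i; rewrite openingN// => h1; have := cr i i0.
  have := ler_distD (c 0 i) (u 0 i) (q k 0 i); lra.
have h2 : h k - Num.max `|u 0 0 - q k 0 0| (r + dl) <= bump k u.
  rewrite /bump le_max; apply/orP; right; rewrite lerB//.
  apply: dist_le_coord => [|i]; first by rewrite le_max normr_ge0.
  have [->|i0] := eqVneq i 0; first by rewrite le_max lexx.
  by rewrite le_max ui ?orbT.
have := bump_ge0 k u; have := Hi 0; rewrite opening0; move: h2.
set a := bump k u; move=> h2 hh a0.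
have s1 : `|u 0 0 - q k 0 0| + 2^-1 * a = `|u 0 0 + 2^-1 * (side k u * a) - q k 0 0|.
  case: (sideP k u) => -[l ->].
    by rewrite !ltr0_norm; lra.
  by rewrite !ger0_norm; lra.
have := ler_distD (c 0 0) (u 0 0 + 2^-1 * (side k u * a)) (q k 0 0); rewrite -s1.
have := normr_ge0 (u 0 0 - q k 0 0).
by move: h2; case: (leP `|u 0 0 - q k 0 0| (r + dl)) => ? ?; lra.
Qed.

End Opening.

(** * Charts of the slit space in an opened slit *)

Section Chart.
Context {R : realType} {n : nat}.
Local Notation N := (n.+1%:R : R).
Local Notation vec := 'rV[R]_n.+1.
Local Notation second := (@second n).
Variables (q : nat -> vec) (h : nat -> R).
Hypotheses (n_ge1 : (1 <= n)%N) (pq : placement q) (sh : sizes q h).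
Local Notation S := (system n_ge1 pq sh).
Local Notation gen := (gen q).
Local Notation X := (slit_space (@slit_space_cvg _ _ _ _ n_ge1 pq sh)).
Local Notation pt := (pt n_ge1 pq sh).
Local Notation opening := (opening q h).
Local Notation bump := (bump q h).
Local Notation side := (side q).

(** The point w is within s of the slit i in the sup norm. *)
Definition near_plate i (s : R) (w : vec) : Prop :=
  `|w 0 0 - q i 0 0| <= s /\ forall k, k != 0 -> `|w 0 k - q i 0 k| <= h i + s.

(** Within s of w only slit k is visible among the first m ones. For k < m the separation of
    the planes is required as well, since the path around the edge of slit k must not cross
    another plane. *)
Definition isolated k m (s : R) (w : vec) : Prop :=
  forall i, (i < m)%N -> i != k -> ~ near_plate i s w /\
    ((k < m)%N -> s < `|q i 0 0 - q k 0 0|).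

Definition replace_coord (v : vec) i (a : R) : vec := \row_j if j == i then a else v 0 j.

Lemma replace_coordE v i a : replace_coord v i a 0 i = a.
Proof. by rewrite mxE eqxx. Qed.

Lemma replace_coordN v i a j : j != i -> replace_coord v i a 0 j = v 0 j.
Proof. by rewrite mxE => /negbTE ->. Qed.

Lemma replace_coord_dist v i a : `|replace_coord v i a - v| <= `|a - v 0 i|.
Proof.
apply: dist_le_coord => // j; have [->|ji] := eqVneq j i; first by rewrite replace_coordE.
by rewrite replace_coordN// subrr normr0.
Qed.

Lemma between_close (x y a b : R) : between x y a -> between x y b -> `|a - b| <= `|x - y|.
Proof.
rewrite /between => /orP[] /andP[? ?] /orP[] /andP[? ?]; rewrite ler_norml.
- by rewrite (ler0_norm (_ : x - y <= 0)); [apply/andP; split|]; lra.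
- by exfalso; lra.
- by exfalso; lra.
- by rewrite (ger0_norm (_ : 0 <= x - y)); [apply/andP; split|]; lra.
Qed.

(** Points on opposite sides of slit k with close images under the opening lie near the edge
    of this slit or outside it. *)
Lemma edge_coord k u v (D : R) : `|opening k u - opening k v| <= D ->
  between (u 0 0) (v 0 0) (q k 0 0) ->
  exists2 i, i != 0 & h k - 3 * D <= `|v 0 i - q k 0 i|.
Proof.
move=> oD b; have := le_trans (coord_dist _ _ 0) oD; rewrite !opening0.
have bu0 : 0 <= bump k u by exact: bump_ge0.
have bv0 : 0 <= bump k v by exact: bump_ge0.
have sP (z : vec) : (z 0 0 < q k 0 0 /\ side k z = -1) \/ (q k 0 0 <= z 0 0 /\ side k z = 1) by exact: sideP.
move=> oD0; have [bvD avD] : bump k v <= 2 * D /\ `|v 0 0 - q k 0 0| <= D.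
  move: oD0; rewrite ler_norml => /andP[].
  case/orP: b => /andP[? ?]; case: (sP u) => -[? ->]; case: (sP v) => -[? ->] ? ?;
    try lra.
    by rewrite gtr0_norm ?subr_gt0//; split; lra.
  by rewrite ltr0_norm ?subr_lt0//; split; lra.
have hv : h k - `|v - q k| <= bump k v by rewrite /bump le_max lexx orbT.
have [i e] := norm_attained (v - q k); rewrite !mxE in e.
have [i0|i0] := eqVneq i 0; last by exists i => //; rewrite -e; lra.
exists second; first exact: second_neq0.
have := normr_ge0 (v 0 second - q k 0 second); rewrite i0 in e; lra.
Qed.

(** If slit k does not separate the two points, rect_path applies directly. Otherwise
    edge_coord finds a coordinate in which v is close to the edge, and moving v past the edge
    inside its plane gives a point v' to which rect_path applies. *)
Lemma chart_gen k m (s : R) (w u v : vec) : gen w -> gen u -> gen v ->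
  isolated k m s w -> 16 * h m <= s -> `|u - w| <= s / 4 -> `|v - w| <= s / 4 ->
  mdist (pt u) (pt v) <= 20 * N * (`|opening k u - opening k v| + h m).
Proof.
move=> gw gu gv iso hs uw vw; set D := `|opening k u - opening k v|.
have D0 : 0 <= D by exact: normr_ge0.
have h0 := h_gt0 sh m; have N2 := N_ge2 n_ge1 (R := R).
have uvD : `|u - v| <= 2 * D by exact: opening_inv.
have uvs : `|u - v| <= s / 2.
  by have := ler_distD w u v; rewrite (distrC w v); lra.
have ND : 2 * D <= N * D by rewrite ler_wpM2r.
have Nh : 2 * h m <= N * h m by rewrite ler_wpM2r// ltW.
have NuvD : N * `|u - v| <= N * (2 * D) by rewrite ler_wpM2l.
have other i : (i < m)%N -> i != k -> between (u 0 0) (v 0 0) (q i 0 0) ->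
    exists2 j, j != 0 & h i + 4 * h m < `|v 0 j - q i 0 j|.
  move=> im ik b; apply: contrapT => C; apply: (iso i im ik).1; split.
    have := (between_dist b).1; have := coord_dist u v 0; have := coord_dist u w 0.
    by have := ler_distD (u 0 0) (w 0 0) (q i 0 0); rewrite (distrC (w 0 0) (u 0 0)); lra.
  move=> j j0; have := coord_dist v w j.
  have := ler_distD (v 0 j) (w 0 j) (q i 0 j); rewrite (distrC (w 0 j) (v 0 j)).
  have : `|v 0 j - q i 0 j| <= h i + 4 * h m.
    by rewrite leNgt; apply/negP => ?; apply: C; exists j.
  by lra.
have direct : (forall i, (i < m)%N -> between (u 0 0) (v 0 0) (q i 0 0) ->
    exists2 j, j != 0 & h i + 4 * h m < `|v 0 j - q i 0 j|) ->
    mdist (pt u) (pt v) <= 20 * N * (D + h m).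
  move=> H; apply: le_trans (pt_dist_le n_ge1 pq sh gu gv H) _.
  by rewrite mulrDr; lra.
have [[km b]|nb] := pselect ((k < m)%N /\ between (u 0 0) (v 0 0) (q k 0 0)); last first.
  apply: direct => i im b; apply: other => //; apply: contra_not_neq nb => <-.
  by split.
have [[j j0 hj]|nj] := pselect (exists2 j, j != 0 & h k + 4 * h m < `|v 0 j - q k 0 j|).
  by apply: direct => i im b'; have [->|ik] := eqVneq i k; [exists j|exact: other].
have [i i0 hi] := edge_coord (lexx D) b.
have hi4 : `|v 0 i - q k 0 i| <= h k + 4 * h m.
  by rewrite leNgt; apply/negP => ?; apply: nj; exists i.
have hk8 : 8 * h m <= h k by exact: (h_lt sh).
pose sg : R := if q k 0 i <= v 0 i then 1 else -1.
(* The value just beyond the edge of slit k. *)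
pose a := q k 0 i + sg * (h k + 5 * h m).
have av : `|a - v 0 i| <= 3 * D + 5 * h m.
  move: hi hi4; rewrite /a /sg; case: ifPn => [l|]; last rewrite -ltNge => l.
    by rewrite ger0_norm ?subr_ge0// ler_norml => ? ?; apply/andP; split; lra.
  by rewrite ltr0_norm ?subr_lt0// ler_norml => ? ?; apply/andP; split; lra.
have aq : h k + 4 * h m < `|a - q k 0 i|.
  rewrite /a addrAC subrr add0r normrM (_ : `|sg| = 1) ?mul1r; last first.
    by rewrite /sg; case: ifP; rewrite ?normrN normr1.
  by rewrite gtr0_norm; lra.
have ab : 0 < a < 1.
  have /andP[? ?] := h_box sh k i.
  have : 2 * h k <= N * h k by rewrite ler_wpM2r// ltW ?(h_gt0 sh).
  by rewrite /a /sg; case: ifP => _ ?; apply/andP; split; lra.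
pose v' := replace_coord v i a.
have v'0 : v' 0 0 = v 0 0 by rewrite replace_coordN// eq_sym.
have v'b : in_box v' by move=> j; rewrite mxE; case: eqP => // _; exact: gv.1.
have gv' : gen v' by split => // j; rewrite v'0; exact: gv.2.
have uv' : `|u - v'| <= 5 * D + 5 * h m.
  have := ler_distD v u v'; have := replace_coord_dist v i a; rewrite -/v' (distrC v' v).
  by move: av uvD; lra.
have vv' : mdist (pt v) (pt v') <= 3 * D + 5 * h m.
  rewrite pt_plane// (edist_one_coord (k := i)) ?replace_coordE 1?distrC//.
  by move=> j ji; rewrite replace_coordN.
have d1 : mdist (pt u) (pt v') <= N * (5 * D + 5 * h m) + 8 * h m.
  apply: le_trans (pt_dist_le (m := m) n_ge1 pq sh gu gv' _) _.
    move=> j jm; rewrite v'0 => b'; have [->|jk] := eqVneq j k.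
      by exists i => //; rewrite replace_coordE.
    exfalso; clear vv'; have := (iso j jm jk).2 km; apply/negP; rewrite -leNgt.
    apply: le_trans (_ : `|u 0 0 - v 0 0| <= s); last first.
      by have := coord_dist u v 0; have := normr_ge0 (u - w); lra.
    exact: between_close b' b.
  by rewrite lerD2r ler_wpM2l.
apply: mdist_tri2 d1 _ _; first by rewrite metric_sym; exact: vv'.
by clear vv'; rewrite !mulrDr; lra.
Qed.

Lemma half_le (a e : R) : a <= e / 2 -> 2 * a <= e.
Proof. by move=> ?; lra. Qed.

(** Around a point where only slit k is visible the opened coordinates control the distance
    of the space, up to the size of the next slits; this passes from generic points to the
    space by density. *)
Lemma chart_dist k m (s : R) (w : vec) (G : X -> vec) (p r : X) : gen w ->
  (forall p u, gen u -> `|G p - opening k u| <= 2 * mdist p (pt u)) ->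
  isolated k m s w -> 16 * h m <= s ->
  `|G p - opening k w| < s / 8 -> `|G r - opening k w| < s / 8 ->
  mdist p r <= 20 * N * (`|G p - G r| + h m).
Proof.
move=> gw HG iso hs pw rw.
have slack (e : R) : 0 < e -> e <= s / 8 - `|G p - opening k w| -> e <= s / 8 - `|G r - opening k w| ->
    mdist p r <= 20 * N * (`|G p - G r| + h m) + 41 * N * e.
  move=> e0 ep er; have e2 : 0 < e / 2 by rewrite divr_gt0.
  have [u gu pu] := gen_dense p e2; have [v gv rv] := gen_dense r e2.
  have Gu : `|G p - opening k u| <= e.
    exact: le_trans (HG p u gu) (half_le pu).
  have Gv : `|G r - opening k v| <= e.
    exact: le_trans (HG r v gv) (half_le rv).
  have ouw : `|u - w| <= s / 4.
    apply: le_trans (opening_inv q h k u w) _.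
    by have := ler_distD (G p) (opening k u) (opening k w); rewrite (distrC _ (G p)); clear pu rv; lra.
  have ovw : `|v - w| <= s / 4.
    apply: le_trans (opening_inv q h k v w) _.
    by have := ler_distD (G r) (opening k v) (opening k w); rewrite (distrC _ (G r)); clear pu rv; lra.
  have uv := chart_gen gw gu gv iso hs ouw ovw.
  have ouv : `|opening k u - opening k v| <= `|G p - G r| + 2 * e.
    have := ler_distD (G p) (opening k u) (opening k v).
    have := ler_distD (G r) (G p) (opening k v).
    by rewrite (distrC _ (G p)); clear pu rv uv; lra.
  rewrite metric_sym in rv; apply: mdist_tri3 pu uv rv _.
  have : N * `|opening k u - opening k v| <= N * (`|G p - G r| + 2 * e) by rewrite ler_wpM2l.
  have : e <= N * e by rewrite ler_peMl ?N1// ltW.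
  by rewrite !mulrDr; lra.
apply/ler_addgt0Pr => e e0.
pose d := Num.min (e / (41 * N)) (Num.min (s / 8 - `|G p - opening k w|) (s / 8 - `|G r - opening k w|)).
have N0 : 0 < 41 * N by rewrite mulr_gt0// ltr0n.
have d0 : 0 < d by rewrite !lt_min divr_gt0//= !subr_gt0 pw rw.
apply: le_trans (slack d d0 _ _) _; [by rewrite !ge_min lexx !orbT|by rewrite !ge_min lexx !orbT|].
by rewrite lerD2l mulrC -ler_pdivlMr// ge_min lexx.
Qed.

End Chart.

(** * Moduli of weakly quasisymmetric maps, uniform in the sizes *)

(** The weak form of quasisymmetry, with comparison constant L and distortion H. Unlike the
    full form it constrains f by two numbers. *)
Definition wqs {R : realType} {T : metricType R} (f : T -> T) (L H : R) : Prop :=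
  forall a b c, mdist a b <= L * mdist b c -> mdist (f a) (f b) <= H * mdist (f b) (f c).

Section Modulus.
Context {R : realType} {n : nat}.
Local Notation N := (n.+1%:R : R).
Local Notation vec := 'rV[R]_n.+1.
Local Notation second := (@second n).
Variables (q : nat -> vec).
Hypotheses (n_ge1 : (1 <= n)%N) (pq : placement q).
Local Notation gen := (gen q).
Local Notation Sp sh := (slit_space (@slit_space_cvg _ _ _ _ n_ge1 pq sh)).
Local Notation pt sh := (pt n_ge1 pq sh).

Lemma exp8_small (e : R) : 0 < e -> exists m, (8^-1 : R) ^+ m.+1 < e.
Proof.
move=> e0; have c : (8^-1 : R) ^+ k @[k --> \oo] --> (0 : R).
  by apply: cvg_expr; rewrite ger0_norm ?invr_ge0// invf_lt1// ltr1n.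
have /cvgr0Pnorm_lt/(_ e e0)[k _ /(_ k.+1 (leqnSn k)) ke] := c.
by exists k; apply: le_lt_trans ke; rewrite ler_norm.
Qed.

(** Total boundedness with a bound that holds for all sizes: two points have close generic
    approximations if these lie in the same cell of a grid and on the same sides of the first
    m planes. *)
Lemma packing (s : R) : 0 < s -> exists P : nat,
  forall h (sh : sizes q h) (p : nat -> Sp sh), exists i j, (i < j <= P)%N /\ mdist (p i) (p j) <= s.
Proof.
move=> s0; have s8 : 0 < s / 8 by rewrite divr_gt0.
have [m hm] := exp8_small (ltac:(by rewrite divr_gt0) : 0 < s / 64).
have [K Ks] := invS_small (ltac:(by rewrite divr_gt0// ltr0n) : 0 < s / (4 * N)).
pose T : finType := ({ffun 'I_n.+1 -> 'I_K.+1} * {ffun 'I_m -> bool})%type.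
exists #|T| => h sh p.
have /choice[u uP] : forall i, exists u, gen u /\ mdist (p i) (pt sh u) <= s / 8.
  by move=> i; have [u gu pu] := gen_dense (p i) s8; exists u.
pose sig (i : 'I_#|T|.+1) : T := ([ffun k => inord (Num.truncn (K.+1%:R * u i 0 k))],
  [ffun j : 'I_m => u i 0 0 < q j 0 0]).
have /injectivePn[i [j ij e]] : ~~ injectiveb sig.
  apply/negP => /injectiveP /leq_card; rewrite card_ord ltnn //.
wlog l : i j ij e / (i < j)%N.
  move=> W; have [/W|/W|/val_inj l] := ltngtP i j; [exact|by rewrite eq_sym; apply|].
  by rewrite l eqxx in ij.
exists i, j; split; first by rewrite l /= -ltnS.
have ar : s / 8 + (s / 4 + 8 * (s / 64)) + s / 8 <= s by lra.
have uv : `|u i - u j| <= K.+1%:R^-1.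
  apply: dist_le_coord => [|k]; first by rewrite invr_ge0.
  have tr l' : (K.+1%:R * u l' 0 k < K.+1%:R) /\ 0 <= K.+1%:R * u l' 0 k.
    have /andP[? ?] := (uP l').1.1 k; rewrite gtr_pMr ?ltr0n//; split => //.
    by rewrite mulr_ge0// ltW.
  have := congr1 (fun x : T => nat_of_ord (x.1 k)) e; rewrite !ffunE !inordK; last 2 first.
  - by rewrite truncn_lt_nat; [exact: (tr j).1|exact: (tr j).2].
  - by rewrite truncn_lt_nat; [exact: (tr i).1|exact: (tr i).2].
  have /andP[a1 a2] := truncn_itv (tr i).2; have /andP[b1 b2] := truncn_itv (tr j).2.
  move=> et; rewrite et in a1 a2; rewrite -[(Num.truncn _).+1%:R]natr1 in a2; rewrite -[(Num.truncn _).+1%:R]natr1 in b2.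
  rewrite -(ler_pM2l (_ : 0 < K.+1%:R)) ?ltr0n// mulfV ?pnatr_eq0// -[K.+1%:R in leLHS]ger0_norm// -normrM mulrBr.
  by rewrite ler_norml; apply/andP; split; lra.
have hm' : h m <= s / 64 by apply: ltW; apply: le_lt_trans (h_exp sh m) hm.
have duv : mdist (pt sh (u i)) (pt sh (u j)) <= s / 4 + 8 * (s / 64).
  apply: le_trans (pt_dist_le (m := m) n_ge1 pq sh (uP i).1 (uP j).1 _) _.
    move=> k km b; exfalso.
    have := congr1 (fun x : T => x.2 (Ordinal km)) e; rewrite !ffunE /=.
    by move: b; rewrite /between => /orP[] /andP[b1 b2]; rewrite ?b1 ?b2 ltNge ?(ltW b1) ?(ltW b2).
  rewrite lerD// ?ler_wpM2l//.
  apply: (@le_trans _ _ (N * (s / (4 * N)))); first by rewrite ler_wpM2l// (le_trans uv)// ltW.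
  have : N != 0 by rewrite pnatr_eq0.
  by move: N => x x0; rewrite le_eqVlt; apply/orP; left; apply/eqP; field.
apply: mdist_tri3 (uP i).2 duv _ ar; rewrite metric_sym; exact: (uP j).2.
Qed.

(** A shift by t towards the middle stays in the unit interval. *)
Definition toward_half (a t : R) : R := if a <= 2^-1 then a + t else a - t.

Lemma toward_half_itv (a t : R) : 0 < a < 1 -> 0 <= t < 2^-1 -> 0 < toward_half a t < 1.
Proof.
by move=> /andP[? ?] /andP[? ?]; rewrite /toward_half; case: (leP a) => ?; apply/andP; split; lra.
Qed.

Lemma toward_half_dist (a t s : R) : `|toward_half a t - toward_half a s| = `|t - s|.
Proof.
rewrite /toward_half; case: ifP => _; first by congr (`|_|); ring.
by rewrite -normrN; congr (`|_|); ring.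
Qed.

Lemma toward_half0 (a : R) : toward_half a 0 = a.
Proof. by rewrite /toward_half addr0 subr0 if_same. Qed.

Lemma replace_box (v : vec) k (a : R) : in_box v -> 0 < a < 1 -> in_box (replace_coord v k a).
Proof. by move=> vb a01 j; rewrite mxE; case: eqP. Qed.

Lemma edist_replace (v : vec) k (a b : R) : edist (replace_coord v k a) (replace_coord v k b) = `|a - b|.
Proof.
rewrite (edist_one_coord (k := k)) ?replace_coordE// => i ik.
by rewrite !replace_coordN.
Qed.

Lemma replace_self (v : vec) k : replace_coord v k (v 0 k) = v.
Proof. by apply/rowP => j; rewrite mxE; case: eqP => // ->. Qed.

(** Points at prescribed distances from u, inside the plane of u; they all belong to the
    space whatever the sizes are. *)
Definition shifted (u : vec) (t : R) := replace_coord u second (toward_half (u 0 second) t).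

Lemma shifted_dist h (sh : sizes q h) u (t s : R) : gen u -> 0 <= t < 2^-1 -> 0 <= s < 2^-1 ->
  mdist (pt sh (shifted u t)) (pt sh (shifted u s)) = `|t - s|.
Proof.
move=> gu t0 s0; have sn := second_neq0 n_ge1.
have box r : 0 <= r < 2^-1 -> in_box (shifted u r).
  by move=> r0; apply: replace_box; [exact: gu.1|apply: toward_half_itv => //; exact: gu.1].
have z r : shifted u r 0 0 = u 0 0 by rewrite replace_coordN// eq_sym.
have g r : 0 <= r < 2^-1 -> gen (shifted u r).
  by move=> r0; split; [exact: box|move=> j; rewrite z; exact: gu.2].
rewrite pt_plane ?z//; [|exact: g|exact: box].
by rewrite edist_replace toward_half_dist.
Qed.

Lemma shifted0 u : shifted u 0 = u.
Proof. by rewrite /shifted toward_half0 replace_self. Qed.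

Lemma quarter_pow i j : (i < j)%N -> (4^-1 : R) ^+ i.+1 <= 2 * `|4^-1 ^+ i.+1 - 4^-1 ^+ j.+1|.
Proof.
move=> ij; have p : (0 : R) < 4^-1 ^+ i.+1 by rewrite exprn_gt0.
have le : (4^-1 : R) ^+ j.+1 <= 4^-1 * 4^-1 ^+ i.+1.
  rewrite -exprS; apply: ler_wiXn2l => //; first by rewrite invf_le1// ler1n.
rewrite ger0_norm; lra.
Qed.

Lemma quarter_lt i : 0 <= (4^-1 : R) ^+ i.+1 < 2^-1.
Proof.
rewrite exprn_ge0//= exprS; apply: (@le_lt_trans _ _ 4^-1); last by lra.
by rewrite ler_piMr// exprn_ile1// invf_le1// ler1n.
Qed.

(** The points shifted by the powers of 1/4 have, by packing, two images f (x i) and f (x j)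
    closer than s / H^2. Weak quasisymmetry transfers this first to f u and f (x i), then to
    f u and f b. The number of points needed depends on s and H only. *)
Lemma modulus_upper (H s : R) : 1 <= H -> 0 < s -> exists2 t : R, 0 < t &
  forall h (sh : sizes q h) (f : Sp sh -> Sp sh), wqs f (4 * N) H ->
  forall u b, gen u -> mdist (pt sh u) b <= t -> mdist (f (pt sh u)) (f b) <= s.
Proof.
move=> H1 s0; have H0 : 0 < H by exact: lt_le_trans H1.
have [P HP] := packing (ltac:(by rewrite divr_gt0// mulr_gt0) : 0 < s / (H * H)).
exists (4^-1 ^+ P.+1); first by rewrite exprn_gt0.
have N1' := N1 (R := R) (n := n).
have ar1 : 2 <= 4 * N by lra. have ar2 : 1 <= 4 * N by lra.
move=> h sh f fH u b gu ub.
pose x i := shifted u (4^-1 ^+ i.+1).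
have [i [j [/andP[ij jP] dij]]] := HP h sh (fun i => f (pt sh (x i))).
have dux k : mdist (pt sh u) (pt sh (x k)) = 4^-1 ^+ k.+1.
  rewrite -{1}(shifted0 u) shifted_dist ?quarter_lt//; last by rewrite lexx invr_gt0/=.
  by rewrite sub0r normrN ger0_norm// exprn_ge0.
have e1 : mdist (f (pt sh u)) (f (pt sh (x i))) <= H * mdist (f (pt sh (x i))) (f (pt sh (x j))).
  apply: fH; rewrite dux shifted_dist ?quarter_lt//; apply: le_trans (quarter_pow ij) _.
  exact: ler_wpM2r ar1.
have e2 : mdist (f b) (f (pt sh u)) <= H * mdist (f (pt sh u)) (f (pt sh (x i))).
  apply: fH; rewrite dux metric_sym; apply: le_trans ub _.
  apply: (@le_trans _ _ (4^-1 ^+ i.+1)); last first.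
    by rewrite ler_peMl ?exprn_ge0.
  by apply: ler_wiXn2l => //; [rewrite invf_le1// ler1n|exact: leq_trans (ltnW ij) jP].
rewrite metric_sym; apply: le_trans e2 _.
apply: le_trans (ler_wpM2l (ltW H0) e1) _.
rewrite mulrA; apply: le_trans (ler_wpM2l (ltW (mulr_gt0 H0 H0)) dij) _.
by rewrite mulrC divfK// gt_eqF// mulr_gt0.
Qed.


Section Reach.
Variables (h : nat -> R) (sh : sizes q h) (f : Sp sh -> Sp sh) (H tau : R).
Hypotheses (H1 : 1 <= H) (tau0 : 0 < tau) (tau4 : tau <= 4^-1) (fH : wqs f (4 * N) H).

Definition reach (a : Sp sh) (B : R) := forall w, mdist a w <= tau -> mdist (f a) (f w) <= B.

(** The bound on the image of a ball moves to a neighbouring centre, with a loss of a factor,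
    provided that there is a point at distance exactly tau to compare with. *)
Lemma reach_step a a' e B : reach a B -> mdist a a' <= tau / 2 -> mdist a e = tau ->
  reach a' (2 * H * B).
Proof.
have N1' := N1 (R := R) (n := n); have t0 := tau0; have H1' := H1.
have th : tau - tau / 2 = tau / 2 by field.
have ar (x : R) : tau / 2 <= x -> tau <= 4 * N * x.
  move=> hx; have x0 : 0 <= x by lra.
  by have := ler_wpM2r x0 N1'; lra.
have tt : tau / 2 <= tau by lra.
have ar2 : H * (2 * B) <= 2 * H * B by lra.
have H0 : 0 <= H by lra.
move=> ra aa' ae w a'w.
have tri : mdist a e <= tau / 2 + mdist a' e.
  by apply: le_trans (metric_triangle a a' e) _; exact: lerD aa' (lexx _).
rewrite ae in tri; have a'e : tau / 2 <= mdist a' e by rewrite -th lerBlDl.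
have h1 : mdist (f w) (f a') <= H * mdist (f a') (f e).
  by apply: fH; rewrite metric_sym; apply: le_trans a'w (ar _ a'e).
have h2 : mdist (f a') (f e) <= 2 * B.
  apply: (mdist_tri2 (b := f a) (x := B) (y := B)).
  - by rewrite metric_sym; apply: ra; exact: le_trans aa' tt.
  - by apply: ra; rewrite ae.
  - by rewrite mulr_natl mulr2n.
rewrite metric_sym; apply: le_trans h1 _; apply: le_trans ar2.
exact: ler_wpM2l.
Qed.

Lemma reach_path (g : nat -> Sp sh) m B : 0 <= B ->
  (forall k, (k < m)%N -> mdist (g k) (g k.+1) <= tau / 2) ->
  (forall k, (k < m)%N -> exists e, mdist (g k) e = tau) ->
  reach (g 0%N) B -> forall k, (k <= m)%N ->
  reach (g k) ((2 * H) ^+ k * B) /\ mdist (f (g 0%N)) (f (g k)) <= k%:R * ((2 * H) ^+ k * B).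
Proof.
have t0 := tau0; have H1' := H1; have tt : tau / 2 <= tau by lra.
have H2 : 1 <= 2 * H by lra.
have ar (k : nat) (C : R) : 0 <= C -> k%:R * C + C <= k.+1%:R * (2 * H * C).
  move=> C0; have := ler_wpM2r C0 H2; rewrite mul1r => hC.
  have := ler_wpM2l (ler0n R k.+1) hC; rewrite -natr1; lra.
move=> B0 gg ge r0; elim=> [|k ih] km; first by rewrite expr0 mul1r mul0r mdistxx.
have [rk dk] := ih (ltnW km); have [e ke] := ge k km; have kk := gg k km.
rewrite exprS -(mulrA (2 * H)); split; first exact: reach_step rk kk ke.
have B' : 0 <= (2 * H) ^+ k * B by rewrite mulr_ge0// exprn_ge0// (le_trans ler01).
exact: mdist_tri2 dk (rk _ (le_trans kk tt)) (ar k _ B').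
Qed.

Lemma reach_segment (L : vec -> Prop) (u z : vec) m B : 0 <= B -> N / m.+1%:R <= tau / 2 ->
  (forall a b, L a -> L b -> mdist (pt sh a) (pt sh b) = edist a b) ->
  (forall a, L a -> in_box a /\ exists e, mdist (pt sh a) e = tau) ->
  (forall t : R, 0 <= t <= 1 -> L (u + t *: (z - u))) ->
  reach (pt sh u) B -> reach (pt sh z) ((2 * H) ^+ m.+1 * B) /\
    mdist (f (pt sh u)) (f (pt sh z)) <= m.+1%:R * ((2 * H) ^+ m.+1 * B).
Proof.
move=> B0 mN Ld Le Ls r0.
pose a k : vec := u + (k%:R / m.+1%:R) *: (z - u).
have a0 : a 0%N = u by rewrite /a mul0r scale0r addr0.
have am : a m.+1 = z by rewrite /a divff ?pnatr_eq0// scale1r addrC subrK.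
have La k : (k <= m.+1)%N -> L (a k).
  by move=> km; apply: Ls; rewrite divr_ge0//= ler_pdivrMr ?ltr0n// mul1r ler_nat.
have ub : in_box u by rewrite -a0; exact: (Le _ (La 0%N isT)).1.
have zb : in_box z by rewrite -am; exact: (Le _ (La _ (leqnn _))).1.
have zu : edist (z - u) 0 <= N.
  apply: le_trans (edist_le_norm _ _) _; rewrite ler_piMr// subr0.
  apply: norm_le_coord => // k; rewrite !mxE.
  have /andP[? ?] := ub k; have /andP[? ?] := zb k.
  by rewrite ler_norml; apply/andP; split; lra.
have gg k : (k < m.+1)%N -> mdist (pt sh (a k)) (pt sh (a k.+1)) <= tau / 2.
  move=> km; rewrite Ld; [|exact: La (ltnW km)|exact: La].
  rewrite /a edist_segment -mulrBl -natr1 opprD addrA subrr sub0r mulN1r normrN.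
  rewrite ger0_norm ?invr_ge0//; apply: le_trans mN.
  by rewrite mulrC ler_wpM2r// invr_ge0.
have := @reach_path (fun k => pt sh (a k)) m.+1 B B0 gg _ _ m.+1 (leqnn _).
by rewrite a0 am; apply => // k km; exact: (Le _ (La _ (ltnW km))).2.
Qed.

Lemma scale_le (c x : R) : 1 <= c -> 0 <= x -> x <= c * x.
Proof. by move=> c1 x0; rewrite ler_peMl. Qed.

(** A second reference point; with middle it measures the size of the image of f. *)
Definition off_middle : vec := replace_coord (middle : vec) 0 4^-1.

(** On the hyperplane where the second coordinate is 1/2 one moves in the direction 0 or
    inside the hyperplane without meeting a slit. *)
Lemma half_shift (w : vec) : in_box w -> w 0 second = 2^-1 ->
  exists e, mdist (pt sh w) e = tau.
Proof.
move=> wb ws; have s0 := second_neq0 n_ge1; have t0 := tau0; have t4 := tau4.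
pose w' := replace_coord w 0 (toward_half (w 0 0) tau).
have t2 : 0 <= tau < 2^-1 by apply/andP; split; lra.
exists (pt sh w'); rewrite pt_half//; last 2 first.
- by apply: replace_box => //; exact: toward_half_itv.
- by rewrite replace_coordN.
by rewrite -{1}(replace_self w 0) edist_replace -{1}(toward_half0 (w 0 0)) toward_half_dist sub0r normrN gtr0_norm.
Qed.

(** If f x and f b were very close, then so would be, by weak quasisymmetry, the image of the
    ball around x, and step by step the images of the balls along a path to the hyperplane
    where the second coordinate is 1/2, and inside this hyperplane up to the two reference
    points. The number of steps does not depend on the sizes. *)
Lemma lower_bound m x b : N / m.+1%:R <= tau / 2 -> gen x -> tau <= mdist (pt sh x) b ->
  mdist (f (pt sh (middle : vec))) (f (pt sh off_middle)) <=
  m.+1%:R * (2 * H) ^+ (3 * m.+1) * H * mdist (f (pt sh x)) (f b).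
Proof.
have s0 := second_neq0 n_ge1; have t0 := tau0; have t4 := tau4.
have H0 : 0 <= H := le_trans ler01 H1.
have N1' := N1 (R := R) (n := n); have N4 : 1 <= 4 * N by lra.
move=> mN gx xb; have t2 : 0 <= tau < 2^-1.
  by clear xb; apply/andP; split; lra.
set d := mdist (f (pt sh x)) (f b); have d0 : 0 <= d by exact: mdist_ge0.
have B0 : 0 <= H * d by rewrite mulr_ge0.
have r0 : reach (pt sh x) (H * d).
  move=> w xw; rewrite metric_sym; apply: fH; rewrite metric_sym.
  exact: le_trans xw (le_trans xb (scale_le N4 (mdist_ge0 _ _))).
pose z : vec := replace_coord (middle : vec) 0 (x 0 0).
have mb : in_box (middle : vec) by move=> k; rewrite mxE invr_gt0 ltr0n/= invf_lt1// ltr1n.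
have zb : in_box z by apply: replace_box => //; exact: gx.1.
have z0 : z 0 0 = x 0 0 by rewrite replace_coordE.
have zs : z 0 second = 2^-1 by rewrite replace_coordN// mxE.
have ob : in_box off_middle by apply: replace_box => //; rewrite invr_gt0 ltr0n/= invf_lt1// ltr1n.
have os : off_middle 0 second = 2^-1 by rewrite replace_coordN// mxE.
have ms : (middle : vec) 0 second = 2^-1 by rewrite mxE.
have [r1 _] : reach (pt sh z) ((2 * H) ^+ m.+1 * (H * d)) /\
    mdist (f (pt sh x)) (f (pt sh z)) <= m.+1%:R * ((2 * H) ^+ m.+1 * (H * d)).
  apply: (@reach_segment (fun w => in_box w /\ w 0 0 = x 0 0)) => //.
  - move=> a c [ab a0] [cb c0]; rewrite pt_plane ?a0 ?c0//.
    by split => // j; rewrite a0; exact: gx.2.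
  - move=> a [ab a0]; split => //.
    have ga : gen a by split => // j; rewrite a0; exact: gx.2.
    exists (pt sh (shifted a tau)); rewrite -{1}(shifted0 a) shifted_dist//.
      by rewrite sub0r normrN gtr0_norm.
    by rewrite lexx invr_gt0/=.
  - move=> t t01; split; first by apply: box_segment => //; exact: gx.1.
    by rewrite !mxE eqxx subrr mulr0 addr0.
have B1 : 0 <= (2 * H) ^+ m.+1 * (H * d) by rewrite mulr_ge0// exprn_ge0// mulr_ge0.
have half (u v : vec) B : in_box u -> in_box v -> u 0 second = 2^-1 -> v 0 second = 2^-1 -> 0 <= B ->
    reach (pt sh u) B -> reach (pt sh v) ((2 * H) ^+ m.+1 * B) /\
    mdist (f (pt sh u)) (f (pt sh v)) <= m.+1%:R * ((2 * H) ^+ m.+1 * B).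
  move=> ub vb us vs B0' r.
  apply: (@reach_segment (fun w => in_box w /\ w 0 second = 2^-1)) => //.
  - by move=> a c [ab a0] [cb c0]; exact: pt_half.
  - by move=> a [ab a0]; split => //; exact: half_shift.
  - move=> t t01; split; first exact: box_segment.
    by rewrite !mxE us vs subrr mulr0 addr0.
have [r2 _] := half _ _ _ zb mb zs ms B1 r1.
have B2 : 0 <= (2 * H) ^+ m.+1 * ((2 * H) ^+ m.+1 * (H * d)).
  by rewrite mulr_ge0// exprn_ge0// mulr_ge0.
have [_] := half _ _ _ mb ob ms os B2 r2.
move=> hd; apply: le_trans hd _; rewrite !mulrA -2!(mulrA m.+1%:R) -!exprD.
by rewrite !mulSn mul0n addn0 addnA -!mulrA.
Qed.

End Reach.

Lemma modulus_lower (H t : R) : 1 <= H -> 0 < t -> exists2 B : R, 0 < B &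
  forall h (sh : sizes q h) (f : Sp sh -> Sp sh), wqs f (4 * N) H ->
  forall x b, gen x -> t <= mdist (pt sh x) b ->
  mdist (f (pt sh (middle : vec))) (f (pt sh off_middle)) <= B * mdist (f (pt sh x)) (f b).
Proof.
move=> H1 t0; pose tau := Num.min t 4^-1.
have tau0 : 0 < tau by rewrite lt_min t0 invr_gt0 ltr0n.
have tau4 : tau <= 4^-1 by rewrite ge_min lexx orbT.
have taut : tau <= t by rewrite ge_min lexx.
have [m hm] := invS_small (ltac:(by rewrite divr_gt0// mulr_gt0// ltr0n) : 0 < tau / (2 * N)).
have mN : N / m.+1%:R <= tau / 2.
  have := ler_wpM2l (ler0n R n.+1) (ltW hm).
  rewrite (_ : N * (tau / (2 * N)) = tau / 2)//.
  have : N != 0 by rewrite pnatr_eq0.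
  by move: N => y y0; field.
exists (m.+1%:R * (2 * H) ^+ (3 * m.+1) * H).
  by rewrite !mulr_gt0 ?ltr0n ?exprn_gt0 ?mulr_gt0// (lt_le_trans _ H1).
move=> h sh f fH x b gx xb; apply: (@lower_bound h sh f H tau) => //.
exact: le_trans xb.
Qed.

End Modulus.

(** * A map that omits a value cannot nearly cover it *)

Section Puncture.
Context {R : realType} {n : nat}.
Local Notation N := (n.+1%:R : R).
Local Notation vec := 'rV[R]_n.+1.
Variables (q : nat -> vec).
Local Notation gen := (gen q).

Lemma normalize_close (a b : vec) (e : R) : a != 0 -> b != 0 -> `|a - b| <= e * `|a| ->
  forall k, `|a 0 k / `|a| - b 0 k / `|b| | <= 2 * e.
Proof.
move=> a0 b0 ab k; have na : 0 < `|a| by rewrite normr_gt0.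
have nb : 0 < `|b| by rewrite normr_gt0.
have -> : a 0 k / `|a| - b 0 k / `|b| = ((a 0 k - b 0 k) + b 0 k / `|b| * (`|b| - `|a|)) / `|a|.
  by field; rewrite !gt_eqF.
rewrite normrM [`|_^-1|]gtr0_norm ?invr_gt0// ler_pdivrMr//.
have -> : 2 * e * `|a| = e * `|a| + e * `|a| by ring.
apply: le_trans (ler_normD _ _) _; apply: lerD.
  exact: le_trans (coord_dist a b k) ab.
rewrite normrM; apply: le_trans (_ : 1 * `|a - b| <= _); last by rewrite mul1r.
apply: ler_pM => //.
  rewrite normrM [`|_^-1|]gtr0_norm ?invr_gt0// ler_pdivrMr// mul1r; exact: coord_le.
by rewrite distrC; exact: ler_dist_dist.
Qed.

Lemma scale_close (a b : vec) (r e d : R) : a != 0 -> b != 0 -> `|a| <= r -> 0 <= e -> 0 <= r ->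
  `| `|a| - `|b| | <= d ->
  (forall k, `|a 0 k / `|a| - b 0 k / `|b| | <= e) -> `|a - b| <= r * e + d.
Proof.
move=> a0 b0 ar e0 r0 abd H; have na : 0 < `|a| by rewrite normr_gt0.
have nb : 0 < `|b| by rewrite normr_gt0.
have d0 : 0 <= d by exact: le_trans abd.
apply: dist_le_coord => [|k]; first by rewrite addr_ge0// mulr_ge0.
have -> : a 0 k - b 0 k = `|a| * (a 0 k / `|a| - b 0 k / `|b|) + b 0 k / `|b| * (`|a| - `|b|).
  by field; rewrite !gt_eqF.
apply: le_trans (ler_normD _ _) _; apply: lerD.
  by rewrite normrM normr_id; apply: ler_pM.
rewrite normrM; apply: le_trans (_ : 1 * d <= _); last by rewrite mul1r.
apply: ler_pM => //.
by rewrite normrM [`|_^-1|]gtr0_norm ?invr_gt0// ler_pdivrMr// mul1r; exact: coord_le.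
Qed.

Section Labelling.
Variables (g : vec -> vec) (x : vec) (rho kappa kappa1 zeta eta : R) (M0 : nat).
Hypotheses (gx : gen x) (rho0 : 0 < rho) (kappa0 : 0 < kappa) (kappa_le : kappa <= 2^-1)
  (k10 : 0 < kappa1) (k1k : kappa1 <= kappa) (M0k : M0.+1%:R^-1 <= kappa)
  (k1M : 8 * 3 ^+ n.+1 * (M0.+1%:R * (2 * kappa1)) <= 1)
  (zeta0 : 0 < zeta) (eta0 : 0 < eta).
Hypotheses (g_x : `|g x| <= rho / 4) (g_neq0 : forall a, gen a -> g a != 0)
  (g_close : forall a b, gen a -> gen b -> `|a - b| <= eta -> `|g a| < rho ->
     `|g a - g b| <= kappa1 * `|g a|)
  (g_layer : forall a b, gen a -> gen b -> (1 - kappa) * rho <= `|g a| <= (1 + kappa) * rho ->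
     (1 - kappa) * rho <= `|g b| <= (1 + kappa) * rho -> `|g a - g b| <= 4 * kappa * rho ->
     `|a - b| < `|a - x| / 2)
  (g_bd : forall a k, gen a -> a 0 k < zeta \/ 1 - zeta < a 0 k -> rho <= `|g a|).

Variables (M : nat) (xi : nat -> R).
Hypotheses (M_gt0 : (0 < M)%N) (Meta : 2 * M.+1%:R^-1 <= eta) (Mzeta : M.+1%:R^-1 <= zeta)
  (xiP : forall i : nat, i%:R * M.+1%:R^-1 < xi i < i.+1%:R * M.+1%:R^-1)
  (xiq : forall i j, xi i != q j 0 0).

Local Notation vertex := {ffun 'I_n.+1 -> 'I_M.+1}.

(** The grid points, with coordinates of index 0 replaced by generic values xi. *)
Definition place (v : vertex) : vec :=
  \row_k if k == 0 then xi (v 0) else (v k)%:R * M.+1%:R^-1 + 2^-1 * M.+1%:R^-1.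

Let M1 : (0 : R) < M.+1%:R^-1. Proof. by rewrite invr_gt0 ltr0n. Qed.

Lemma place_itv (v : vertex) k : (v k)%:R * M.+1%:R^-1 < place v 0 k < (v k).+1%:R * M.+1%:R^-1.
Proof.
rewrite mxE; case: eqP => [->|_]; first exact: xiP.
rewrite -[(v k).+1%:R]natr1 mulrDl mul1r; move: M1; move: (_^-1) (_ * _) => m y m1.
by apply/andP; split; lra.
Qed.

Lemma place_gen v : gen (place v).
Proof.
split=> [k|j]; last by rewrite mxE eqxx.
have /andP[l r] := place_itv v k; apply/andP; split.
  by apply: le_lt_trans l; rewrite mulr_ge0// ltW.
apply: lt_le_trans r _; rewrite ler_pdivrMr ?ltr0n// mul1r ler_nat.
exact: ltn_ord.
Qed.

Lemma place_cell (w u v : vertex) : (forall k, (w k <= u k <= (w k).+1)%N) ->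
  (forall k, (w k <= v k <= (w k).+1)%N) -> `|place u - place v| <= eta.
Proof.
move=> wu wv; apply: le_trans Meta; have m1 := M1.
apply: dist_le_coord => [|k]; first by rewrite mulr_ge0// ltW.
have /andP[u1 u2] := wu k; have /andP[v1 v2] := wv k.
have : (w k)%:R * M.+1%:R^-1 <= (u k)%:R * M.+1%:R^-1 :> R by rewrite ler_wpM2r ?ler_nat// ltW.
have : (w k)%:R * M.+1%:R^-1 <= (v k)%:R * M.+1%:R^-1 :> R by rewrite ler_wpM2r ?ler_nat// ltW.
have : (u k).+1%:R * M.+1%:R^-1 <= ((w k).+1.+1)%:R * M.+1%:R^-1 :> R.
  by rewrite ler_wpM2r ?ler_nat// ltW.
have : (v k).+1%:R * M.+1%:R^-1 <= ((w k).+1.+1)%:R * M.+1%:R^-1 :> R.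
  by rewrite ler_wpM2r ?ler_nat// ltW.
have -> : (w k).+2%:R * M.+1%:R^-1 = (w k)%:R * M.+1%:R^-1 + 2 * M.+1%:R^-1 :> R.
  by rewrite -mulrDl -natrD addn2.
rewrite ler_norml; move: m1 (place_itv u k) (place_itv v k).
move: (M.+1%:R^-1) => m m1 /andP[? ?] /andP[? ?] *.
by apply/andP; split; lra.
Qed.

Let gv (v : vertex) : vec := g (place v).
Let inside (v : vertex) := `|gv v| < rho.

Let gv0 v : gv v != 0. Proof. by apply: g_neq0; exact: place_gen. Qed.

(** The direction of g, rescaled so that bricks are small on the sphere. *)
Definition angle (v : vertex) (k : nat) : R := M0.+1%:R * ((gv v : vec) 0 (inord k) / `|gv v|).
Definition colour (v : vertex) : seq int := [seq brick (angle v) k | k <- iota 0 n.+1].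

(** Attaches the colours seen just inside the sphere of radius rho to vertices just outside. *)
Definition touches (c : seq int) (v : vertex) : Prop := rho <= `|gv v| /\
  exists u, [/\ inside u, colour u = c & `|gv u - gv v| <= kappa * rho].

(** One vertex just outside the ball for each colour; the default value occurs for colours
    that do not touch the boundary of the ball. *)
Definition representative (c : seq int) : vertex :=
  if pselect (exists v, touches c v) is left H then projT1 (cid H) else [ffun=> ord0].

Lemma representativeP c v : touches c v -> touches c (representative c).
Proof.
rewrite /representative => tv; case: pselect => [H|[]]; last by exists v.
exact: (projT2 (cid H)).
Qed.

(** A substitute for a retraction of the punctured ball to its boundary: the points inside
    move to a boundary point of the same colour. *)
Definition moved (v : vertex) : vec := if inside v then place (representative (colour v)) else place v.

(** The first coordinate in which the moved point exceeds x, and n + 1 if there is none. A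
    cell with all the labels surrounds x. *)
Definition label (v : vertex) : nat := find (fun k => x 0 k < moved v 0 k) (enum 'I_n.+1).

Lemma colour_brick u v : colour u = colour v -> forall k, (k < n.+1)%N -> brick (angle u) k = brick (angle v) k.
Proof.
move=> e k kn; have := congr1 (fun s => nth 0 s k) e.
by rewrite !(nth_map 0%N) ?size_iota// !nth_iota.
Qed.

Lemma brick_colour u v : (forall k, (k < n.+1)%N -> brick (angle u) k = brick (angle v) k) -> colour u = colour v.
Proof. by move=> H; apply/eq_in_map => k; rewrite mem_iota => /andP[_ kn]; exact: H. Qed.

Lemma close_inside (w u v : vertex) : (forall k, (w k <= u k <= (w k).+1)%N) ->
  (forall k, (w k <= v k <= (w k).+1)%N) -> inside u -> `|gv u - gv v| <= kappa1 * `|gv u|.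
Proof.
move=> wu wv iu; apply: g_close => //; [exact: place_gen|exact: place_gen|].
exact: place_cell wu wv.
Qed.

Lemma label_le v : (label v <= n.+1)%N.
Proof. by rewrite -[leqRHS]size_enum_ord find_size. Qed.

Lemma label_pos v (k : 'I_n.+1) : label v = k -> x 0 k < moved v 0 k.
Proof.
move=> e; have h : has (fun k => x 0 k < moved v 0 k) (enum 'I_n.+1).
  by rewrite has_find -/(label v) e size_enum_ord.
by have := nth_find k h; rewrite -/(label v) e nth_ord_enum.
Qed.

Lemma label_before v (k : 'I_n.+1) : (k < label v)%N -> moved v 0 k <= x 0 k.
Proof. by move=> /(before_find k); rewrite nth_ord_enum leNgt => ->. Qed.

Lemma x_itv k : zeta <= x 0 k <= 1 - zeta.
Proof.
have r0 := rho0; have xr := g_x.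
by apply/andP; split; rewrite leNgt; apply/negP => H;
  [have := g_bd gx (or_introl H)|have := g_bd gx (or_intror H)]; lra.
Qed.

Lemma outside_moved v : rho <= `|gv v| -> moved v = place v.
Proof. by rewrite /moved /inside ltNge => ->. Qed.

Lemma label_low (v : vertex) (k : 'I_n.+1) : v k = 0 :> nat -> label v != k.
Proof.
move=> v0; apply/eqP => /label_pos; apply/negP; rewrite -leNgt.
have /andP[_ h] := place_itv v k; rewrite v0 mul1r in h.
have lt : place v 0 k < zeta by exact: lt_le_trans h Mzeta.
rewrite outside_moved; last by apply: g_bd (or_introl lt); exact: place_gen.
by have /andP[? _] := x_itv k; exact: ltW (lt_le_trans lt _).
Qed.

Lemma label_high (v : vertex) (k : 'I_n.+1) : v k = M :> nat -> (label v <= k)%N.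
Proof.
move=> v0; rewrite leqNgt; apply/negP => /label_before; apply/negP; rewrite -ltNge.
have /andP[h _] := place_itv v k; rewrite v0 in h.
have e : M%:R * M.+1%:R^-1 = 1 - M.+1%:R^-1 :> R.
  have nz : M.+1%:R != 0 :> R by rewrite pnatr_eq0.
  by apply: (mulIf nz); rewrite mulrBl mul1r mulfVK// mulVf// -(natr1 M) addrK.
rewrite e in h; have mz := Mzeta.
have lt : 1 - zeta < place v 0 k by apply: le_lt_trans h; rewrite lerB.
rewrite outside_moved; last by apply: g_bd (or_intror lt); exact: place_gen.
by have /andP[_ ?] := x_itv k; exact: le_lt_trans lt.
Qed.

Lemma layer_dist u v : `|gv u| < rho -> colour u = colour v -> (1 - kappa) * rho <= `|gv u| ->
  `|gv v| < rho -> (1 - kappa) * rho <= `|gv v| -> `|gv u - gv v| <= 2 * kappa * rho.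
Proof.
move=> u1 e u2 v1 v2; have r0 := rho0; have K0 := kappa0.
have H k : `|gv u 0 k / `|gv u| - gv v 0 k / `|gv v| | <= kappa.
  have := brick_close (colour_brick e) (ltn_ord k); rewrite /angle inord_val -mulrBr normrM.
  rewrite ger0_norm// mulrC -ltr_pdivlMr ?ltr0n// mul1r => /ltW hk; exact: le_trans M0k.
have -> : 2 * kappa * rho = rho * kappa + kappa * rho by ring.
apply: scale_close => //; [exact: ltW|exact: ltW|exact: ltW|].
by rewrite ler_norml; apply/andP; split; lra.
Qed.

(** Suppose that the vertices of a cell carry all the labels. If |g| < rho at all of them,
    their directions are close and one coordinate of the scaled directions is near an
    integer, so brick_multiplicity gives two vertices of equal colour, which are moved to the
    same place and cannot have different labels. If |g| >= rho at all of them, no vertex is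
    moved, x is close to the cell since the labels surround it, and g x would be large. In
    the mixed case every vertex ends up close to a vertex v of the far layer, because equal
    colours mean close directions and g_layer makes points of the layer with close values
    close compared with their distance to x. As the labels surround x, this bounds the
    distance from v to x by half of itself. *)
Lemma labelling_absurd : False.
Proof.
have [w [_ wP]] := kuhn_cell label_le label_low label_high M_gt0.
have /choice[V VP] : forall l : 'I_n.+2, exists v : vertex, label v = l /\ forall k, (w k <= v k <= (w k).+1)%N.
  by move=> l; apply: wP; rewrite -ltnS.
have Vl l : label (V l) = l := (VP l).1.
have Vc l := (VP l).2.
have r0 := rho0; have K0 := kappa0; have K1 := k10; have K1k := k1k; have K2 := kappa_le.
have surround (v : 'I_n.+2) (D : R) : 0 <= D -> (forall u, `|moved (V u) - moved (V v)| <= D) ->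
    `|moved (V v) - x| <= D.
  move=> D0 H; apply: dist_le_coord => // k.
  have lo : moved (V ord_max) 0 k <= x 0 k by apply: label_before; rewrite Vl.
  have hi : x 0 k < moved (V (widen_ord (leqnSn _) k)) 0 k by apply: label_pos; rewrite Vl.
  have := le_trans (coord_dist _ _ k) (H ord_max).
  have := le_trans (coord_dist _ _ k) (H (widen_ord (leqnSn _) k)).
  by rewrite !ler_norml => /andP[? ?] /andP[? ?]; apply/andP; split; lra.
have [[v ov]|allin] := pselect (exists v, rho <= `|gv (V v)|); last first.
  have ins u : inside (V u) by rewrite /inside ltNge; apply/negP => ?; apply: allin; exists u.
  pose lam : R := M0.+1%:R * (2 * kappa1).
  have near a b k : `|angle (V a) k - angle (V b) k| <= lam.
    rewrite /angle -mulrBr normrM ger0_norm//; apply: ler_wpM2l => //.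
    by apply: normalize_close => //; exact: close_inside (Vc a) (Vc b) (ins a).
  have [k0 e0] := norm_attained (gv (V ord0)).
  have [z ez] : exists z : int, angle (V ord0) k0 = z%:~R.
    rewrite /angle inord_val e0; have n0 : gv (V ord0) 0 k0 != 0 by rewrite -normr_gt0 -e0 normr_gt0.
    have [p|p] := leP 0 (gv (V ord0) 0 k0).
      by exists M0.+1; rewrite ger0_norm// divff// mulr1.
    by exists (- M0.+1%:Z); rewrite ltr0_norm// invrN mulrN divff// mulrN1 rmorphN.
  have [a [b [ab ce]]] := @brick_multiplicity R n.+1 n.+2 (fun a => angle (V a)) lam k0 z
    k1M (fun a b k _ => near a b k) (ltn_ord k0) (fun a => ltac:(rewrite -ez; exact: near)) (ltnSn _).
  have lam0 : 0 < lam by rewrite mulr_gt0 ?ltr0n// mulr_gt0.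
  have lam1 : lam < 1.
    have e1 : 1 <= 3 ^+ n.+1 :> R by rewrite exprn_ege1// ler1n.
    by move: k1M; rewrite -/lam; nra.
  have cc : colour (V a) = colour (V b).
    by apply: brick_colour; apply: code_brick ce => j _; exact: le_lt_trans (near a b j) lam1.
  case/eqP: ab; apply: val_inj; rewrite /= -(Vl a) -(Vl b) /label /moved.
  by rewrite (ins a) (ins b) cc.
have [[u iu]|allout] := pselect (exists u, inside (V u)); last first.
  have out l : rho <= `|gv (V l)| by rewrite leNgt; apply/negP => ?; apply: allout; exists l.
  have zx : `|moved (V v) - x| <= eta.
    apply: surround => [|u]; first exact: ltW.
    by rewrite !outside_moved//; exact: place_cell (Vc u) (Vc v).
  rewrite outside_moved// distrC in zx.
  have xr := g_x; have gx1 : `|g x| < rho by lra.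
  have := g_close gx (place_gen (V v)) zx gx1.
  have := ler_distD (g x) (gv (V v)) 0; rewrite !subr0 distrC.
  have : kappa1 * `|g x| <= 1 * `|g x| by rewrite ler_wpM2r//; lra.
  move: ov; rewrite -/(gv (V v)); lra.
have mixed l : inside (V l) -> `|gv (V l) - gv (V v)| <= kappa * rho.
  move=> il; apply: le_trans (close_inside (Vc l) (Vc v) il) _.
  by apply: ler_pM => //; [exact: ltW|exact: ltW].
have vtop : (1 - kappa) * rho <= `|gv (V v)| <= (1 + kappa) * rho.
  have := mixed u iu; have := ler_distD (gv (V u)) (gv (V v)) 0; rewrite !subr0 (distrC (gv (V v))).
  by move: iu ov; rewrite /inside => *; apply/andP; split; nra.
have gpv := place_gen (V v).
set D := `|place (V v) - x|.
have step l : `|moved (V l) - moved (V v)| <= D / 2.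
  rewrite [moved (V v)]outside_moved// distrC.
  have [il|] := boolP (inside (V l)); last first.
    rewrite /inside -leNgt => ol; rewrite outside_moved//; apply/ltW/g_layer => //; first exact: place_gen.
      have := close_inside (Vc u) (Vc l) iu.
      have : kappa1 * `|gv (V u)| <= kappa * rho by apply: ler_pM => //; exact: ltW.
      have := ler_distD (gv (V u)) (gv (V l)) 0; rewrite !subr0 (distrC (gv (V l))).
      by move: iu ol; rewrite /inside => *; apply/andP; split; nra.
    have h1 := close_inside (Vc u) (Vc l) iu; have h2 := mixed u iu.
    have : kappa1 * `|gv (V u)| <= kappa * rho by apply: ler_pM => //; exact: ltW.
    have := ler_distD (gv (V u)) (gv (V v)) (gv (V l)); rewrite (distrC (gv (V v)) (gv (V u))).
    by have := mulr_ge0 (ltW K0) (ltW r0); rewrite -/(gv _) -/(gv _); lra.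
  have tl : touches (colour (V l)) (V v) by split => //; exists (V l); split => //; exact: mixed.
  have [rv' [u' [iu' cu' du']]] := representativeP tl.
  rewrite /moved il; set v' := representative _ in rv' du' *.
  have dl := mixed l il.
  have ul : (1 - kappa) * rho <= `|gv (V l)|.
    by have := ler_distD (gv (V l)) (gv (V v)) 0; rewrite !subr0 (distrC (gv (V v))); move: ov; lra.
  have uu' : (1 - kappa) * rho <= `|gv u'|.
    by have := ler_distD (gv u') (gv v') 0; rewrite !subr0 (distrC (gv v')); lra.
  have dd := layer_dist il (esym cu') ul iu' uu'.
  apply/ltW/g_layer => //; first exact: place_gen.
    have := ler_distD (gv u') (gv v') 0; rewrite !subr0 (distrC (gv v')).
    by move: iu' rv'; rewrite /inside -/(gv v') => *; apply/andP; split; nra.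
  have := ler_distD (gv (V l)) (gv (V v)) (gv v'); have := ler_distD (gv u') (gv (V l)) (gv v').
  rewrite (distrC (gv (V v)) (gv (V l))) -/(gv (V v)) -/(gv v').
  lra.
have D0 : 0 <= D by exact: normr_ge0.
have D20 : 0 <= D / 2 by rewrite divr_ge0.
have := surround v _ D20 step; rewrite outside_moved// -/D => DD.
have [Dp|] := ltP 0 D; first by lra.
move=> Dle; have De : D = 0 by apply/eqP; rewrite eq_le Dle D0.
have q0 : `|g (place (V v)) - g (place (V v))| <= 4 * kappa * rho.
  by rewrite subrr normr0 !mulr_ge0// ltW.
by have := g_layer gpv gpv vtop vtop q0; rewrite subrr normr0 -/D; lra.
Qed.

End Labelling.
End Puncture.

(** * A slit near the source of every puncture *)

Lemma doubling {R : realFieldType} (d nn xa ab dd h t : R) : d <= nn * xa + 8 * h -> 16 * h <= t ->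
  t < d -> xa / 2 <= ab -> ab <= dd -> 0 <= nn -> d <= 4 * nn * dd.
Proof.
move=> h1 h2 h3 h4 h5 n0; have : nn * xa <= nn * (2 * dd) by apply: ler_wpM2l => //; lra.
by lra.
Qed.

Lemma thin_layer {R : realFieldType} (r E J D nn G h K : R) : r / 8 <= E -> E <= J * D ->
  D <= 20 * nn * (G + h) -> G <= 4 * K * r -> h <= K * r -> K * (nn * J) = 2000^-1 ->
  0 <= nn -> 0 <= J -> 0 < r -> False.
Proof.
move=> h1 h2 h3 h4 h5 e n0 J0 r0.
have h6 : D <= 20 * nn * (5 * (K * r)).
  by apply: le_trans h3 _; apply: ler_wpM2l; [rewrite mulr_ge0|lra].
have : J * D <= J * (20 * nn * (5 * (K * r))) by exact: ler_wpM2l.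
have -> : J * (20 * nn * (5 * (K * r))) = 100 * (K * (nn * J)) * r by ring.
by rewrite e; lra.
Qed.

Lemma half_cancel {R : fieldType} (a t : R) : a != 0 -> a * (t / (2 * a)) = t / 2.
Proof. by move=> a0; rewrite invfM mulrCA [a * _]mulrCA mulfV// mulr1. Qed.

Lemma half_eighth {R : realFieldType} (t h : R) : h < t / 16 -> t / 2 + 8 * h <= t.
Proof. by move=> *; lra. Qed.

Lemma le_half {R : realFieldType} (m e : R) : m < e / 2 -> 2 * m <= e.
Proof. by move=> *; lra. Qed.

Lemma le_half_self {R : realFieldType} (m e : R) : 0 < m -> m < e / 2 -> m <= e.
Proof. by move=> *; lra. Qed.

Lemma border_far {R : realFieldType} (a x e : R) : a < e / 2 \/ 1 - e / 2 < a -> e < x -> x < 1 - e ->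
  - (e / 2) < x - a < e / 2 -> False.
Proof. by case=> ? ? ? /andP[? ?]; lra. Qed.

Section Hole.
Context {R : realType} {n : nat}.
Local Notation N := (n.+1%:R : R).
Local Notation vec := 'rV[R]_n.+1.
Variables (q : nat -> vec) (h : nat -> R).
Hypotheses (n_ge1 : (1 <= n)%N) (pq : placement q) (sh : sizes q h).
Local Notation gen := (gen q).
Local Notation X := (slit_space (@slit_space_cvg _ _ _ _ n_ge1 pq sh)).
Local Notation pt := (pt n_ge1 pq sh).
Local Notation opening := (opening q h).

(** The reciprocal of the relative thickness of the layers in which the labelling argument
    compares values; it grows with J because it has to beat the distortion J + 1. *)
Definition scale J : nat := (2000 * n.+1 * J.+1)%N.
(** The relative error allowed for the values of g at neighbouring points, small enough for
    brick_multiplicity. *)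
Definition slack J : R := (16 * 3 ^+ n.+1 * (scale J)%:R)^-1.

Lemma scale_gt0 J : (0 : R) < (scale J)%:R.
Proof. by rewrite ltr0n /scale !muln_gt0. Qed.

Lemma scaleE J : (scale J)%:R = 2000 * N * J.+1%:R :> R.
Proof. by rewrite /scale !natrM. Qed.

Lemma slack_gt0 J : 0 < slack J.
Proof. by rewrite /slack invr_gt0 !mulr_gt0 ?scale_gt0 ?exprn_gt0 ?ltr0n. Qed.

Lemma slack_le J : 16 * slack J <= (scale J)%:R^-1.
Proof.
rewrite /slack; have K0 := scale_gt0 J.
have e1 : (1 : R) <= 3 ^+ n.+1 by rewrite exprn_ege1// ler1n.
have e0 : 3 ^+ n.+1 != 0 :> R by rewrite expf_neq0// pnatr_eq0.
have -> : 16 * (16 * 3 ^+ n.+1 * (scale J)%:R)^-1 = (3 ^+ n.+1)^-1 * (scale J)%:R^-1 :> R.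
  by field; rewrite (gt_eqF K0) e0.
rewrite -[leRHS]mul1r; apply: ler_wpM2r; first by rewrite invr_ge0 ltW.
by rewrite invf_le1// (lt_le_trans ltr01).
Qed.

Lemma slack_anti i j : (i <= j)%N -> slack j <= slack i.
Proof.
move=> ij; rewrite /slack lef_pV2 ?posrE ?mulr_gt0 ?scale_gt0 ?exprn_gt0 ?ltr0n//.
by apply: ler_wpM2l; rewrite ?mulr_ge0// ler_nat /scale leq_mul2l ltnS ij orbT.
Qed.

Lemma scale_inv J : (scale J)%:R^-1 * (N * J.+1%:R) = 2000^-1 :> R.
Proof.
rewrite scaleE; have : N != 0 by rewrite pnatr_eq0.
have : J.+1%:R != 0 :> R by rewrite pnatr_eq0.
by move: N (J.+1%:R) => a b b0 a0; field; rewrite a0 b0.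
Qed.

Lemma scale_inv_le J : (scale J)%:R^-1 <= 2000^-1 :> R.
Proof.
rewrite lef_pV2 ?posrE ?scale_gt0 ?ltr0n// ler_nat /scale -mulnA.
by rewrite -[leqLHS]muln1 leq_mul2l muln_gt0.
Qed.

Section Puncture.
Variables (f : X -> X) (k J : nat) (x w c : vec) (G : X -> vec) (e' t rho r0 : R).
Hypotheses (gx : gen x) (gw : gen w) (dx : deep q J e' x) (e'0 : 0 < e').
Hypotheses (fH : wqs f (4 * N) J.+1%:R) (rho0 : 0 < rho) (r00 : 0 < r0).
Hypothesis GP : forall p u, gen u -> `|G p - opening k u| <= 2 * mdist p (pt u).
Hypotheses (wiso : isolated q h k J (32 * rho) w) (yw : mdist (f (pt x)) (pt w) <= rho / 16)
  (yc : `|G (f (pt x)) - c| <= rho / 4) (far : forall p, r0 <= `|G p - c|).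
Hypotheses (hJt : 24 * N * h J <= t) (hJr : (scale J)%:R * h J <= rho).
Hypothesis upper : forall b, mdist (pt x) b <= t -> mdist (f (pt x)) (f b) <= rho / 16.
Hypothesis lower : forall b, e' / 2 <= mdist (pt x) b -> 40 * N * rho < mdist (f (pt x)) (f b).
Local Notation g a := (G (f (pt a)) - c).

Let hJr' : h J <= (scale J)%:R^-1 * rho.
Proof. by rewrite ler_pdivlMl ?scale_gt0. Qed.

Let hJr4 : 16 * h J <= 32 * rho /\ h J <= rho / 4.
Proof.
have a : (scale J)%:R^-1 * rho <= 2000^-1 * rho by rewrite ler_pM2r// scale_inv_le.
by have := hJr'; have := rho0; move: a; move: ((scale J)%:R^-1 * rho) => z; split; lra.
Qed.

(** All points with |g| of order rho have images in the chart around w. *)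
Lemma chart_bound a b : gen a -> gen b -> `|g a| <= 3 / 2 * rho -> `|g b| <= 3 / 2 * rho ->
  mdist (f (pt a)) (f (pt b)) <= 20 * N * (`|g a - g b| + h J).
Proof.
have near (p : X) : `|G p - c| <= 3 / 2 * rho -> `|G p - opening k w| < 32 * rho / 8.
  move=> pc; have := GP (f (pt x)) gw.
  have y2 : 2 * mdist (f (pt x)) (pt w) <= rho / 8.
    have -> : rho / 8 = 2 * (rho / 16) by field.
    by rewrite ler_pM2l.
  move=> /le_trans/(_ y2) yo.
  have h1 := ler_distD c (G p) (opening k w).
  have h2 := ler_distD (G (f (pt x))) c (opening k w); rewrite (distrC c (G _)) in h2.
  move: pc yo h1 h2 yc rho0; clear y2; move: (`|_|) (`|_|) (`|_|) (`|_|) (`|_|) => *; lra.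
move=> ga gb ha hb; have -> : g a - g b = G (f (pt a)) - G (f (pt b)) by rewrite opprB addrA subrK.
apply: (chart_dist gw GP wiso hJr4.1); exact: near.
Qed.


Let N0 : 0 < N. Proof. by rewrite ltr0n. Qed.

Let N16 : 16 <= 24 * N.
Proof. have h1 : 1 <= N by rewrite ler1n. by lra. Qed.

(** Points with |g| of order rho are close to x: otherwise modulus_lower would make the
    images far apart. *)
Lemma near_x a : gen a -> `|g a| <= 3 / 2 * rho -> mdist (pt x) (pt a) < e' / 2.
Proof.
move=> ga ha; rewrite ltNge; apply/negP => /lower; apply/negP; rewrite -leNgt.
have hx : `|g x| <= 3 / 2 * rho by apply: le_trans yc _; have := rho0; lra.
apply: le_trans (chart_bound gx ga hx ha) _.
have -> : 40 * N * rho = 20 * N * (2 * rho) by ring.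
apply: ler_wpM2l; first by rewrite mulr_ge0// ltW.
have h1 := ler_normB (g x) (g a).
move: h1 ha yc hJr4.2 rho0; move: (`|_|) (`|_|) (`|_|) (h J) => *; lra.
Qed.

Lemma deep_plane a b i : gen a -> mdist (pt x) (pt a) < e' / 2 -> `|a - b| <= e' / 2 ->
  (i < J)%N -> ~ between (a 0 0) (b 0 0) (q i 0 0).
Proof.
move=> ga xa ab iJ /between_dist[ac _].
have x1 := le_lt_trans (pt_norm_le n_ge1 pq sh (gen_free h gx) (gen_free h ga)) xa.
have h1 := le_lt_trans (coord_dist x a 0) x1.
have h2 := le_trans (coord_dist a b 0) ab.
have h3 := dx.1 i iJ; have h4 := ler_distD (a 0 0) (x 0 0) (q i 0 0).
move: ac h1 h2 h3 h4; clear x1; move: (`|_|) (`|_|) (`|_|) (`|_|) => *; lra.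
Qed.

(** If a and b were at a distance comparable to that between a and x, weak quasisymmetry
    would compare the images, and f a would be too close to f x. Here the smallness of h_J
    makes the sup norm and the distance comparable. *)
Lemma layer_step a b : gen a -> gen b -> rho / 2 <= `|g a| -> `|g a| <= 3 / 2 * rho ->
  `|g b| <= 3 / 2 * rho -> `|g a - g b| <= 4 * (scale J)%:R^-1 * rho -> `|a - b| < `|a - x| / 2.
Proof.
move=> ga gb ha1 ha2 hb gab; rewrite ltNge; apply/negP => abx.
have xa := near_x ga ha2.
have fxa : rho / 8 <= mdist (f (pt x)) (f (pt a)).
  have := extend_lip GP (f (pt a)) (f (pt x)).
  have h1 := ler_distD (G (f (pt x))) (G (f (pt a))) c.
  rewrite (metric_sym (f (pt a))); move: h1 yc ha1; clear xa.
  move: (`|_|) (`|_|) (`|_|) (mdist _ _) => *; lra.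
have tx : t < mdist (pt x) (pt a).
  rewrite ltNge; apply/negP => /upper /(le_trans fxa).
  by have := rho0; clear xa fxa; lra.
have dax : mdist (pt x) (pt a) <= N * `|x - a| + 8 * h J.
  apply: pt_dist_le => // i iJ bt; exfalso.
  have [h1 _] := between_dist bt.
  have x1 := le_lt_trans (pt_norm_le n_ge1 pq sh (gen_free h gx) (gen_free h ga)) xa.
  have h2 := le_lt_trans (coord_dist x a 0) x1; have := dx.1 i iJ.
  move: h1 h2 e'0; clear x1 tx fxa xa; move: (`|_|) (`|_|) => *; lra.
have dab : mdist (pt x) (pt a) <= 4 * N * mdist (pt a) (pt b).
  have ab := pt_norm_le n_ge1 pq sh (gen_free h ga) (gen_free h gb).
  have hN : 16 * h J <= t.
    by apply: le_trans hJt; apply: (ler_wpM2r (ltW (h_gt0 sh J))); exact: N16.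
  by apply: doubling dax hN tx _ ab (ltW N0); rewrite distrC.
apply: thin_layer fxa (fH dab) (chart_bound ga gb ha2 hb) gab hJr' (scale_inv J) _ _ rho0 => //.
Qed.


(** Otherwise the hypotheses of labelling_absurd hold for g: close grid points have close
    values by uniform continuity, unless a slit separates them; slits of index below J are
    too far from x by deep_plane, and the later ones satisfy the estimate by assumption. *)
Lemma puncture : exists i a b, [/\ (J <= i)%N, gen a & gen b] /\ [/\ near_slit q h i a,
  near_slit q h i b, mdist (pt x) (pt a) < e' / 2 & slack J * `|g a| < `|g a - g b|].
Proof.
apply: contrapT => none; have K0 := scale_gt0 J; have s0 := slack_gt0 J.
have close i a b : (J <= i)%N -> gen a -> gen b -> near_slit q h i a -> near_slit q h i b ->
    `|g a| < rho -> `|g a - g b| <= slack J * `|g a|.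
  move=> Ji ga gb na nb ha; rewrite leNgt; apply/negP => bad; apply: none; exists i, a, b.
  split; split => //; apply: near_x => //; apply: le_trans (ltW ha) _.
  by apply: scale_le (ltW rho0); lra.
have J1 : (1 : R) <= J.+1%:R by rewrite ler1n.
have s1 : 0 < slack J * r0 / 2 by rewrite divr_gt0// mulr_gt0.
have [t' t'0 t'P] := modulus_upper n_ge1 pq J1 s1.
have [m hm] := h_small sh (divr_gt0 t'0 (ltr0n R 16)).
pose eta := Num.min (h m) (Num.min (t' / (2 * N)) (e' / 2)).
have eta0 : 0 < eta.
  by rewrite !lt_min (h_gt0 sh) !divr_gt0// mulr_gt0.
have [em et ee] : [/\ eta <= h m, eta <= t' / (2 * N) & eta <= e' / 2].
  by rewrite /eta !ge_min !lexx !orbT.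
have [M hM] := invS_small (divr_gt0 eta0 (ltr0n R 2)).
have xiP i : exists2 z : R, i%:R * M.+1%:R^-1 < z < i.+1%:R * M.+1%:R^-1 &
    forall j, z != q j 0 0.
  by apply: avoid_countable; rewrite ltr_pM2r ?invr_gt0 ?ltr0n// ltr_nat.
have /choice[xi xiE] : forall i, exists z : R, i%:R * M.+1%:R^-1 < z < i.+1%:R * M.+1%:R^-1 /\
    forall j, z != q j 0 0 by move=> i; have [z z1 z2] := xiP i; exists z.
have Ke : (scale J).-1.+1 = scale J by rewrite prednK// /scale !muln_gt0.
have si := scale_inv_le J.
have sle : slack J <= (scale J)%:R^-1 by apply: le_trans (slack_le J); apply: scale_le (ltW s0); lra.
have M1 : (0 : R) < M.+1%:R^-1 by rewrite invr_gt0 ltr0n.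
have eta8 : eta <= 8^-1 by apply: le_trans em (h_le8 sh m).
have M0 : (0 < M)%N.
  rewrite lt0n; apply/eqP => M0; move: hM eta8; rewrite M0 invr1 => a1 a2; lra.
apply: (@labelling_absurd _ _ q (fun a => g a) x rho (scale J)%:R^-1 (slack J) (e' / 2) eta
  (scale J).-1 gx rho0 _ _ s0 sle _ _ eta0 yc _ _ _ _ M xi M0 _ _ (fun i => (xiE i).1)
  (fun i => (xiE i).2)).
- by rewrite invr_gt0; exact: K0.
- by apply: le_trans si _; rewrite lef_pV2 ?posrE ?ltr0n// ler_nat.
- by rewrite Ke; exact: lexx.
- rewrite Ke /slack le_eqVlt; apply/orP; left; apply/eqP; field.
  by rewrite (gt_eqF K0) expf_neq0// pnatr_eq0.
- by move=> a ga; rewrite -normr_gt0; exact: lt_le_trans (far _).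
- move=> a b ga gb ab ha.
  have [dab|[i [im na nb bt]]] := cell_dichotomy n_ge1 pq sh ga gb (le_trans ab em).
    apply: le_trans (_ : slack J * r0 <= _); last by rewrite ler_pM2l.
    have -> : slack J * r0 = 2 * (slack J * r0 / 2) by field.
    have fab : mdist (f (pt a)) (f (pt b)) <= slack J * r0 / 2.
      apply: t'P => //; apply: le_trans dab _.
      have h1 : N * `|a - b| <= N * (t' / (2 * N)) by rewrite ler_pM2l// (le_trans ab).
      have h2 : N * (t' / (2 * N)) = t' / 2 by apply: half_cancel; rewrite pnatr_eq0.
      apply: le_trans (lerD h1 (lexx _)) _; rewrite h2.
      exact: half_eighth hm.
    have -> : g a - g b = G (f (pt a)) - G (f (pt b)) by rewrite opprB addrA subrK.
    by apply: le_trans (extend_lip GP _ _) _; rewrite ler_pM2l.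
  have [Ji|iJ] := leqP J i; first exact: close Ji _ _ _ _ _.
  have xa : mdist (pt x) (pt a) < e' / 2.
    by apply: near_x => //; apply: le_trans (ltW ha) _; apply: scale_le (ltW rho0); lra.
  by case: (deep_plane ga xa (le_trans ab ee) iJ bt).
- move=> a b ga gb /andP[a1 a2] /andP[b1 b2] gab.
  have u : (1 + (scale J)%:R^-1) * rho <= 3 / 2 * rho by rewrite ler_pM2r//; lra.
  have l : rho / 2 <= (1 - (scale J)%:R^-1) * rho by rewrite mulrC ler_pM2r//; lra.
  exact: layer_step (le_trans l a1) (le_trans a2 u) (le_trans b2 u) gab.
- move=> a k' ga bd; rewrite leNgt; apply/negP => ha.
  have xa : mdist (pt x) (pt a) < e' / 2.
    by apply: near_x => //; apply: le_trans (ltW ha) _; apply: scale_le (ltW rho0); lra.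
  have x1 := le_lt_trans (pt_norm_le n_ge1 pq sh (gen_free h gx) (gen_free h ga)) xa.
  have := le_lt_trans (coord_dist x a k') x1; have /andP[] := dx.2 k'.
  by move: bd; rewrite ltr_norml; exact: border_far.
- exact: le_half hM.
- exact: le_trans (le_trans (le_half_self M1 hM) _) ee.
Qed.

End Puncture.
End Hole.

(** * Stages: how small each slit has to be *)

Lemma finite_lower {R : realFieldType} (I : finType) (f : I -> R) : (forall i, 0 < f i) ->
  exists2 e : R, 0 < e & forall i, e < f i.
Proof.
move=> f0; exists (\big[Num.min/1]_i (f i / 2)).
  by apply: lt_bigmin => // i _; rewrite divr_gt0.
move=> i; apply: (@le_lt_trans _ _ (f i / 2)); first exact: bigmin_le_cond.
by have := f0 i; lra.
Qed.

Section Stages.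
Context {R : realType} {n : nat}.
Local Notation N := (n.+1%:R : R).
Local Notation vec := 'rV[R]_n.+1.
Variables (q : nat -> vec).
Hypotheses (n_ge1 : (1 <= n)%N) (pq : placement q).
Local Notation gen := (gen q).
Local Notation Sp sh := (slit_space (@slit_space_cvg _ _ _ _ n_ge1 pq sh)).
Local Notation pt sh := (pt n_ge1 pq sh).

(** The quantifier over all sizes makes it possible to use the modulus t in the choice of the
    sizes. *)
Definition tame (J : nat) (t s : R) : Prop :=
  forall h (sh : sizes q h) (f : Sp sh -> Sp sh), wqs f (4 * N) J.+1%:R ->
  forall u b, gen u -> mdist (pt sh u) b <= t -> mdist (f (pt sh u)) (f b) <= s.

Definition spread (J : nat) (d B : R) : Prop :=
  forall h (sh : sizes q h) (f : Sp sh -> Sp sh), wqs f (4 * N) J.+1%:R ->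
  forall x b, gen x -> d <= mdist (pt sh x) b ->
  mdist (f (pt sh (middle : vec))) (f (pt sh off_middle)) <= B * mdist (f (pt sh x)) (f b).

(** The data attached to slit J: a distance e' from the previous slits, a much smaller scale
    e at which images are examined, the range Jp of the blocks that this scale requires, the
    separation s of the planes in this range, and finally h_J, small compared with the
    modulus t that belongs to s. *)
Record stage (h : nat -> R) (J : nat) (e' e s : R) (Jp : nat) (t B : R) : Prop := Stage {
  st_clear : clearance q J e' ;
  st_e'J : e' * J.+1%:R <= 1 ;
  st_e0 : 0 < e ;
  st_ee' : 7680 * e <= e' ;
  st_eh : forall k, (k < J)%N -> 4 * e <= h k ;
  st_s0 : 0 < s ;
  st_se : s <= e ;
  st_gap : forall i j, (i < Jp)%N -> (j < Jp)%N -> i != j -> s < `|q i 0 0 - q j 0 0| ;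
  st_net : forall y : vec, (forall k, 0 <= y 0 k <= 1) -> exists b, [/\ (J <= b)%N,
    (2 ^ b.+1 <= Jp.+1)%N & forall j, (2 ^ b <= j.+1 < 2 ^ b.+1)%N -> `|q j - y| <= e / 8] ;
  st_h : (scale (n:=n) J)%:R * h J <= e ;
  st_ht : 24 * N * h J <= t ;
  st_tame : tame J t (slack (n:=n) J * s / 20) ;
  st_B0 : 0 < B ;
  st_B : 9600 * N * e * B * J.+1%:R < 1 ;
  st_spread : spread J (e' / 2) B
}.

Lemma plane_sep m : exists2 s : R, 0 < s &
  forall i j, (i < m)%N -> (j < m)%N -> i != j -> s < `|q i 0 0 - q j 0 0|.
Proof.
pose F (p : 'I_m * 'I_m) : R := if p.1 == p.2 then 1 else `|q p.1 0 0 - q p.2 0 0|.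
have F0 p : 0 < F p.
  rewrite /F; case: eqP => // ij; rewrite normr_gt0 subr_eq0.
  by apply/eqP => /(q_inj pq) e; apply: ij; exact: val_inj.
have [s s0 sP] := finite_lower F0.
exists s => // i j im jm ij; have := sP (Ordinal im, Ordinal jm); rewrite /F /=.
by rewrite -val_eqE /= (negbTE ij).
Qed.

(** Finitely many centres are involved. *)
Lemma clearance_exists J : exists2 e' : R, clearance q J e' & e' * J.+1%:R <= 1.
Proof.
pose F (i : 'I_J) : R := Num.min (q i 0 0) (1 - q i 0 0).
have F0 i : 0 < F i.
  by have /andP[? ?] := q_box pq i 0; rewrite lt_min subr_gt0; apply/andP.
have [a a0 aP] := finite_lower F0.
have [b b0 bP] := plane_sep J.
have J0 : (0 : R) < J.+1%:R^-1 by rewrite invr_gt0 ltr0n.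
pose e := Num.min (Num.min (a / 4) (b / 4)) (Num.min (32^-1) J.+1%:R^-1).
have e0 : 0 < e by rewrite !lt_min J0 !divr_gt0// invr_gt0 ltr0n.
have [ea eb e1 eJ] : [/\ e <= a / 4, e <= b / 4, e <= 32^-1 & e <= J.+1%:R^-1].
  by rewrite /e !ge_min !lexx !orbT.
exists e; last by rewrite -ler_pdivlMr ?ltr0n// mul1r.
split => //; first by lra.
- move=> i iJ; have := aP (Ordinal iJ); rewrite /F lt_min /= => /andP[? ?].
  by apply/andP; split; lra.
- by move=> i j iJ jJ ij; have := bP i j iJ jJ ij; lra.
Qed.

(** First e' is chosen, then the lower modulus B, the scale e, the range Jp, the separation
    s, the modulus t, and finally the bound for h_J. *)
Lemma stage_exists J (prev : R) : 0 < prev -> exists2 b : R, 0 < b &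
  forall h : nat -> R, (forall k, (k < J)%N -> prev <= h k) -> h J <= b ->
  exists e' e s Jp t B, stage h J e' e s Jp t B.
Proof.
move=> p0; have [e' ce' e'J] := clearance_exists J; have [e'0 _ _ _] := ce'.
have J1 : (1 : R) <= J.+1%:R by rewrite ler1n.
have J0 : (0 : R) < J.+1%:R by rewrite ltr0n.
have N0 : 0 < N by rewrite ltr0n.
have [B B0 BP] := modulus_lower n_ge1 pq J1 (divr_gt0 e'0 (ltr0n R 2)).
pose D := 9600 * N * B * J.+1%:R.
have D0 : 0 < D by rewrite !mulr_gt0 ?ltr0n.
pose e := Num.min (e' / 7680) (Num.min (prev / 4) (2 * D)^-1).
have e0 : 0 < e by rewrite !lt_min !divr_gt0 ?ltr0n//= invr_gt0 mulr_gt0.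
have [ee ep eD] : [/\ e <= e' / 7680, e <= prev / 4 & e <= (2 * D)^-1].
  by rewrite /e !ge_min !lexx !orbT.
have [beta' netP] := q_dense pq J (divr_gt0 e0 (ltr0n R 8)).
pose Jp := (2 ^ beta')%N.
have [s1 s10 sP] := plane_sep Jp.
pose s := Num.min s1 e.
have s0 : 0 < s by rewrite lt_min s10.
have z0 : 0 < slack (n:=n) J * s / 20 by rewrite divr_gt0 ?ltr0n// mulr_gt0// slack_gt0.
have [t t0 tP] := modulus_upper n_ge1 pq J1 z0.
have K0 := @scale_gt0 R n J.
exists (Num.min (e / (scale (n:=n) J)%:R) (t / (24 * N))).
  by rewrite lt_min !divr_gt0// mulr_gt0 ?ltr0n.
move=> h hk; rewrite le_min => /andP[h1 h2].
exists e', e, s, Jp, t, B; split.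
- exact: ce'.
- exact: e'J.
- exact: e0.
- by move: ee; rewrite ler_pdivlMr ?ltr0n// mulrC.
- by move=> k kJ; apply: le_trans (hk k kJ); rewrite mulrC -ler_pdivlMr ?ltr0n.
- exact: s0.
- by rewrite /s ge_min lexx orbT.
- by move=> i j iJ jJ ij; apply: le_lt_trans (sP i j iJ jJ ij); rewrite /s ge_min lexx.
- move=> y yI; have [b [/andP[Jb bb] bP]] := netP y yI; exists b; split => //.
  by apply: leqW; rewrite leq_exp2l.
- by move: h1; rewrite ler_pdivlMr// mulrC.
- by move: h2; rewrite ler_pdivlMr ?mulr_gt0 ?ltr0n// mulrC.
- exact: tP.
- exact: B0.
- have -> : 9600 * N * e * B * J.+1%:R = e * D by rewrite /D; ring.
  apply: le_lt_trans (_ : (2 * D)^-1 * D < 1); first by rewrite ler_pM2r.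
  by rewrite invfM -mulrA mulVf ?gt_eqF// mulr1 invf_lt1// ltr1n.
- exact: BP.
Qed.

End Stages.

(** * Existence of the centres and of the sizes *)

(** Each value is chosen in its interval off the finitely many earlier ones. *)
Lemma distinct_points {R : realType} (l u : nat -> R) : (forall j, l j < u j) ->
  exists f : nat -> R, (forall j, l j < f j < u j) /\ injective f.
Proof.
move=> lu; have /choice[P PP] : forall p : nat * seq R, exists x, l p.1 < x < u p.1 /\ x \notin p.2.
  move=> [j s] /=; have [x x1 x2] := avoid_countable (nth 0 s) (lu j); exists x; split => //.
  by apply/negP => /(nthP 0)[i _ e]; have := x2 i; rewrite e eqxx.
pose past j := iter j (fun s => rcons s (P (size s, s))) [::].
have size_past j : size (past j) = j by elim: j => //= j ih; rewrite size_rcons ih.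
pose f j := P (j, past j).
have f_past i j : (i < j)%N -> f i \in past j.
  elim: j => // j ih; rewrite ltnS leq_eqVlt /= mem_rcons inE size_past => /predU1P[->|/ih ->].
    by rewrite eqxx.
  by rewrite orbT.
exists f; split=> [j|]; first exact: (PP (j, past j)).1.
have neq i j : (i < j)%N -> f i <> f j.
  by move=> /f_past fi e; have := (PP (j, past j)).2; rewrite /= -/(f j) -e fi.
move=> i j e; case: (ltngtP i j) => // [/neq|/neq/nesym]; by case.
Qed.

Section Existence.
Context {R : realType} {n : nat}.
Local Notation N := (n.+1%:R : R).
Local Notation vec := 'rV[R]_n.+1.
Local Notation second := (@second n).

(** The points of the grids are enumerated so that each occurs infinitely often: the 2-adic
    valuation of b takes every value for arbitrarily large b. *)
Definition target (b : nat) : vec := if unpickle (logn 2 b) is Some (M, s)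
  then \row_(k < n.+1) Num.min 1 ((nth 0%N s k)%:R / (M : nat).+1%:R) else 0.

Lemma target_itv b k : 0 <= target b 0 k <= 1.
Proof.
rewrite /target; case: (unpickle _) => [[M s]|]; rewrite mxE ?lexx ?ler01//.
by rewrite le_min ler01 divr_ge0//= ge_min lexx.
Qed.

Lemma target_dense (M beta : nat) : exists beta', forall y : vec, (forall k, 0 <= y 0 k <= 1) ->
  exists b, (beta <= b < beta')%N /\ `|target b - y| <= M.+1%:R^-1.
Proof.
pose code (v : {ffun 'I_n.+1 -> 'I_M.+2}) : nat * seq nat := (M, [seq val (v k) | k <- enum 'I_n.+1]).
pose b v := (2 ^ pickle (code v) * (2 * beta).+1)%N.
exists (\max_v b v).+1 => y yI.
have M0 : (0 : R) < M.+1%:R by rewrite ltr0n.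
pose v := [ffun k => inord (Num.truncn (y 0 k * M.+1%:R)) : 'I_M.+2].
exists (b v); split.
  rewrite ltnS leq_bigmax andbT /b; apply: (@leq_trans (2 * beta).+1); first by lia.
  by apply: leq_pmull; rewrite expn_gt0.
have lb : logn 2 (b v) = pickle (code v).
  rewrite /b lognM ?expn_gt0// pfactorK// [X in (_ + X)%N]logn_coprime ?addn0//.
  by rewrite coprime2n /= mul2n odd_double.
rewrite /target lb pickleK /code; apply: dist_le_coord => [|k]; first by rewrite invr_ge0 ltW.
have /andP[y0 y1] := yI k.
have ym : 0 <= y 0 k * M.+1%:R by rewrite mulr_ge0// ltW.
have /andP[t1 t2] := truncn_itv ym.
have vk : v k = Num.truncn (y 0 k * M.+1%:R) :> nat.
  rewrite ffunE inordK// ltnS -(ler_nat R); apply: le_trans t1 _.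
  by rewrite -[leRHS]mul1r ler_pM2r.
rewrite mxE (nth_map k) ?size_enum_ord// nth_ord_enum /= vk.
move: t1 t2; rewrite -[(Num.truncn _).+1%:R]natr1; move: (Num.truncn _)%:R => T t1 t2.
have T1 : T / M.+1%:R <= y 0 k by rewrite ler_pdivrMr.
have T2 : y 0 k < T / M.+1%:R + M.+1%:R^-1.
  by rewrite -[X in _ < _ + X]mul1r -mulrDl ltr_pdivlMr.
rewrite (min_idPr (le_trans T1 y1)).
by move: T1 T2; move: (T / M.+1%:R) (M.+1%:R^-1) => a c *; rewrite ler_norml; apply/andP; split; lra.
Qed.

Lemma placement_exists (n_ge1 : (1 <= n)%N) : exists q : nat -> vec, placement q.
Proof.
pose blk j := trunc_log 2 j.+1.
pose lo j k := Num.max 0 (target (blk j) 0 k - (blk j).+1%:R^-1).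
pose hi j k := Num.min 1 (target (blk j) 0 k + (blk j).+1%:R^-1).
have lohi j k : lo j k < hi j k.
  have r0 : (0 : R) < (blk j).+1%:R^-1 by rewrite invr_gt0 ltr0n.
  have /andP[] := target_itv (blk j) k; rewrite /lo /hi.
  by move: (target _ _ _) (_^-1) r0 => T r *; rewrite gt_max !lt_min; apply/andP; split; apply/andP; split; lra.
have [f [fI finj]] := distinct_points (fun j => lohi j 0).
have /choice[g gP] : forall p : nat * 'I_n.+1, exists x, lo p.1 p.2 < x < hi p.1 p.2 /\ x != 2^-1.
  move=> [j k] /=; have [x x1 x2] := avoid_countable (fun=> 2^-1) (lohi j k).
  by exists x; split => //; exact: (x2 0%N).
pose q j : vec := \row_k if k == 0 then f j else g (j, k).
have qI j k : lo j k < q j 0 k < hi j k.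
  by rewrite mxE; case: eqP => [->|_]; [exact: fI|exact: (gP (j, k)).1].
exists q; split.
- move=> j k; have := qI j k; rewrite /lo /hi gt_max lt_min => /andP[/andP[-> _] /andP[-> _]].
  by [].
- by move=> i j; rewrite !mxE eqxx; exact: finj.
- move=> j; rewrite mxE ifN; first exact: (gP (j, _)).2.
  exact: second_neq0.
move=> e beta e0; have [M hM] := invS_small (divr_gt0 e0 (ltr0n R 2)).
have [beta' H] := target_dense M (beta + M); exists beta' => y yI.
have [b [/andP[b1 b2] yb]] := H y yI; exists b; split; first by rewrite b2 andbT; lia.
move=> j jb; have bj : blk j = b by apply: trunc_log_eq.
have r1 : b.+1%:R^-1 <= M.+1%:R^-1 :> R.
  by rewrite lef_pV2 ?posrE ?ltr0n// ler_nat; lia.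
apply: dist_le_coord => [|k]; first exact: ltW.
have := le_trans (coord_dist _ _ k) yb.
have := qI j k; rewrite /lo /hi bj gt_max lt_min => /andP[/andP[_ +] /andP[_ +]].
rewrite !ler_norml => a1 a2 /andP[a3 a4].
move: r1 hM a1 a2 a3 a4; move: (b.+1%:R^-1) (M.+1%:R^-1) => *.
by apply/andP; split; lra.
Qed.

Lemma size_bound (q : nat -> vec) (pq : placement q) j : exists2 b : R, 0 < b & forall x, x <= b ->
  [/\ forall i, (i < j)%N -> 16 * N * x < `|q i 0 0 - q j 0 0|,
      forall k, 16 * N * x < q j 0 k < 1 - 16 * N * x & x < `|q j 0 second - 2^-1|].
Proof.
have [s s0 sP] := plane_sep pq j.+1.
pose F (k : 'I_n.+1) : R := Num.min (q j 0 k) (1 - q j 0 k).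
have F0 k : 0 < F k.
  by have /andP[? ?] := q_box pq j k; rewrite lt_min subr_gt0; apply/andP.
have [a a0 aP] := finite_lower F0.
pose b := Num.min (s / (16 * N)) (a / (16 * N)).
have d0 : 0 < `|q j 0 second - 2^-1| by rewrite normr_gt0 subr_eq0; exact: q_half.
have N0 : 0 < 16 * N by rewrite mulr_gt0 ?ltr0n.
exists (Num.min (`|q j 0 second - 2^-1| / 2) b).
  by rewrite !lt_min !divr_gt0.
move=> x; rewrite !le_min !ler_pdivlMr// => /and3P[xh xs xa]; rewrite mulrC in xs; rewrite mulrC in xa.
split=> [i ij|k|].
- by apply: le_lt_trans xs _; apply: sP; rewrite ?ltnS ?(ltnW ij)// ltn_eqF.
- by have := aP k; rewrite /F lt_min => /andP[? ?]; apply/andP; split; lra.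
- by move: d0 xh; move: (`|_|) => *; lra.
Qed.

(** The size of slit j is determined by j and the preceding size, through size_bound and
    stage_exists. *)
Lemma sizes_exist (n_ge1 : (1 <= n)%N) (q : nat -> vec) (pq : placement q) : exists h, sizes q h /\
  forall J, exists e' e s Jp t B, stage n_ge1 pq h J e' e s Jp t B.
Proof.
have /choice[g gP] : forall p : nat * R, exists b : R, 0 < p.2 -> [/\ 0 < b, 8 * b <= p.2,
    [/\ forall i, (i < p.1)%N -> 16 * N * b < `|q i 0 0 - q p.1 0 0|,
      forall k, 16 * N * b < q p.1 0 k < 1 - 16 * N * b & b < `|q p.1 0 second - 2^-1|] &
    forall h : nat -> R, (forall k, (k < p.1)%N -> p.2 <= h k) -> h p.1 = b ->
      exists e' e s Jp t B, stage n_ge1 pq h p.1 e' e s Jp t B].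
  move=> [j prev] /=; have [p0|_] := ltP 0 prev; last by exists 0.
  have [b1 b10 b1P] := size_bound pq j; have [b2 b20 b2P] := stage_exists n_ge1 pq j p0.
  exists (Num.min (prev / 8) (Num.min b1 b2)) => _; split.
  - by rewrite !lt_min divr_gt0 ?b10.
  - by rewrite mulrC -ler_pdivlMr ?ltr0n// ge_min lexx.
  - by apply: b1P; rewrite !ge_min lexx !orbT.
  - by move=> h hk hj; apply: b2P => //; rewrite hj !ge_min lexx !orbT.
have [h hE] : exists h : nat -> R, forall j, h j = g (j, if j is i.+1 then h i else 1).
  by exists (fix h j := g (j, if j is i.+1 then h i else 1)); case.
have g0 j p : 0 < p -> 0 < g (j, p) by move=> p0; have [] := gP (j, p) p0.
have h0 j : 0 < h j by elim: j => [|j ih]; rewrite hE; exact: g0.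
have prev0 j : 0 < (if j is i.+1 then h i else 1) by case: j => [|j]; [exact: ltr01|exact: h0].
have step j : 8 * h j <= if j is i.+1 then h i else 1.
  by have [_ + _ _] := gP (j, _) (prev0 j); rewrite /= -hE.
have fine j : [/\ forall i, (i < j)%N -> 16 * N * h j < `|q i 0 0 - q j 0 0|,
    forall k, 16 * N * h j < q j 0 k < 1 - 16 * N * h j & h j < `|q j 0 second - 2^-1|].
  by have [_ _ + _] := gP (j, _) (prev0 j); rewrite /= -hE.
have anti i j : (i <= j)%N -> h j <= h i.
  elim: j => [|j ih]; first by rewrite leqn0 => /eqP ->.
  rewrite leq_eqVlt => /predU1P[->//|]; rewrite ltnS => /ih.
  by have := step j.+1; have := h0 j.+1; rewrite /=; lra.
exists h; split.
  split; first exact: h0.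
  - by have := step 0%N; rewrite /=; lra.
  - by move=> j; exact: (step j.+1).
  - by move=> i j; have [H _ _] := fine j; exact: H.
  - by move=> j; have [_ H _] := fine j.
  - by move=> j; have [] := fine j.
move=> J; have [_ _ _] := gP (J, _) (prev0 J); rewrite /= -hE; apply => //.
by case: J => // J k; rewrite ltnS; exact: anti.
Qed.

End Existence.

(** * What a weakly quasisymmetric map does at a stage *)

Lemma clamp_props {R : realFieldType} (w c r d : R) : 0 <= r -> `|w - c| <= r + d -> 0 <= d ->
  let z := Num.max (c - r) (Num.min (c + r) w) in
  [/\ `|z - c| <= r, `|z - c| <= `|w - c| & `|z - w| <= d].
Proof.
move=> r0 wc d0 /=.
have [h1|h1] := leP w (c + r); have [h2|h2] := leP (c - r) w.
- rewrite subrr normr0; split => //.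
  by rewrite ler_norml; apply/andP; split; lra.
- have a : w - c < 0 by lra.
  rewrite (ltr0_norm a) in wc *; split; rewrite ler_norml; apply/andP; split; lra.
- have e : Num.max (c - r) (c + r) = c + r by apply/max_idPr; lra.
  rewrite e.
  have a : 0 < w - c by lra.
  by rewrite (gtr0_norm a) in wc *; split; rewrite ler_norml; apply/andP; split; lra.
- by lra.
Qed.

Lemma spread_real {R : realFieldType} (J1 Dl B D nn e : R) : 1 <= J1 * Dl -> Dl <= B * D ->
  9600 * nn * e * B * J1 < 1 -> 0 < B -> 0 < J1 -> 9600 * nn * e < D.
Proof.
move=> h1 h2 h3 B0 J0; have BJ : 0 < B * J1 by rewrite mulr_gt0.
rewrite -(ltr_pM2r BJ) mulrA; apply: lt_le_trans h3 _; apply: le_trans h1 _.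
rewrite mulrC mulrA [D * B]mulrC; exact: ler_wpM2r (ltW J0) _ _ h2.
Qed.

Lemma slit_const {R : realFieldType} n : 4 * n.+1%:R + 8 <= 24 * n.+1%:R :> R.
Proof. have h1 : 1 <= n.+1%:R :> R by rewrite ler1n. by lra. Qed.

Lemma too_small {R : realFieldType} (k k2 g d s h : R) : k * g < d -> d <= 2 * (k2 * s / 20) ->
  k2 * s <= k * (h / 4) -> k * (h / 3) <= k * g -> 0 < k * h -> False.
Proof. by move=> *; lra. Qed.

Section At.
Context {R : realType} {n : nat}.
Local Notation N := (n.+1%:R : R).
Local Notation vec := 'rV[R]_n.+1.
Variables (q : nat -> vec) (h : nat -> R).
Hypotheses (n_ge1 : (1 <= n)%N) (pq : placement q) (sh : sizes q h).
Local Notation gen := (gen q).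
Local Notation X := (slit_space (@slit_space_cvg _ _ _ _ n_ge1 pq sh)).
Local Notation pt := (pt n_ge1 pq sh).
Local Notation opening := (opening q h).

(** The lower bound passes to the limit. *)
Lemma far_extend (F : vec -> vec) (G : X -> vec) (c : vec) (d : R) :
  (forall p u, gen u -> `|G p - F u| <= 2 * mdist p (pt u)) ->
  (forall u, gen u -> d <= `|F u - c|) -> forall p, d <= `|G p - c|.
Proof.
move=> GF Fd p; rewrite leNgt; apply/negP => lt.
have d0 : 0 < (d - `|G p - c|) / 4 by rewrite divr_gt0// subr_gt0.
have [u gu pu] := gen_dense p d0.
have h1 : `|G p - F u| <= 2 * ((d - `|G p - c|) / 4).
  by apply: le_trans (GF p u gu) _; rewrite ler_pM2l.
have h2 := Fd u gu; have h3 := ler_distD (G p) (F u) c; rewrite (distrC (F u) (G p)) in h3.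
clear pu; lra.
Qed.

Lemma opening_dist k (u : vec) : `|opening k u - u| <= 2^-1 * h k.
Proof.
have hk := h_gt0 sh k; have b0 := bump_ge0 q h k u.
have bh : bump q h k u <= h k by rewrite /bump ge_max (ltW hk) gerBl normr_ge0.
apply: dist_le_coord => [|i]; first by rewrite mulr_ge0// ltW.
have [->|i0] := eqVneq i 0; last by rewrite openingN// subrr normr0 mulr_ge0// ltW.
rewrite opening0 addrC addKr; have [[_ ->]|[_ ->]] := sideP q k u.
  by rewrite ler_norml; apply/andP; split; lra.
by rewrite ler_norml; apply/andP; split; lra.
Qed.

Section Shrink.
Variables (J Jp : nat) (e' e s t B : R) (f : X -> X).
Hypotheses (st : stage n_ge1 pq h J e' e s Jp t B) (fH : wqs f (4 * N) J.+1%:R).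

Let e0 := st_e0 st.
Let s0 := st_s0 st.
Let K0 := @slack_gt0 R n J.

Lemma tame_le a b : gen a -> mdist (pt a) b <= t ->
  mdist (f (pt a)) (f b) <= slack (n:=n) J * s / 20.
Proof. by move=> ga; exact: (st_tame st fH). Qed.

Lemma slack_le1 : slack (n:=n) J <= 1 :> R.
Proof.
by have := slack_le J (R:=R) (n:=n); have := scale_inv_le J (R:=R) (n:=n); lra.
Qed.

Lemma tame_value : 0 < slack (n:=n) J * s / 20 /\ slack (n:=n) J * s / 20 <= e / 16.
Proof.
have h1 : slack (n:=n) J * s <= 1 * s by apply: ler_wpM2r; [exact: ltW|exact: slack_le1].
have h2 : 0 < slack (n:=n) J * s by exact: mulr_gt0.
by have h3 := st_se st; have h4 := e0; split; lra.
Qed.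

(** The diameter of slit i is below the modulus t, since h_i <= h_J. *)
Lemma slit_shrinks i a b : (J <= i)%N -> gen a -> gen b -> near_slit q h i a -> near_slit q h i b ->
  mdist (f (pt a)) (f (pt b)) <= slack (n:=n) J * s / 20.
Proof.
move=> Ji ga gb na nb; apply: tame_le => //.
apply: le_trans (near_slit_dist n_ge1 pq sh ga gb na nb) _; apply: le_trans (st_ht st).
apply: le_trans (_ : 24 * N * h i <= _).
  apply: ler_wpM2r; first exact: ltW (h_gt0 sh i).
  exact: slit_const.
by apply: ler_wpM2l; [rewrite mulr_ge0|exact: (h_anti sh)].
Qed.

(** A slit whose image is larger than a fixed fraction of its distance to c must have its
    image very close to c, because this image is small. *)
Lemma shrunk (G : X -> vec) c i a b : (J <= i)%N -> gen a -> gen b ->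
  near_slit q h i a -> near_slit q h i b -> (forall p r, `|G p - G r| <= 2 * mdist p r) ->
  slack (n:=n) J * `|G (f (pt a)) - c| < `|G (f (pt a)) - c - (G (f (pt b)) - c)| ->
  `|G (f (pt a)) - c| < s / 10.
Proof.
move=> Ji ga gb na nb Gl; rewrite opprB addrA subrK => lt.
rewrite -(ltr_pM2l K0); apply: lt_le_trans lt _; apply: le_trans (Gl _ _) _.
have -> : slack (n:=n) J * (s / 10) = 2 * (slack (n:=n) J * s / 20) by field.
by rewrite ler_pM2l// (slit_shrinks Ji).
Qed.

End Shrink.

Section Stage.
Variables (J Jp : nat) (e' e s t B : R) (f : X -> X) (x : vec).
Hypotheses (st : stage n_ge1 pq h J e' e s Jp t B) (fH : wqs f (4 * N) J.+1%:R)
  (big : 1 <= J.+1%:R * mdist (f (pt (middle : vec))) (f (pt off_middle)))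
  (gx : gen x) (dx : deep q J e' x).

Let e0 := st_e0 st.
Let s0 := st_s0 st.
Let e'0 : 0 < e'. Proof. by have [] := st_clear st. Qed.
Let K0 := @slack_gt0 R n J.

(** The lower modulus at this stage, combined with the lower bound on the distance of the two
    reference images. *)
Lemma far_apart b : e' / 2 <= mdist (pt x) b -> 9600 * N * e < mdist (f (pt x)) (f b).
Proof.
move=> /(st_spread st fH gx) D1; have D2 := st_B st; have B0 := st_B0 st.
have J0 : (0 : R) < J.+1%:R by rewrite ltr0n.
exact: spread_real big D1 D2 B0 J0.
Qed.

Lemma stage_puncture (k : nat) (w c : vec) (G : X -> vec) (rho r0 : R) : gen w ->
  e <= rho -> rho <= 240 * e -> 0 < r0 ->
  (forall p u, gen u -> `|G p - opening k u| <= 2 * mdist p (pt u)) ->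
  isolated q h k J (32 * rho) w -> mdist (f (pt x)) (pt w) <= e / 16 ->
  `|G (f (pt x)) - c| <= rho / 4 -> (forall p, r0 <= `|G p - c|) ->
  exists i a b, [/\ (J <= i)%N, gen a & gen b] /\ [/\ near_slit q h i a,
    near_slit q h i b, mdist (pt x) (pt a) < e' / 2 &
    slack (n:=n) J * `|G (f (pt a)) - c| < `|G (f (pt a)) - c - (G (f (pt b)) - c)|].
Proof.
move=> gw r1 r2 r00 GP iso yw yc far; have hJ := h_gt0 sh J.
have er : e / 16 <= rho / 16 by lra.
have N0 : 0 < N by rewrite ltr0n.
have bnd : 40 * N * rho <= 9600 * N * e.
  have : N * rho <= N * (240 * e) by rewrite ler_pM2l.
  by lra.
apply: (puncture gx gw dx e'0 fH (lt_le_trans e0 r1) r00 GP iso (le_trans yw er) yc far (st_ht st) (le_trans (st_h st) r1)).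
- by move=> b /(tame_le st fH gx)/le_trans; apply; apply: le_trans (tame_value st).2 er.
- by move=> b /far_apart; exact: le_lt_trans.
Qed.


(** If the image of x were near slit k, there would be a point c of the opened hole at a
    distance of order e from it, and deep enough in the hole to be at distance e from the
    image of the opening. By puncture some slit of index at least J would have a large image,
    in contradiction to shrunk. *)
Lemma avoids_plates k (w : vec) : gen w -> mdist (f (pt x)) (pt w) <= e / 16 -> (k < J)%N ->
  ~ near_plate q h k (32 * e) w.
Proof.
move=> gw yw kJ [w0 wi].
have [G GP] := lip_extend (opening_lip n_ge1 pq sh k).
have eh := st_eh st kJ; have ep := e0.
(* The centre c is w truncated to the slit reduced by 3 e, in all the coordinates along the
   slit, and its height leaves 3 e / 2 to the boundary of the hole. *)
pose r0 := h k - 3 * e; have r00 : 0 <= r0 by rewrite /r0; lra.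
pose r := Num.min r0 `|w - q k|.
have rn : 0 <= r by rewrite le_min r00 normr_ge0.
pose c : vec := \row_i if i == 0 then q k 0 0 + 2^-1 * (side q k w * (h k - r - 3 * e))
  else Num.max (q k 0 i - r0) (Num.min (q k 0 i + r0) (w 0 i)).
have ci i : i != 0 -> `|c 0 i - q k 0 i| <= r /\ `|c 0 i - w 0 i| <= 35 * e.
  move=> i0; have wr : `|w 0 i - q k 0 i| <= r0 + 35 * e.
    by have := wi i i0; rewrite /r0; lra.
  have [h1 h2 h3] := clamp_props r00 wr (ltac:(lra) : 0 <= 35 * e).
  rewrite mxE (negbTE i0) le_min h1; split => //.
  exact: le_trans h2 (coord_dist w (q k) i).
have c0 : c 0 0 = q k 0 0 + 2^-1 * (side q k w * (h k - r - 3 * e)) by rewrite mxE eqxx.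
have rb : 0 <= h k - r - 3 * e by rewrite /r; have := ge_min r0 r0 `|w - q k|; rewrite lexx /= /r0; lra.
have far : forall p, e <= `|G p - c|.
  apply: (far_extend GP) => u gu; apply: (opening_margin u e0 _ rn) => [i i0|].
    exact: (ci i i0).1.
  rewrite (_ : c 0 0 - q k 0 0 = 2^-1 * (side q k w * (h k - r - 3 * e))); last by rewrite c0 addrC addKr.
  have -> : `|2^-1 * (side q k w * (h k - r - 3 * e))| = 2^-1 * (h k - r - 3 * e).
    have [[_ ->]|[_ ->]] := sideP q k w; rewrite ?mulN1r ?mulrN ?normrN ?mul1r ger0_norm//;
      by rewrite mulr_ge0.
  by lra.
have oc : `|opening k w - c| <= 35 * e.
  apply: dist_le_coord => [|i]; first by lra.
  have [->|i0] := eqVneq i 0; last by rewrite openingN// distrC; exact: (ci i i0).2.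
  rewrite opening0 c0; have bumpE : 0 <= bump q h k w - (h k - r - 3 * e) <= 3 * e.
    rewrite /bump /r /r0; have [le|lt] := leP (h k - 3 * e) `|w - q k|.
      by have [z|z] := leP 0 (h k - `|w - q k|); apply/andP; split; lra.
    by rewrite (max_idPr _); [apply/andP; split; lra|lra].
  move: w0 bumpE; rewrite !ler_norml => /andP[? ?] /andP[? ?].
  by have [[_ ->]|[_ ->]] := sideP q k w; apply/andP; split; lra.
have [e'p e'1 e'q e'g] := st_clear st; have ee := st_ee' st.
have iso : isolated q h k J (32 * (240 * e)) w.
  move=> i iJ ik; have g := e'g i k iJ kJ ik; split=> [[near0 _]|_]; last by lra.
  have := ler_distD (w 0 0) (q i 0 0) (q k 0 0); rewrite (distrC (q i 0 0) (w 0 0)).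
  by lra.
have yc : `|G (f (pt x)) - c| <= 240 * e / 4.
  have h1 : `|G (f (pt x)) - opening k w| <= 2 * (e / 16).
    by apply: le_trans (GP _ _ gw) _; rewrite ler_pM2l.
  have h2 := ler_distD (opening k w) (G (f (pt x))) c.
  by move: h1 h2 oc ep; clear yw GP; move: (`|_|) (`|_|) (`|_|) => *; lra.
have [i [a [b [[Ji ga gb] [na nb _ bad]]]]] :=
  stage_puncture gw (ltac:(lra) : e <= 240 * e) (lexx _) e0 GP iso yw yc far.
have := shrunk st fH Ji ga gb na nb (extend_lip GP) bad.
by have := far (f (pt a)); have := st_se st; have := s0; clear bad yw GP; lra.
Qed.

Variable P : X -> vec.
Hypothesis PP : forall p u, gen u -> `|P p - u| <= 2 * mdist p (pt u).

Lemma opened_coord j (G : X -> vec) p : (forall p u, gen u -> `|G p - opening j u| <= 2 * mdist p (pt u)) ->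
  `|P p - q j| <= `|G p - q j| + 2^-1 * h j.
Proof.
move=> GP; apply/ler_addgt0Pr => d d0.
have [u gu pu] := gen_dense p (divr_gt0 d0 (ltr0n R 4)).
have h1 : `|P p - u| <= 2 * (d / 4) by apply: le_trans (PP _ gu) _; rewrite ler_pM2l.
have h2 : `|G p - opening j u| <= 2 * (d / 4) by apply: le_trans (GP _ _ gu) _; rewrite ler_pM2l.
have h3 := opening_dist j u.
have h4 := ler_distD u (P p) (q j); have h5 := ler_distD (opening j u) u (q j).
have h6 := ler_distD (G p) (opening j u) (q j).
rewrite (distrC u (opening j u)) in h5; rewrite (distrC (opening j u) (G p)) in h6.
by clear pu GP; lra.
Qed.

(** The opening of slit j itself has a hole at q_j, and no other slit is visible at the scale
    e by avoids_plates. The slit i found by puncture cannot be later than j: at the next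
    stage such slits have images smaller than h_j, while all images keep the distance h_j / 3
    from q_j. *)
Lemma caught j (w : vec) e2' e2 s2 Jp2 t2 B2 : stage n_ge1 pq h j.+1 e2' e2 s2 Jp2 t2 B2 ->
  wqs f (4 * N) j.+2%:R ->
  (J <= j)%N -> gen w -> mdist (f (pt x)) (pt w) <= e / 32 -> `|q j - w| <= e / 8 ->
  exists i a, [/\ (J <= i <= j)%N, gen a & near_slit q h i a] /\
    [/\ mdist (pt x) (pt a) < e' / 2 & `|P (f (pt a)) - q j| <= s / 4].
Proof.
move=> st2 fH2 Jj gw yw jw; have [G GP] := lip_extend (opening_lip n_ge1 pq sh j).
have hj := h_gt0 sh j; have ep := e0.
have hJe : h j <= e / 2000.
  apply: le_trans (h_anti sh Jj) _; have := st_h st; rewrite mulrC -ler_pdivlMr ?scale_gt0//.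
  move=> /le_trans; apply; apply: ler_wpM2l; [exact: ltW|exact: scale_inv_le].
have far : forall p, h j / 3 <= `|G p - q j|.
  apply: (far_extend GP) => u gu; apply: (opening_margin u _ _ (lexx 0)); first by rewrite divr_gt0.
    by move=> i _; rewrite subrr normr0.
  by rewrite subrr normr0; lra.
have iso : isolated q h j J (32 * e) w.
  move=> i iJ ij; split; last by rewrite ltnNge Jj.
  by apply: avoids_plates => //; apply: le_trans yw _; lra.
have yc : `|G (f (pt x)) - q j| <= e / 4.
  have h1 : `|G (f (pt x)) - opening j w| <= 2 * (e / 32).
    by apply: le_trans (GP _ _ gw) _; rewrite ler_pM2l.
  have h2 := ler_distD (opening j w) (G (f (pt x))) (q j); have h3 := opening_dist j w.
  have h4 := ler_distD w (opening j w) (q j); rewrite (distrC w (q j)) in h4.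
  by clear yw GP; lra.
have yw16 : mdist (f (pt x)) (pt w) <= e / 16 by apply: le_trans yw _; lra.
have [i [a [b [[Ji ga gb] [na nb xa bad]]]]] :=
  stage_puncture gw (lexx e) (ltac:(lra) : e <= 240 * e) (divr_gt0 hj (ltr0n R 3)) GP iso yw16 yc far.
have fa := far (f (pt a)).
have sh10 := shrunk st fH Ji ga gb na nb (extend_lip GP) bad.
have [ij|ji] := leqP i j.
  exists i, a; split; [by rewrite Ji|split => //].
  apply: le_trans (opened_coord (f (pt a)) GP) _.
  by clear xa yw yw16 bad GP; lra.
have lt : `|G (f (pt a)) - q j - (G (f (pt b)) - q j)| <= 2 * (slack (n:=n) j.+1 * s2 / 20).
  rewrite opprB addrA subrK; apply: le_trans (extend_lip GP _ _) _.
  rewrite ler_pM2l//; exact: (slit_shrinks st2 fH2 ji ga gb na nb).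
have sl := slack_anti (R := R) (n := n) (leq_trans Jj (leqnSn j)).
have s2h : s2 <= h j / 4.
  by apply: le_trans (st_se st2) _; rewrite ler_pdivlMr ?ltr0n// mulrC; exact: (st_eh st2 (ltnSn j)).
have s20 := st_s0 st2; have k0 := @slack_gt0 R n j.+1.
have l1 : slack (n:=n) j.+1 * s2 <= slack (n:=n) J * (h j / 4) by apply: ler_pM => //; exact: ltW.
have l2 : slack (n:=n) J * (h j / 3) <= slack (n:=n) J * `|G (f (pt a)) - q j| by rewrite ler_pM2l.
have l3 : 0 < slack (n:=n) J * h j by rewrite mulr_gt0.
by case: (too_small bad lt l1 l2 l3).
Qed.

End Stage.
End At.

(** * Deep points are almost fixed *)

Lemma wqs_mono {R : realType} {T : metricType R} (f : T -> T) (L H H' : R) : H <= H' ->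
  wqs f L H -> wqs f L H'.
Proof.
move=> HH fH a b c abc; apply: le_trans (fH a b c abc) _.
by apply: ler_wpM2r => //; exact: mdist_ge0.
Qed.

Lemma close_coords {R : realFieldType} (xa aq qw xw e' e h : R) : xw <= xa + (aq + qw) ->
  xa < e' / 2 -> aq <= 2 * h -> qw <= e / 8 -> h <= e / 2000 -> 7680 * e <= e' -> 0 < e -> xw < e'.
Proof. by move=> *; lra. Qed.

Lemma sum_small {R : realFieldType} (xw e' e nn h yw D : R) : 0 <= nn -> xw < e' ->
  h <= e / 2000 -> 7680 * e <= e' -> 0 < e -> yw <= e / 32 -> D <= nn * xw + 8 * h ->
  D + yw <= (nn + 1) * e'.
Proof.
move=> n0 xe he ee e0 ye De; have : nn * xw <= nn * e' by apply: ler_wpM2l => //; exact: ltW.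
by rewrite mulrDl mul1r; lra.
Qed.

Lemma both_near {R : realFieldType} (qq pq pq' pp s k : R) : qq <= pq + (pp + pq') -> pq <= s / 4 ->
  pq' <= s / 4 -> pp <= 2 * (k * s / 20) -> k <= 1 -> 0 < s -> s < qq -> False.
Proof.
move=> h1 h2 h3 h4 k1 s0 h5; have : k * s <= 1 * s by apply: ler_wpM2r => //; exact: ltW.
by lra.
Qed.

Lemma block_below (m j p : nat) : (2 * m.+1 <= p.+1)%N -> (j <= m + m)%N -> (j < p)%N.
Proof. lia. Qed.

Lemma block_range (m j : nat) : (m <= j)%N -> (j <= m + m)%N -> (m.+1 <= j.+1 < 2 * m.+1)%N.
Proof. lia. Qed.

Lemma block_index (m : nat) (l : 'I_m.+1) : (m <= m + l <= m + m)%N.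
Proof. by rewrite leq_addr leq_add2l -ltnS ltn_ord. Qed.

Section Identity.
Context {R : realType} {n : nat}.
Local Notation N := (n.+1%:R : R).
Local Notation vec := 'rV[R]_n.+1.
Variables (q : nat -> vec) (h : nat -> R).
Hypotheses (n_ge1 : (1 <= n)%N) (pq : placement q) (sh : sizes q h).
Hypothesis (stages : forall J, exists e' e s Jp t B, stage n_ge1 pq h J e' e s Jp t B).
Local Notation gen := (gen q).
Local Notation X := (slit_space (@slit_space_cvg _ _ _ _ n_ge1 pq sh)).
Local Notation pt := (pt n_ge1 pq sh).

Lemma id_lip u v : gen u -> gen v -> `|u - v| <= 2 * mdist (pt u) (pt v).
Proof.
move=> gu gv; apply: le_trans (pt_norm_le n_ge1 pq sh (gen_free h gu) (gen_free h gv)) _.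
by apply: scale_le; [rewrite ler1n|exact: mdist_ge0].
Qed.

(** The net gives a block of centres near f x. Each j in the block yields a slit i with J <=
    i <= j whose image is close to q_j. If no such i belonged to the block, two indices j
    would share the same i, and the small image of this slit would be close to two centres on
    distant planes. A slit i of the block is close to f x, as its centre is, and to x. *)
Lemma near_identity J Jp e' e s t B (f : X -> X) x : stage n_ge1 pq h J e' e s Jp t B ->
  wqs f (4 * N) J.+1%:R ->
  1 <= J.+1%:R * mdist (f (pt (middle : vec))) (f (pt off_middle)) ->
  gen x -> deep q J e' x -> mdist (pt x) (f (pt x)) <= (N + 1) * e'.
Proof.
move=> st fH big gx dx; have e0 := st_e0 st; have ee := st_ee' st.
have hJe : h J <= e / 2000.
  have := st_h st; rewrite mulrC -ler_pdivlMr ?scale_gt0// => /le_trans; apply.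
  by apply: ler_wpM2l; [exact: ltW|exact: scale_inv_le].
have [P PP] := lip_extend id_lip.
have [w gw yw] := gen_dense (f (pt x)) (divr_gt0 e0 (ltr0n R 32)).
have w01 k : 0 <= w 0 k <= 1 by have /andP[? ?] := gw.1 k; rewrite !ltW.
have [b [Jb bJp near]] := st_net st w01.
have [m mE] : exists m, (2 ^ b = m.+1)%N by exists (2 ^ b).-1; rewrite prednK// expn_gt0.
have Jm : (J <= m)%N by rewrite -ltnS -mE (leq_ltn_trans Jb)// ltn_expl.
have block j : (m <= j)%N -> (j <= m + m)%N -> `|q j - w| <= e / 8 /\ (j < Jp)%N.
  move=> mj jm; split; last by move: bJp; rewrite expnS mE => /block_below; exact.
  by apply: near; rewrite expnS mE; exact: block_range.
have good j : (m <= j)%N -> (j <= m + m)%N -> exists p : nat * vec,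
    [/\ (J <= p.1 <= j)%N, gen p.2 & near_slit q h p.1 p.2] /\
    [/\ mdist (pt x) (pt p.2) < e' / 2 & `|P (f (pt p.2)) - q j| <= s / 4].
  move=> mj jm; have [e2' [e2 [s2 [Jp2 [t2 [B2 st2]]]]]] := stages j.+1.
  have fH2 : wqs f (4 * N) j.+2%:R by apply: wqs_mono fH; rewrite ler_nat ltnS (leq_trans (leq_trans Jm mj)).
  have [i [a H]] := caught st fH big gx dx PP st2 fH2 (leq_trans Jm mj) gw yw (block j mj jm).1.
  by exists (i, a).
have finish i a : (m <= i)%N -> (i <= m + m)%N -> gen a -> near_slit q h i a ->
    mdist (pt x) (pt a) < e' / 2 -> mdist (pt x) (f (pt x)) <= (N + 1) * e'.
  move=> mi im ga na xa.
  have x1 := le_lt_trans (pt_norm_le n_ge1 pq sh (gen_free h gx) (gen_free h ga)) xa.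
  have hi : h i <= e / 2000 by apply: le_trans hJe; apply: (h_anti sh); exact: leq_trans mi.
  have xw : `|x - w| < e'.
    apply: (close_coords _ x1 na (block i mi im).1 hi ee e0).
    by apply: le_trans (ler_distD a x w) _; rewrite lerD2l ler_distD.
  have dxw : mdist (pt x) (pt w) <= N * `|x - w| + 8 * h J.
    apply: pt_dist_le => // j jJ /between_dist[bt _]; exfalso.
    have := lt_trans (dx.1 j jJ) bt; rewrite ltNge => /negP; apply.
    exact: le_trans (coord_dist x w 0) (ltW xw).
  rewrite metric_sym in yw.
  apply: le_trans (metric_triangle _ (pt w) _) _.
  exact: sum_small (ler0n R n.+1) xw hJe ee e0 yw dxw.
have /choice[r rP] : forall l : 'I_m.+1, exists p : nat * vec,
    [/\ (J <= p.1 <= m + l)%N, gen p.2 & near_slit q h p.1 p.2] /\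
    [/\ mdist (pt x) (pt p.2) < e' / 2 & `|P (f (pt p.2)) - q (m + l)%N| <= s / 4].
  by move=> l; have /andP[? ?] := block_index l; exact: good.
have [[l ml]|low] := pselect (exists l, (m <= (r l).1)%N).
  have [[/andP[_ il] ga na] [xa _]] := rP l.
  by apply: finish ml _ ga na xa; apply: leq_trans il _; have /andP[] := block_index l.
have low' l : ((r l).1 < m)%N by rewrite ltnNge; apply/negP => ?; apply: low; exists l.
pose F l : 'I_m := Ordinal (low' l).
have [l [l' [ll' Fl]]] : exists l l', l != l' /\ (r l).1 = (r l').1.
  apply: contrapT => H; have /leq_card : injective F.
    by move=> l l' /(congr1 val) /= e1; apply: contrapT => /eqP ne; apply: H; exists l, l'.
  by rewrite !card_ord ltnn.
have [[/andP[Jl _] ga na] [_ qa]] := rP l; have [[_ ga' na'] [_ qa']] := rP l'.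
rewrite -Fl in na'.
have fd : `|P (f (pt (r l).2)) - P (f (pt (r l').2))| <= 2 * (slack (n:=n) J * s / 20).
  apply: le_trans (extend_lip PP _ _) _; rewrite ler_pM2l//.
  exact: (slit_shrinks st fH Jl ga ga' na na').
have gap : s < `|q (m + l)%N 0 0 - q (m + l')%N 0 0|.
  have /andP[a1 a2] := block_index l; have /andP[a3 a4] := block_index l'.
  apply: (st_gap st); [exact: (block _ a1 a2).2|exact: (block _ a3 a4).2|].
  by rewrite eqn_add2l.
exfalso; apply: (both_near _ qa qa' fd _ (st_s0 st) (lt_le_trans gap (coord_dist _ _ 0))).
  apply: le_trans (ler_distD (P (f (pt (r l).2))) _ _) _; rewrite distrC lerD2l.
  exact: ler_distD.
exact: slack_le1.
Qed.

End Identity.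

(** * The slit space is not porous *)

Lemma porous_real {R : realFieldType} (e' A nn hi hJ e J1 : R) : e' / 2 / A <= 24 * nn * hi ->
  hi <= hJ -> 0 < hJ -> A < J1 -> 0 < A -> 0 < nn -> 2000 * nn * J1 * hJ <= e -> 7680 * e <= e' ->
  0 < e -> False.
Proof.
move=> h1 h2 h3 h4 A0 n0 h5 h6 e0; rewrite ler_pdivrMr// in h1.
have l1 : 24 * nn * hi * A <= 24 * nn * hJ * A.
  by apply: ler_wpM2r; [exact: ltW|apply: ler_wpM2l => //; rewrite mulr_ge0// ltW].
have l2 : 24 * nn * hJ * A <= 24 * nn * hJ * J1.
  by apply: ler_wpM2l; [rewrite !mulr_ge0// ltW|exact: ltW].
have : 24 * nn * hJ * J1 = 24 / 2000 * (2000 * nn * J1 * hJ) by field.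
by lra.
Qed.

Section Conclusion.
Context {R : realType} {n : nat}.
Local Notation N := (n.+1%:R : R).
Local Notation vec := 'rV[R]_n.+1.
Variables (q : nat -> vec) (h : nat -> R).
Hypotheses (n_ge1 : (1 <= n)%N) (pq : placement q) (sh : sizes q h).
Hypothesis (stages : forall J, exists e' e s Jp t B, stage n_ge1 pq h J e' e s Jp t B).
Local Notation S := (system n_ge1 pq sh).
Local Notation gen := (gen q).
Local Notation X := (slit_space (@slit_space_cvg _ _ _ _ n_ge1 pq sh)).
Local Notation pt := (pt n_ge1 pq sh).
Local Notation tau0 := (@slit_tau0 R n S (@slit_space_cvg _ _ _ _ n_ge1 pq sh)).

Lemma inner_edist i (x y : inner_space S i) : edist (val x) (val y) <= mdist x y.
Proof.
rewrite -lee_fin /mdist /= /inner_space_dist fineK; first exact: edist_le_inner_dist.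
rewrite ge0_fin_numE ?inner_dist_ge0//.
by apply: inner_dist_slit_domain_lty; apply: set_mem; exact: valP.
Qed.

(** At level 0 the distance dominates the sup norm, and the projection is the limit of a
    representing sequence. *)
Lemma tau0_dist (p : X) u : gen u -> `|slit_tau0 p - u| <= mdist p (pt u).
Proof.
move=> gu; set c := completion_repr (sval p 0%N).
pose r k : vec := val (seq_of c k).
have cr : cvgn r.
  have /cauchy_mdistP cc : cauchy (seq_of c @ \oo) := set_mem (valP c).
  apply: cauchy_cvg; apply: cauchy_exP => e e0; have [m _ /(_ m (leqnn m)) ms] := cc e e0.
  exists (r m); change (\forall k \near \oo, ball (r m) e (r k)).
  apply: filterS ms => k; rewrite -ball_normE /= => /(le_lt_trans (inner_edist _ _)).
  exact: le_lt_trans (norm_le_edist _ _).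
have nr : `|r k - u| @[k --> \oo] --> `|slit_tau0 p - u|.
  by apply: cvg_norm; apply: cvgB; [exact: cr|exact: cvg_cst].
apply: le_trans (level_le 0 p (pt u)); rewrite threadE; last exact: (gen_free h gu).
rewrite -[sval p 0%N]completion_reprK completion_pi_dist -/c -(cvg_lim _ nr)//.
apply: ler_lim; [by apply/cvg_ex; eexists; exact: nr|exact: cvg_mdist_seq|].
apply: nearW => k; apply: le_trans (norm_le_edist _ _) _.
have := inner_edist (seq_of c k) (in_level n_ge1 pq sh 0 u).
by rewrite [val (in_level _ _ _ _ _)]in_levelE//; apply: free_domain; exact: (gen_free h gu).
Qed.


Lemma slits_in_slit i : slits S i = in_slit (q i) (h i).
Proof. exact: slitE. Qed.

(** Spheres inside a small ball around a deep point: the outer boundary and the first J slits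
    are too far away. *)
Lemma peripheral_near (P : set X) J e x : gen x -> deep q J e x -> peripheral_sphere P ->
  P `<=` ball (pt x) e -> P !=set0 -> exists2 i, (J <= i)%N & P = tau0 @^-1` slits S i.
Proof.
move=> gx dx sP Pb [p Pp].
have px : `|slit_tau0 p - x| < e.
  by apply: le_lt_trans (tau0_dist p gx) _; rewrite metric_sym; have := Pb p Pp; rewrite ballEmdist.
case: sP => [[i Pi]|Pd].
  exists i => //; rewrite leqNgt; apply/negP => iJ.
  have : slits S i (slit_tau0 p) by rewrite Pi in Pp.
  rewrite slits_in_slit => -[p0 _].
  have h1 := coord_dist x (slit_tau0 p) 0; rewrite p0 (distrC x (slit_tau0 p)) in h1.
  by have := lt_trans (dx.1 i iJ) (le_lt_trans h1 px); rewrite ltxx.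
have : boundary (box S) (slit_tau0 p) by rewrite Pd in Pp.
move=> /boundary_unit_box[k pk].
have := le_lt_trans (coord_dist (slit_tau0 p) x k) px; have /andP[] := dx.2 k.
by rewrite ltr_norml => ? ? /andP[? ?]; case: pk => ?; lra.
Qed.

(** Points over slit i have generic approximations near the slit, to which near_slit_dist
    applies. *)
Lemma slit_sphere_diam i : diam mdist (tau0 @^-1` slits S i : set X) <= 24 * N * h i.
Proof.
have hi := h_gt0 sh i; have N0 : 0 < N by rewrite ltr0n.
apply: diam_le => [|p r]; first by rewrite !mulr_ge0// ltW.
rewrite slits_in_slit => ps rs; apply/ler_addgt0Pr => e e0.
have d0 : 0 < Num.min (h i) (e / 2) by rewrite lt_min hi divr_gt0.
have near (p' : X) : in_slit (q i) (h i) (slit_tau0 p') -> exists u, [/\ gen u, near_slit q h i u & mdist p' (pt u) <= e / 2].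
  move=> ps'; have [u gu pu] := gen_dense p' d0; rewrite le_min in pu; case/andP: pu => pu1 pu2.
  exists u; split => //.
  have h1 := le_trans (tau0_dist p' gu) pu1.
  have h2 : `|slit_tau0 p' - q i| <= h i.
    apply: dist_le_coord => [|k]; first exact: ltW.
    by have [->|k0] := eqVneq k 0; [rewrite ps'.1 subrr normr0 ltW|exact: ps'.2].
  rewrite /near_slit; apply: le_trans (ler_distD (slit_tau0 p') u (q i)) _.
  by rewrite mulr_natl mulr2n distrC lerD.
have [u [gu nu pu]] := near p ps; have [v [gv nv rv]] := near r rs.
apply: le_trans (metric_triangle _ (pt u) _) _.
have -> : 24 * N * h i + e = e / 2 + (24 * N * h i + e / 2) by field.
apply: lerD pu _; apply: le_trans (metric_triangle _ (pt v) _) _.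
rewrite metric_sym in rv; apply: lerD rv.
apply: le_trans (near_slit_dist n_ge1 pq sh gu gv nu nv) _.
by apply: ler_wpM2r; [exact: ltW|exact: slit_const].
Qed.

Lemma middles_apart : 4^-1 <= mdist (pt (middle : vec)) (pt off_middle).
Proof.
have mb : in_box (middle : vec) by move=> k; rewrite mxE invr_gt0 ltr0n invf_lt1// ltr1n.
have ob : in_box (off_middle : vec) by apply: replace_box => //; rewrite invr_gt0 ltr0n/= invf_lt1// ltr1n.
rewrite pt_half//; last 2 first.
- by rewrite mxE.
- by rewrite replace_coordN ?second_neq0// mxE.
apply: le_trans (norm_le_edist _ _); apply: le_trans (coord_dist _ _ 0).
by rewrite replace_coordE mxE ger0_norm; lra.
Qed.

(** At a deep point of stage J the spheres in the ball of radius e'/2 are smaller than any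
    fixed fraction of e' once J exceeds the constant of porosity. *)
Lemma not_porous : ~ porous (@slit_space_cvg _ _ _ _ n_ge1 pq sh).
Proof.
move=> [A A0 H].
have [J AJ] : exists J : nat, A < J.+1%:R.
  exists (Num.truncn A); exact: truncnS_gt.
have [e' [e [s [Jp [t [B st]]]]]] := stages J.
have [e'0 e'1 _ _] := st_clear st.
have [u gu _] := gen_dense (pt (middle : vec)) (@ltr01 R).
have [x [gx dx _]] := deep_dense n_ge1 pq sh (st_clear st) gu.
have r0 : 0 < e' / 2 by rewrite divr_gt0.
have dX : e' / 2 < diam mdist [set: X].
  have md := diam_ge (E := [set: X]) (B := N + 3) (fun p r _ _ => space_diam p r) (x := pt (middle : vec)) (y := pt off_middle) I I.
  by apply: lt_le_trans md; apply: lt_le_trans middles_apart; lra.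
have [P [sP Pb Pd]] := H (pt x) (e' / 2) (introT andP (conj r0 dX)).
have [Pn|P0] := pselect (P !=set0); last first.
  have : diam mdist P <= 0 by apply: diam_le => // p r Pp; case: P0; exists p.
  by move=> /(le_trans Pd); rewrite leNgt divr_gt0.
have Pb' : P `<=` ball (pt x) e'.
  by move=> p /Pb; rewrite !ballEmdist /= => /lt_trans; apply; lra.
have [i Ji Pi] := peripheral_near gx dx sP Pb' Pn.
have := slit_sphere_diam i; rewrite -Pi => /(le_trans Pd) small.
have hJ := h_gt0 sh J; have hij := h_anti sh Ji.
have hK := st_h st; rewrite scaleE in hK.
exact: (porous_real small hij hJ AJ A0 _ hK (st_ee' st) (st_e0 st)).
Qed.

End Conclusion.

(** * Rigidity of quasisymmetric embeddings *)

(** Monotonicity of the distortion function gives the weak condition for distinct points; the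
    degenerate cases are immediate. *)
Lemma qs_wqs {R : realType} {T : metricType R} (f : T -> T) (L : R) : 0 <= L -> qs_embedding f ->
  exists2 H : R, 1 <= H & wqs f L H.
Proof.
move=> L0 [[finj _ _] [eta [eta0 eta_mono etaP]]].
exists (Num.max 1 (eta L)); first by rewrite le_max lexx.
set H := Num.max 1 (eta L); have H1 : 1 <= H by rewrite le_max lexx.
have HL : eta L <= H by rewrite le_max lexx orbT.
have H0 : 0 <= H by exact: le_trans ler01 H1.
move=> a b c abc; have [->|ab] := eqVneq a b; first by rewrite mdistxx mulr_ge0 ?mdist_ge0.
have pos (u v : T) : u != v -> 0 < mdist u v.
  by move=> uv; rewrite lt_neqAle mdist_ge0 andbT eq_sym; apply: contra uv => /eqP/mdist_positivity ->.
have bc : b != c.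
  apply/eqP => e; move: abc; rewrite e mdistxx mulr0 => le; have := pos _ _ ab.
  by rewrite e ltNge le.
have [e|ac] := eqVneq a c.
  by rewrite -e (metric_sym (f b)); apply: scale_le => //; exact: mdist_ge0.
have fbc : 0 < mdist (f b) (f c) by apply: pos; apply: contra bc => /eqP/finj ->.
rewrite -ler_pdivrMr//; apply: le_trans (etaP a b c ab bc ac) _; apply: le_trans HL.
have : mdist a b / mdist b c <= L by rewrite ler_pdivrMr ?pos.
have r0 : 0 <= mdist a b / mdist b c by rewrite divr_ge0 ?mdist_ge0.
by rewrite le_eqVlt => /predU1P[->//|lt]; exact/ltW/eta_mono.
Qed.

Lemma inv_small {R : realType} (C d : R) : 0 < d -> exists J0 : nat, forall J, (J0 <= J)%N ->
  C <= d * J.+1%:R.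
Proof.
move=> d0; exists (Num.truncn (C / d)) => J hJ.
rewrite mulrC -ler_pdivrMr//; apply: ltW; apply: (@lt_le_trans _ _ (Num.truncn (C / d)).+1%:R).
  exact: truncnS_gt.
by rewrite ler_nat ltnS.
Qed.

Lemma rigid_real {R : realFieldType} (pu ux px xfx e' h nn rho r J1 : R) :
  px <= pu + ux -> pu <= rho / 4 -> ux <= 2 * nn * e' + 8 * h -> h <= e' -> 
  xfx <= (nn + 1) * e' -> e' * J1 <= 1 -> 8 * (2 * nn + 8) <= rho * J1 -> rho <= r -> 0 < rho -> 0 <= nn -> 0 < J1 ->
  px < rho /\ xfx <= r / 8.
Proof.
move=> h1 h2 h3 h4 h5 h6 h7 h8 h9 n0 J10.
have e8 : 8 * (2 * nn + 8) * e' <= rho.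
  rewrite -(ler_pM2r J10); apply: le_trans h7.
  have -> : 8 * (2 * nn + 8) * e' * J1 = 8 * (2 * nn + 8) * (e' * J1) by ring.
  by apply: ler_piMr => //; rewrite mulr_ge0// addr_ge0// mulr_ge0.
have : (2 * nn + 8) * e' = 2 * (nn * e') + 8 * e' by ring.
have : 8 * (2 * nn + 8) * e' = 8 * ((2 * nn + 8) * e') by ring.
move: h5; rewrite mulrDl mul1r; rewrite -(mulrA 2) in h3.
have [e0|e0] := leP 0 e'; first by have := mulr_ge0 n0 e0; split; lra.
have : 0 <= nn * - e' by apply: mulr_ge0 => //; lra.
by rewrite mulrN => *; split; lra.
Qed.

Lemma return_small {R : realFieldType} (d px xfp xfx fpx : R) : d <= px + xfp ->
  xfp <= xfx + fpx -> px < d / 4 -> xfx <= d / 4 / 8 -> fpx < d / 4 -> 0 < d -> False.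
Proof. by move=> *; lra. Qed.

Section Rigidity.
Context {R : realType} {n : nat}.
Local Notation N := (n.+1%:R : R).
Local Notation vec := 'rV[R]_n.+1.
Variables (q : nat -> vec) (h : nat -> R).
Hypotheses (n_ge1 : (1 <= n)%N) (pq : placement q) (sh : sizes q h).
Hypothesis (stages : forall J, exists e' e s Jp t B, stage n_ge1 pq h J e' e s Jp t B).
Local Notation gen := (gen q).
Local Notation X := (slit_space (@slit_space_cvg _ _ _ _ n_ge1 pq sh)).
Local Notation pt := (pt n_ge1 pq sh).

Lemma stage_h J e' e s Jp t B : stage n_ge1 pq h J e' e s Jp t B -> h J <= e'.
Proof.
move=> st; have e0 := st_e0 st; have ee := st_ee' st; have := st_h st.
rewrite mulrC -ler_pdivlMr ?scale_gt0// => /le_trans; apply.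
apply: (@le_trans _ _ (e * 1)); last by lra.
apply: ler_wpM2l; first exact: ltW.
by apply: le_trans (scale_inv_le J) _; lra.
Qed.

(** Deep points near p are almost fixed at a late stage; by continuity p is fixed. *)
Lemma qs_embedding_id (f : X -> X) : qs_embedding f -> forall p, f p = p.
Proof.
move=> qsf p; have [[finj fc _] _] := qsf.
have L0 : 0 <= 4 * N by rewrite mulr_ge0.
have [H H1 fH] := qs_wqs L0 qsf.
have D0 : 0 < mdist (f (pt (middle : vec))) (f (pt off_middle)).
  rewrite lt_neqAle mdist_ge0 andbT eq_sym; apply/eqP => /mdist_positivity /finj e.
  by have := middles_apart n_ge1 pq sh; rewrite e mdistxx; apply/negP; rewrite -ltNge; lra.
apply: esym; apply: mdist_positivity; apply/eqP; rewrite eq_le mdist_ge0 andbT leNgt; apply/negP => d0.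
set d := mdist p (f p) in d0.
have d4 : 0 < d / 4 by rewrite divr_gt0.
have /cvg_ballP/(_ _ d4) /nbhs_ballP[rho0 /= rho00 near] := fc p.
pose rho := Num.min rho0 (d / 4); have rho_gt0 : 0 < rho by rewrite lt_min rho00.
have [J1 J1P] := inv_small H (@ltr01 R).
have [J2 J2P] := inv_small 1 D0.
have [J3 J3P] := inv_small (8 * (2 * N + 8)) rho_gt0.
pose J := (J1 + (J2 + J3))%N.
have Ja : (J1 <= J)%N by rewrite leq_addr.
have Jb : (J2 <= J)%N by rewrite /J addnCA leq_addr.
have Jc : (J3 <= J)%N by rewrite /J !addnA leq_addl.
have fHJ : wqs f (4 * N) J.+1%:R by apply: wqs_mono fH; have := J1P J Ja; rewrite mul1r.
have big : 1 <= J.+1%:R * mdist (f (pt (middle : vec))) (f (pt off_middle)).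
  by rewrite mulrC; exact: J2P.
have [e' [e [s [Jp [t [B st]]]]]] := stages J.
have [u gu pu] := gen_dense p (divr_gt0 rho_gt0 (ltr0n R 4)).
have [x [gx dx ux]] := deep_dense n_ge1 pq sh (st_clear st) gu.
have xfx := near_identity stages st fHJ big gx dx.
have rd : rho <= d / 4 by rewrite ge_min lexx orbT.
have [px xf8] := rigid_real (metric_triangle p (pt u) (pt x)) pu ux (stage_h st) xfx (st_e'J st)
  (J3P J Jc) rd rho_gt0 (ler0n R n.+1) (ltr0Sn R J).
have fpx : mdist (f p) (f (pt x)) < d / 4.
  have := near (pt x); rewrite !ballEmdist /=; apply.
  by apply: lt_le_trans px _; rewrite ge_min lexx.
have tri := metric_triangle p (pt x) (f p); have tri2 := metric_triangle (pt x) (f (pt x)) (f p).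
rewrite (metric_sym (f (pt x)) (f p)) in tri2.
by case: (return_small tri tri2 (lt_le_trans px rd) xf8 fpx d0).
Qed.

End Rigidity.

Theorem theorem1p6 (R : realType) (n : nat) (n_ge1 : (1 <= n)%N) :
  exists (S : slit_system R n) (Scvg : slit_dist_cvg S),
    ~ porous Scvg /\ qs_coHopfian (slit_space Scvg).
Proof.
have [q pq] := @placement_exists R n n_ge1.
have [h [sh stages]] := sizes_exist n_ge1 pq.
exists (system n_ge1 pq sh), (@slit_space_cvg _ _ _ _ n_ge1 pq sh); split.
  exact: not_porous.
move=> f qsf; apply/seteqP; split=> // p _; exists p => //.
exact: (qs_embedding_id stages qsf).
Qed.
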